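(* Let $\Phi=(\Phi^{(j)})_{j\in\mathbb{N}}$ be a conformal NIFS on $(U,X)$, with limit sets $J^{(j)}$ ($j\in\mathbb{N}$). Suppose that (i) every map $\varphi\in\bigcup_{j\in\mathbb{N}}\Phi^{(j)}$ is (the restriction to $U$ of) a Möbius transformation; (ii) there exists $\delta>0$ such that for every $j\in\mathbb{N}$ the family $\Phi^{(j)}$ contains (not necessarily distinct) maps $\varphi^{(j)}_a$ and $\varphi^{(j)}_b$ such that for some (not necessarily distinct) points $z_a,z_b\in J^{(j+1)}$ we have $|\varphi^{(j)}_a(z_a)-\varphi^{(j)}_b(z_b)|\ge\delta$; (iii) there exists $\eta>0$ such that for all $\varphi\in\bigcup_{j\in\mathbb{N}}\Phi^{(j)}$ we have $|\varphi'|\ge\eta$ on $X$. Then for every $j\in\mathbb{N}$ the closure $\overline{J^{(j)}}$ is uniformly perfect. Furthermore, for a given pair $(U,X)$, the modulus of any conformal annulus separating any of the sets $\overline{J^{(j)}}$ is bounded above by a constant depending only on $\delta$ and $\eta$.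
   Context: NIFS. Let $U\subseteq\mathbb{C}$ be non-empty, open and connected and let $X\subset U$ be compact. A non-autonomous iterated function system (NIFS) $\Phi$ on $(U,X)$ is a sequence $\Phi^{(1)},\Phi^{(2)},\dots$, where each $\Phi^{(j)}=(\varphi^{(j)}_i:U\to X)_{i\in I^{(j)}}$ is a collection of non-constant functions indexed by a non-empty set $I^{(j)}$ (of arbitrary cardinality), such that there exist $0<s<1$ and a metric $d$ on $U$, inducing the Euclidean topology on $X$, with $d(\varphi(z),\varphi(w))\le s\,d(z,w)$ for all $z,w\in X$ and all $\varphi\in\bigcup_j\Phi^{(j)}$. The NIFS is conformal if all its maps are analytic and one-to-one on $U$. Limit sets. For $j,k\in\mathbb{N}$ let $X^{(j)}_k$ be the union of the sets $\varphi^{(j)}_{\omega_1}\circ\varphi^{(j+1)}_{\omega_2}\circ\cdots\circ\varphi^{(j+k-1)}_{\omega_k}(X)$ over all $(\omega_1,\dots,\omega_k)\in I^{(j)}\times\cdots\times I^{(j+k-1)}$, and let $J^{(j)}=\bigcap_{k=1}^\infty X^{(j)}_k$. Thus $J^{(j)}$ is the limit set of the NIFS $\Phi^{(j)},\Phi^{(j+1)},\dots$. Closures are Euclidean. Annuli. A conformal annulus is a doubly connected domain $A\subset\mathbb{C}$ that can be mapped conformally onto a round annulus $\{z:r<|z-w|<R\}$ with $0<r<R<\infty$; its modulus is $\mathrm{mod}\,A=\log(R/r)$. It separates a set $F\subset\mathbb{C}$ if $F\cap A=\emptyset$ and $F$ meets both components of $\mathbb{C}\setminus A$. A compact set $F\subset\mathbb{C}$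 with at least two points is uniformly perfect if there is a uniform upper bound on the moduli of all conformal annuli which separate $F$. *)

(* Defs.v *)
From HB Require Import structures.
From mathcomp Require Import all_boot all_order all_algebra.
From mathcomp Require Import all_classical all_reals all_analysis.
From mathcomp Require Import complex.
Import Order.TTheory GRing.Theory Num.Theory numFieldNormedType.Exports.
Set Implicit Arguments.
Unset Strict Implicit.
Unset Printing Implicit Defensive.
Local Open Scope ring_scope.
Local Open Scope complex_scope.
Local Open Scope classical_set_scope.

(* The complex plane. MathComp-Analysis puts no topology on [R[i]] itself; going
   through the bundled structure provides the norm topology of a numFieldType.
   The norm [`|z|] then lives in [C R], and for [x : R] the comparison
   [x%:C <= `|z|] in [C R] is the comparison of real numbers. *)
Definition C (R : realType) : numClosedFieldType := R[i].

Section complex_analysis.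
Variable R : realType.
Implicit Types (A F U X : set (C R)) (f : C R -> C R).

Definition domain A := [/\ A !=set0, open A & connected A].

Definition analytic_on A f := forall z0, A z0 -> exists a : nat -> C R,
  \forall z \near z0, series (fun n => a n * (z - z0) ^+ n) @ \oo --> f z.

Definition conformal_on A f := analytic_on A f /\ set_inj A f.

(* [c * z + d != 0] is part of the definition since [x / 0 = 0] in MathComp. *)
Definition mobius_on A f := exists a b c d : C R, a * d - b * c != 0 /\
  forall z, A z -> c * z + d != 0 /\ f z = (a * z + b) / (c * z + d).

Definition round_annulus (w : C R) (r1 r2 : R) : set (C R) :=
  [set z | r1%:C < `|z - w| < r2%:C].

Definition components (T : topologicalType) (S : set T) : set (set T) :=
  connected_component S @` S.

Definition sphere : topologicalType := one_point_compactification (C R).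

Definition sphere_compl A : set sphere := ~` ((Some : C R -> sphere) @` A).

Definition doubly_connected A :=
  exists K1 K2, K1 <> K2 /\ components (sphere_compl A) = [set K1; K2].

(* [annulus_modulus A m]: A is a conformal annulus and m = mod A. *)
Definition annulus_modulus A (m : R) :=
  [/\ domain A, doubly_connected A &
      exists f w r1 r2, [/\ 0 < r1, r1 < r2, conformal_on A f,
        f @` A = round_annulus w r1 r2 & m = ln (r2 / r1)]].

(* The two complementary components of an annulus are those of its complement in
   the sphere: without infinity, the unbounded one may become disconnected. *)
Definition separates A F := F `&` A = set0 /\
  forall K, components (sphere_compl A) K -> exists2 z, F z & K (Some z).

Definition uniformly_perfect F :=
  [/\ compact F, exists x y, [/\ F x, F y & x <> y] &
      exists M : R, forall A m, annulus_modulus A m -> separates A F -> m <= M].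

Definition metric_on U (d : C R -> C R -> R) :=
  [/\ forall x y, U x -> U y -> 0 <= d x y,
      forall x y, U x -> U y -> (d x y = 0 <-> x = y),
      forall x y, U x -> U y -> d x y = d y x &
      forall x y z, U x -> U y -> U z -> d x z <= d x y + d y z].

(* At each point of X, d and the Euclidean metric have the same relative
   neighbourhoods in X. *)
Definition induces_euclidean_topology X (d : C R -> C R -> R) :=
  forall x, X x -> forall S : set (C R),
    (\forall y \near x, X y -> S y) <->
    (exists2 e : R, 0 < e & forall y, X y -> d x y < e -> S y).

End complex_analysis.

(* Stages are numbered from 0. A map U -> X is a total function of which only the
   values on U matter. *)
Record system (R : realType) := System {
  idx : nat -> Type;
  smap : forall j, idx j -> C R -> C R }.

Section nifs.
Variable R : realType.
Implicit Types (U X : set (C R)) (Phi : system R).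

Definition nifs U X Phi :=
  [/\ forall j, inhabited (idx Phi j),
      forall j (i : idx Phi j) z, U z -> X (smap i z),
      forall j (i : idx Phi j), exists z w, [/\ U z, U w & smap i z <> smap i w] &
      exists (s : R) (d : C R -> C R -> R),
        [/\ 0 < s < 1, metric_on U d, induces_euclidean_topology X d &
            forall j (i : idx Phi j) z w, X z -> X w ->
              d (smap i z) (smap i w) <= s * d z w]].

Definition conformal_nifs U X Phi :=
  nifs U X Phi /\ forall j (i : idx Phi j), conformal_on U (smap i).

Fixpoint word Phi (j k : nat) : Type :=
  if k is k'.+1 then (idx Phi j * word Phi j.+1 k')%type else unit.

Fixpoint word_map Phi (j k : nat) : word Phi j k -> C R -> C R :=
  if k is k'.+1 then fun w => smap w.1 \o word_map w.2 else fun=> id.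

Definition level X Phi (j k : nat) : set (C R) :=
  \bigcup_(w in [set: word Phi j k]) (word_map w @` X).

Definition limit_set X Phi (j : nat) : set (C R) :=
  \bigcap_(k in [set k | (0 < k)%N]) level X Phi j k.

Definition mobius_system U Phi :=
  forall j (i : idx Phi j), mobius_on U (smap i).

Definition limit_spread X Phi (delta : R) :=
  forall j, exists (a b : idx Phi j) (za zb : C R),
    [/\ limit_set X Phi j.+1 za, limit_set X Phi j.+1 zb &
        delta%:C <= `|smap a za - smap b zb|].

Definition derivative_bounded_below X Phi (eta : R) :=
  forall j (i : idx Phi j) z, X z -> eta%:C <= `|(smap i)^`() z|.

End nifs.

(* Main.v *)
Require Import Defs.
From mathcomp Require Import all_boot all_order all_algebra.
From mathcomp Require Import all_classical all_reals all_analysis.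
From mathcomp Require Import complex ring lra.
Import Order.TTheory GRing.Theory Num.Theory numFieldNormedType.Exports.

(** Why the theorem holds. The proof has two independent halves.

    Limit sets have no empty round annuli of large ratio around their points.
    Given a point p of a limit set J_j and a scale D < delta, p lies in the
    images of X under longer and longer prefixes of some word, and these images
    shrink because the maps contract. Take the first prefix F o phi whose image
    has diameter at most D; then F (X) is still larger than D. A Moebius map
    without pole in U has bounded distortion on X, because its pole keeps a
    positive distance from X (mobius_distortion), and phi cannot contract by
    more than the factor eta (mobius_expands). The limit set at the next stage
    contains two points at distance delta, so their images under F o phi, which
    lie in J_j and within D of p, are at a distance comparable to D. One of them
    is not much closer to p than D (limit_set_perfect).

    An annulus of large modulus separates in a round way. If an annulus A of
    modulus m has p and q on its bounded side and s on its unbounded side, then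
    m is at most a constant times |p - s| / |p - q| (modulus_bound). This is a
    Schwarz lemma for maps into the plane without p and s. On that domain there
    is an explicit metric rho of negative curvature; comparing it at the maximum
    of a quotient with a metric of the strip 0 < x < m, in the coordinate
    x = ln |f - w0| + const where f maps A onto a round annulus, gives that the
    middle curve of A has rho-length at most a constant over m (ahlfors_bound).
    The curve separates p from s, so it meets the segment [p, s], and near that
    segment rho is bounded below; hence for large m the whole curve lies in a
    disc too small to contain both p and q. The one outside can then escape to
    infinity without meeting the curve, although it lies on the bounded side
    (circle_separates).

    Together: let p be a point of the closed limit set on the bounded side, and
    s the nearest one on the other side. The first half yields a point q of the
    limit set closer to p than s but not much closer. It has to be on the side
    of p, and the second half bounds the modulus.

    The complex analysis is reduced to one estimate, taylor_rem_lip, on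
    differences of the Taylor remainder. It provides derivatives and second-order
    expansions, the local inverse, and the absence of critical points of an
    injective analytic function. Laplacians appear only as the coefficient of
    |h|^2 in a second-order expansion (rjet). *)

Set Implicit Arguments.
Unset Strict Implicit.
Unset Printing Implicit Defensive.
Local Open Scope ring_scope.
Local Open Scope complex_scope.
Local Open Scope classical_set_scope.

(** * The absolute value of a complex number as a real number *)

Section cabs.
Variable R : realType.
Implicit Types (z w : C R) (x y e : R).

(** The norm of [C R] takes its values in [C R] itself. Estimates are carried out
    in [R]. *)
Definition cabs z : R := complex.Re `|z|.

Lemma cabsE z : `|z| = (cabs z)%:C :> C R.
Proof. by rewrite /cabs RRe_real // normr_real. Qed.

Lemma cabs_ge0 z : 0 <= cabs z.
Proof. by have := normr_ge0 z; rewrite cabsE ler0c. Qed.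

Lemma cabs0 : cabs 0 = 0. Proof. by rewrite /cabs normr0. Qed.

Lemma cabs1 : cabs 1 = 1. Proof. by rewrite /cabs normr1. Qed.

Lemma cabs_eq0 z : (cabs z == 0) = (z == 0).
Proof. by rewrite -(normr_eq0 z) cabsE; apply/eqP/eqP => [->//|[]]. Qed.

Lemma cabs_gt0 z : (0 < cabs z) = (z != 0).
Proof. by rewrite lt_def cabs_ge0 andbT cabs_eq0. Qed.

Lemma cabsM z w : cabs (z * w) = cabs z * cabs w.
Proof. by rewrite {1}/cabs normrM !cabsE -rmorphM. Qed.

Lemma cabsX z n : cabs (z ^+ n) = cabs z ^+ n.
Proof. by elim: n => [|n IH]; rewrite ?expr0 ?cabs1 // !exprS cabsM IH. Qed.

Lemma cabsN z : cabs (- z) = cabs z. Proof. by rewrite /cabs normrN. Qed.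

Lemma cabsB z w : cabs (z - w) = cabs (w - z).
Proof. by rewrite -cabsN opprB. Qed.

Lemma cabsD z w : cabs (z + w) <= cabs z + cabs w.
Proof. by have := ler_normD z w; rewrite !cabsE -rmorphD lecR. Qed.

Lemma cabs_tri (v z w : C R) : cabs (z - w) <= cabs (z - v) + cabs (v - w).
Proof. by rewrite (le_trans _ (cabsD _ _)) // addrA subrK. Qed.

Lemma cabs_subl z w : cabs z - cabs w <= cabs (z - w).
Proof. by rewrite lerBlDr (le_trans _ (cabsD _ _)) // subrK. Qed.

Lemma cabs_dist z w : `|cabs z - cabs w| <= cabs (z - w).
Proof.
rewrite ler_norml cabs_subl andbT lerNl opprB (cabsB z); exact: cabs_subl.
Qed.

Lemma cabsV z : cabs z^-1 = (cabs z)^-1.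
Proof.
have [->|z0] := eqVneq z 0; first by rewrite invr0 cabs0 invr0.
apply: (@mulfI _ (cabs z)); first by rewrite cabs_eq0.
by rewrite -cabsM divff // divff ?cabs1 // cabs_eq0.
Qed.

Lemma cabs_div z w : cabs (z / w) = cabs z / cabs w.
Proof. by rewrite cabsM cabsV. Qed.

Lemma cabs_real x : cabs (x%:C : C R) = `|x|.
Proof. by rewrite /cabs normc_def /= expr0n /= addr0 sqrtr_sqr. Qed.

Lemma cabs_i : cabs ('i : C R) = 1.
Proof. by rewrite /cabs normc_def /= expr0n /= add0r sqrtr_sqr normr1. Qed.

Lemma cabs_sqr z : cabs z ^+ 2 = complex.Re z ^+ 2 + complex.Im z ^+ 2.
Proof. by have := add_Re2_Im2 z; rewrite cabsE -rmorphXn => -[]. Qed.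

Lemma normRe_le z : `|complex.Re z| <= cabs z.
Proof. by have := normc_ge_Re z; rewrite cabsE lecR. Qed.

Lemma ReD z w : complex.Re (z + w) = complex.Re z + complex.Re w.
Proof. by case: z w => [? ?] [? ?]. Qed.

Lemma ReN z : complex.Re (- z) = - complex.Re z.
Proof. by case: z. Qed.

Lemma cabs_le_ReIm z : cabs z <= `|complex.Re z| + `|complex.Im z|.
Proof.
have h2 : cabs z ^+ 2 <= (`|complex.Re z| + `|complex.Im z|) ^+ 2.
  rewrite cabs_sqr sqrrD !real_normK ?num_real //.
  by rewrite lerD2r lerDl mulrn_wge0 // mulr_ge0.
by rewrite ler_sqr ?nnegrE ?cabs_ge0 ?addr_ge0 in h2.
Qed.

Lemma cabs_nat n : cabs (n%:R : C R) = n%:R.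
Proof. by rewrite -(rmorph_nat (real_complex R)) cabs_real normr_nat. Qed.

Lemma nbhsC z0 (P : set (C R)) :
  nbhs z0 P <-> exists2 e : R, 0 < e & forall z, cabs (z - z0) < e -> P z.
Proof.
split.
  move=> /nbhs_ballP[e e0 He]; exists (complex.Re e).
    by move: e0; rewrite /= ltcE /= => /andP[].
  move=> z Hz; apply: He; rewrite /ball /= cabsE cabsB.
  move: e0; rewrite /= !ltcE /= => /andP[/eqP -> _].
  by rewrite eqxx.
move=> [e e0 He]; apply/nbhs_ballP; exists e%:C; first by rewrite /= ltcR.
by move=> z; rewrite /ball /= cabsE ltcR cabsB; exact: He.
Qed.

Lemma nearC z0 (P : set (C R)) :
  (\forall z \near z0, P z) <->
  exists2 e : R, 0 < e & forall z, cabs (z - z0) < e -> P z.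
Proof. exact: nbhsC. Qed.

Lemma openC (A : set (C R)) : open A <->
  forall z0, A z0 -> exists2 e : R, 0 < e & forall z, cabs (z - z0) < e -> A z.
Proof.
rewrite openE; split => H z0 Az0; first by apply/nbhsC; exact: H.
by apply/nbhsC; exact: H.
Qed.

Lemma nearR (t0 : R) (P : set R) :
  (\forall t \near t0, P t) <->
  exists2 e : R, 0 < e & forall t, `|t - t0| < e -> P t.
Proof.
split.
  by move=> /nbhs_ballP[e e0 He]; exists e => // t ht; apply: He; rewrite /ball /= distrC.
move=> [e e0 He]; apply/nbhs_ballP; exists e => // t; rewrite /ball /= distrC; exact: He.
Qed.

Lemma cvgCR (T : Type) (F : set_system T) {FF : Filter F} (f : T -> R) l :
  (forall e, 0 < e -> \forall t \near F, `|f t - l| < e) -> f @ F --> l.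
Proof.
move=> H; apply/cvgrPdist_lt => e e0; near=> t; rewrite distrC; near: t; exact: H.
Unshelve. all: by end_near. Qed.

Lemma cvgCC (T : Type) (F : set_system T) {FF : Filter F} (f : T -> C R) l :
  f @ F --> l <->
  (forall e : R, 0 < e -> \forall t \near F, cabs (f t - l) < e).
Proof.
split.
  move=> H e e0; have : nbhs l [set z | cabs (z - l) < e].
    by apply/nbhsC; exists e.
  by move=> /H.
move=> H P /nbhsC[e e0 He]; rewrite /nbhs /=.
have := H e e0; apply: filterS => t; exact: He.
Qed.

Lemma within_continuousC (A : set (C R)) (G : C R -> R) :
  (forall h, A h -> forall e : R, 0 < e -> exists2 d : R, 0 < d &
    forall k, A k -> cabs (k - h) < d -> `|G k - G h| < e) ->
  {within A, continuous G}.
Proof.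
move=> H; apply/subspace_continuousP => h Ah.
apply: cvgCR => e e0; rewrite /= near_withinE; apply/nearC.
by have [d d0 Hd] := H h Ah e e0; exists d => // k hk Ak; exact: Hd.
Qed.

End cabs.

(** * Lipschitz estimates for power series *)

Section powerseries.
Variable R : realType.
Implicit Types (z w h k : C R) (a : nat -> C R).

Lemma cabs_expB h k (t : R) n : cabs h <= t -> cabs k <= t ->
  cabs (h ^+ n - k ^+ n) <= n%:R * t ^+ n.-1 * cabs (h - k).
Proof.
move=> ht kt; have t0 : 0 <= t := le_trans (cabs_ge0 h) ht.
elim: n => [|n IH]; first by rewrite !expr0 subrr cabs0 !mul0r.
have -> : h ^+ n.+1 - k ^+ n.+1 = h * (h ^+ n - k ^+ n) + (h - k) * k ^+ n.
  by rewrite !exprS; ring.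
apply: le_trans (cabsD _ _) _; rewrite !cabsM cabsX.
have -> : n.+1%:R * t ^+ n.+1.-1 * cabs (h - k) =
   t * (n%:R * t ^+ n.-1 * cabs (h - k)) + cabs (h - k) * t ^+ n.
  case: n {IH} => [|n]; first by rewrite /= !expr0; ring.
  by rewrite /= -[n.+2]addn1 natrD exprS; ring.
apply: lerD; first by apply: ler_pM => //; exact: cabs_ge0.
by rewrite ler_wpM2l ?cabs_ge0 // lerXn2r ?nnegrE ?cabs_ge0.
Qed.

Lemma cvg_series_terms_bounded a (z l : C R) :
  series (fun n => a n * z ^+ n) @ \oo --> l ->
  exists2 B : R, 0 < B & forall n, cabs (a n) * cabs z ^+ n <= B.
Proof.
move=> /cvgCC /(_ 1 ltr01) [n0 _ H].
exists (2 + \sum_(i < n0) cabs (a i) * cabs z ^+ i).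
  by rewrite ltr_pwDl // sumr_ge0 // => i _; rewrite mulr_ge0 ?exprn_ge0 ?cabs_ge0.
move=> n; have [nn0|n0n] := ltnP n n0.
  rewrite (bigD1 (Ordinal nn0)) //= addrCA lerDl addr_ge0 // sumr_ge0 // => i _.
  by rewrite mulr_ge0 ?exprn_ge0 ?cabs_ge0.
apply: ler_wpDr.
  by rewrite sumr_ge0 // => i _; rewrite mulr_ge0 ?exprn_ge0 ?cabs_ge0.
have /= H1 := H n n0n; have /= H2 := H n.+1 (leqW n0n).
rewrite -cabsX -cabsM.
have -> : a n * z ^+ n = series (fun n => a n * z ^+ n) n.+1 - series (fun n => a n * z ^+ n) n.
  by rewrite seriesSB.
have := cabs_tri l (series (fun n => a n * z ^+ n) n.+1) (series (fun n => a n * z ^+ n) n).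
rewrite (cabsB l); move: H1 H2 => /=; lra.
Qed.

Definition taylor_rem (f : C R -> C R) (a : nat -> C R) z0 (N : nat) h :=
  f (z0 + h) - \sum_(i < N.+1) a i * h ^+ i.

(** The coefficients are bounded by a multiple of [p ^- n] as soon as the series
    converges at distance [p]; for arguments of size at most [p / 4] the increments
    [h ^+ n - k ^+ n] then sum to a geometric series. Bounding increments instead of
    values gives derivatives, jets and local inverses without summing the
    differentiated series. *)
Lemma taylor_rem_lip (f : C R -> C R) a z0 :
  (\forall z \near z0, series (fun n => a n * (z - z0) ^+ n) @ \oo --> f z) ->
  exists2 r : R, 0 < r & forall N, exists2 B : R, 0 <= B &
   forall h k t, t <= r -> cabs h <= t -> cabs k <= t ->
   cabs (taylor_rem f a z0 N h - taylor_rem f a z0 N k) <= B * t ^+ N * cabs (h - k).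
Proof.
move=> /nearC[e e0 He].
pose p := e / 2; have p0 : 0 < p by rewrite divr_gt0.
have pC : cabs (p%:C : C R) = p by rewrite cabs_real gtr0_norm.
have : series (fun n => a n * p%:C ^+ n) @ \oo --> f (z0 + p%:C).
  have := He (z0 + p%:C); rewrite (addrC z0) addrK pC; apply.
  by rewrite /p; lra.
move=> /cvg_series_terms_bounded[B B0 HB]; rewrite pC in HB.
(* The ratio [4] leaves [2 ^- i] after absorbing [N.+1 + i <= N.+1 * 2 ^ i]. *)
exists (p / 4); first by rewrite divr_gt0.
move=> N; exists (2 * (B * N.+1%:R / p ^+ N.+1)).
  by rewrite !mulr_ge0 ?invr_ge0 ?exprn_ge0 // ltW.
move=> h k t tr ht kt; have t0 : 0 <= t := le_trans (cabs_ge0 h) ht.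
have S h' : cabs h' <= t -> series (fun n => a n * h' ^+ n) @ \oo --> f (z0 + h').
  move=> h't; have := He (z0 + h'); rewrite (addrC z0) addrK; apply.
  by rewrite (le_lt_trans (le_trans h't tr)) // /p; lra.
set c := B * N.+1%:R / p ^+ N.+1 * t ^+ N * cabs (h - k).
have c0 : 0 <= c.
  rewrite /c !mulr_ge0 ?cabs_ge0 ?exprn_ge0 ?invr_ge0 ?exprn_ge0 //; exact: ltW.
pose D M : C R := \sum_(i < M) a i * (h ^+ i - k ^+ i).
have step i : cabs (a (N.+1 + i)%N * (h ^+ (N.+1 + i) - k ^+ (N.+1 + i))) <= c / 2 ^+ i.
  rewrite cabsM; apply: le_trans (ler_wpM2l (cabs_ge0 _) (cabs_expB _ ht kt)) _.
  have ha : cabs (a (N.+1 + i)%N) <= B / p ^+ (N.+1 + i).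
    by rewrite ler_pdivlMr ?exprn_gt0.
  apply: le_trans (ler_wpM2r _ ha) _.
    by rewrite !mulr_ge0 ?exprn_ge0 ?cabs_ge0.
  have -> : c / 2 ^+ i = B / p ^+ (N.+1 + i) * ((N.+1%:R * 2 ^+ i * (t ^+ N * (p / 4) ^+ i)) * cabs (h - k)).
    have e4 : (p / 4) ^+ i = p ^+ i / (2 ^+ i * 2 ^+ i).
      by rewrite expr_div_n -exprMn -natrM.
    rewrite e4 /c exprD; set q1 := p ^+ N.+1; set q2 := p ^+ i; set d := _ ^+ i.
    have q10 : q1 != 0 by rewrite expf_neq0 // lt0r_neq0.
    have q20 : q2 != 0 by rewrite expf_neq0 // lt0r_neq0.
    have d0 : d != 0 by rewrite expf_neq0.
    by field; rewrite q10 q20 d0.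
  apply: ler_wpM2l; first by rewrite divr_ge0 ?exprn_ge0 // ltW.
  apply: ler_wpM2r; first exact: cabs_ge0.
  apply: ler_pM => //; first by rewrite exprn_ge0.
    rewrite -natrX -natrM ler_nat.
    have i2 : (i < 2 ^ i)%N by exact: ltn_expl.
    by rewrite (leq_trans _ (leq_mul (leqnn N.+1) i2)) // mulnS leq_add2l leq_pmull.
  rewrite addSn /= exprD; apply: ler_wpM2l; first by rewrite exprn_ge0.
  by rewrite lerXn2r ?nnegrE // ltW // divr_gt0.
have bnd M : cabs (D (N.+1 + M)%N - D N.+1) <= c * (2 - 2 / 2 ^+ M).
  elim: M => [|M IH]; first by rewrite addn0 subrr cabs0 expr0 divr1 subrr mulr0.
  rewrite addnS {1}/D big_ord_recr /= -/(D _) addrAC.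
  apply: le_trans (cabsD _ _) _.
  apply: le_trans (lerD IH (step M)) _.
  rewrite -mulrDr ler_wpM2l //.
  have -> : (2:R) ^- M = 2 * 2 ^- M.+1.
    by rewrite exprS; field; rewrite expf_neq0.
  by rewrite le_eqVlt; apply/orP; left; apply/eqP; ring.
have bnd' M : (N.+1 <= M)%N -> cabs (D M - D N.+1) <= c * 2.
  move=> NM; rewrite -(subnKC NM); apply: le_trans (bnd _) _.
  by rewrite ler_wpM2l // gerBl divr_ge0 // exprn_ge0.
have -> : taylor_rem f a z0 N h - taylor_rem f a z0 N k = f (z0 + h) - f (z0 + k) - D N.+1.
  rewrite /taylor_rem /D; under [X in _ = _ - X]eq_bigr do rewrite mulrBr.
  by rewrite sumrB; ring.
have -> : 2 * (B * N.+1%:R / p ^+ N.+1) * t ^+ N * cabs (h - k) = c * 2 by rewrite /c; ring.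
apply/ler_addgt0Pr => eps eps0.
have e20 : 0 < eps / 2 by rewrite divr_gt0.
have /cvgCC /(_ _ e20)[n1 _ H1] := S _ ht.
have /cvgCC /(_ _ e20)[n2 _ H2] := S _ kt.
pose M := maxn N.+1 (maxn n1 n2).
have /H1 /= h1 : (n1 <= M)%N by rewrite /M !leq_max leqnn !orbT.
have /H2 /= h2 : (n2 <= M)%N by rewrite /M !leq_max leqnn !orbT.
have := bnd' M (leq_maxl _ _).
have E h' : series (fun n => a n * h' ^+ n) M = \sum_(i < M) a i * h' ^+ i.
  by rewrite /series /= big_mkord.
rewrite !E in h1 h2.
set Sh := \sum_(i < M) a i * h ^+ i in h1 *.
set Sk := \sum_(i < M) a i * k ^+ i in h2 *.
have -> : D M = Sh - Sk.
  by rewrite /D /Sh /Sk -sumrB; apply: eq_bigr => i _; rewrite mulrBr.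
move=> h3.
have -> : f (z0 + h) - f (z0 + k) - D N.+1 = (Sh - Sk - D N.+1) + ((f (z0 + h) - Sh) + (Sk - f (z0 + k))).
  by ring.
apply: le_trans (cabsD _ _) _; rewrite lerD //.
apply: le_trans (cabsD _ _) _; rewrite (cabsB (f _)); lra.
Qed.

End powerseries.

(** * Compact discs and local surjectivity *)

Section localtheory.
Variable R : realType.
Implicit Types (z w h k u v a : C R).

(** The set is a closed subset of the image of a square of the real plane. *)
Lemma closed_bounded_compact (A : set (C R)) (r : R) :
  closed A -> (forall z, A z -> cabs z <= r) -> compact A.
Proof.
move=> cA bA.
pose g (x : R * R) : C R := x.1 +i* x.2.
have cg : continuous g.
  move=> [x y]; apply/cvgCC => e e0.
  have e20 : 0 < e / 2 by rewrite divr_gt0.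
  near=> p; rewrite (le_lt_trans (cabs_le_ReIm _)) //=.
  have h1 : `|p.1 - x| < e / 2.
    near: p; apply: (@cvg_fst _ _ (nbhs x) (nbhs y) _ [set t | `|t - x| < e / 2]).
    by apply/nearR; exists (e / 2).
  have h2 : `|p.2 - y| < e / 2.
    near: p; apply: (@cvg_snd _ _ (nbhs x) (nbhs y) _ [set t | `|t - y| < e / 2]).
    by apply/nearR; exists (e / 2).
  lra.
have cs := @segment_compact R (- r) r.
have cK : compact (g @` (`[- r, r] `*` `[- r, r])).
  by apply: continuous_compact; [exact: continuous_subspaceT|exact: compact_setX].
apply: subclosed_compact cA cK _ => z Az.
have zr := bA z Az.
exists (complex.Re z, complex.Im z); last by case: (z).
have hR := normRe_le z.
have hI : `|complex.Im z| <= cabs z.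
  rewrite -ler_sqr ?nnegrE ?cabs_ge0 // cabs_sqr real_normK ?num_real //.
  by rewrite lerDr sqr_ge0.
split; rewrite /= in_itv /= -ler_norml; lra.
Unshelve. all: by end_near. Qed.

Lemma closed_disc w (r : R) : closed [set z | cabs (z - w) <= r].
Proof.
rewrite -[X in closed X]setCK closedC; apply/openC => z /= /negP.
rewrite -ltNge => h; exists (cabs (z - w) - r); first by rewrite subr_gt0.
move=> z' hz'; apply/negP; rewrite -ltNge.
have := cabs_tri z' z w; rewrite (cabsB z z'); lra.
Qed.

Lemma compact_disc w (r : R) : compact [set z | cabs (z - w) <= r].
Proof.
apply: (@closed_bounded_compact _ (r + cabs w)); first exact: closed_disc.
by move=> z /= h; rewrite -lerBlDr; exact: le_trans (cabs_subl _ _) h.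
Qed.

(** Minimise [cabs (F - y)] over the closed disc. On its boundary the value exceeds
    the one at the centre, so the minimum is interior; a nonzero minimum could be
    lowered by a step in the direction [(y - F) / a]. *)
Lemma lip_open (F : C R -> C R) z0 a (r : R) : 0 < r -> a != 0 ->
  (forall h k, cabs h <= r -> cabs k <= r ->
   cabs (F (z0 + h) - F (z0 + k) - a * (h - k)) <= cabs a / 2 * cabs (h - k)) ->
  forall y, cabs (y - F z0) < cabs a * r / 4 -> exists2 h, cabs h < r & F (z0 + h) = y.
Proof.
move=> r0 a0 H y Hy.
have aa0 : 0 < cabs a by rewrite cabs_gt0.
have H0 h : cabs h <= r -> cabs a / 2 * cabs h <= cabs (F (z0 + h) - F z0).
  move=> hr; have := H h 0 hr; rewrite cabs0 !addr0 !subr0 => /(_ (ltW r0)).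
  have := cabs_subl (a * h) (a * h - (F (z0 + h) - F z0)).
  rewrite subKr cabsM (cabsB (a * h)); lra.
pose G h : R := cabs (F (z0 + h) - y).
have cG : {within [set h | cabs (h - 0) <= r], continuous G}.
  apply: within_continuousC => h; rewrite /= subr0 => hr e e0.
  exists (e / (2 * cabs a)); first by rewrite divr_gt0 // mulr_gt0.
  move=> k; rewrite /= subr0 => kr hk.
  have /= := H k h kr hr.
  have : cabs (k - h) * (2 * cabs a) < e by rewrite -ltr_pdivlMr // mulr_gt0.
  move=> h1 h2; rewrite /G.
  have h3 : cabs (F (z0 + k) - F (z0 + h)) < e.
    have := cabsD (F (z0 + k) - F (z0 + h) - a * (k - h)) (a * (k - h)).
    rewrite subrK cabsM; lra.
  rewrite (le_lt_trans (cabs_dist _ _)) //.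
  by rewrite opprB addrA subrK.
have ne : [set h | cabs (h - 0) <= r] !=set0.
  by exists 0 => /=; rewrite subrr cabs0 ltW.
have [c] := compact_EVT_min ne (@compact_disc 0 r) cG.
rewrite inE /= subr0 => cr cmin.
have {}cmin h : cabs h <= r -> G c <= G h.
  by move=> hr; apply: cmin; rewrite inE /= subr0.
have G0 := cmin 0; rewrite cabs0 in G0; have {}G0 := G0 (ltW r0).
rewrite {2}/G addr0 cabsB in G0.
have cr' : cabs c < r.
  rewrite lt_neqAle cr andbT; apply/eqP => ce.
  have := H0 c cr; have := cabsD (F (z0 + c) - y) (y - F z0).
  rewrite addrA subrK ce -/(G c).
  move: (G c) (cabs (F (z0 + c) - F z0)) (cabs (y - F z0)) Hy G0 => g1 g2 g3 .
  lra.
exists c => //; apply/eqP; rewrite -subr_eq0 -cabs_eq0 -/(G c).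
apply/eqP/le_anti; rewrite cabs_ge0 andbT leNgt; apply/negP => Gc.
(* The step [d] makes [a * d] a fraction [t] of the missing [y - F (z0 + c)], small
   enough to stay in the disc. *)
pose t := Num.min 1 ((r - cabs c) * cabs a / G c).
have t0 : 0 < t.
  by rewrite lt_min ltr01 divr_gt0 // mulr_gt0 // subr_gt0.
have t1 : t <= 1 by rewrite ge_min lexx.
pose d : C R := t%:C * (y - F (z0 + c)) / a.
have Ed : cabs d = t * G c / cabs a.
  by rewrite /d cabs_div cabsM cabs_real gtr0_norm // cabsB.
have cdr : cabs (c + d) <= r.
  apply: le_trans (cabsD _ _) _; rewrite Ed -lerBrDl ler_pdivrMr // -ler_pdivlMr //.
  by rewrite ge_min lexx orbT.
have := H (c + d) c cdr cr.
have := cmin _ cdr.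
have -> : c + d - c = d by rewrite addrAC subrr add0r.
have -> : a * d = t%:C * (y - F (z0 + c)) by rewrite /d mulrC divfK.
rewrite {2}/G Ed.
have -> : F (z0 + (c + d)) - y = (F (z0 + (c + d)) - F (z0 + c) - t%:C * (y - F (z0 + c))) + (1 - t)%:C * (F (z0 + c) - y).
  by rewrite rmorphB rmorph1; ring.
move=> h1 h2; have := le_trans h1 (cabsD _ _).
rewrite cabsM cabs_real ger0_norm ?subr_ge0 // -/(G c).
have E2 : cabs a / 2 * (t * G c / cabs a) = t * G c / 2.
  by field; exact: lt0r_neq0.
rewrite E2 in h2; move=> h3.
have tG : 0 < t * G c by exact: mulr_gt0.
move: h2 h3 tG; rewrite /= mulrBl mul1r.
move: (cabs _) (t * G c) (G c) => A B D; lra.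
Qed.

End localtheory.

(** * Injective analytic functions have no critical points *)

Section critical.
Variable R : realType.
Implicit Types (z w h k u v : C R) (a : nat -> C R).

Lemma cabs_expB2 k u v (s t : R) n : 0 <= s ->
  cabs u <= s -> cabs v <= s -> cabs k + s <= t ->
  cabs ((k + u) ^+ n - (k + v) ^+ n - n%:R * k ^+ n.-1 * (u - v))
   <= n%:R ^+ 2 * s * t ^+ n.-2 * cabs (u - v).
Proof.
move=> s0 us vs kst.
have kt : cabs k <= t by rewrite (le_trans _ kst) // lerDl.
have t0 : 0 <= t := le_trans (cabs_ge0 k) kt.
have kut : cabs (k + u) <= t by rewrite (le_trans (cabsD _ _)) // (le_trans _ kst) // lerD2l.
have kvt : cabs (k + v) <= t by rewrite (le_trans (cabsD _ _)) // (le_trans _ kst) // lerD2l.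
elim: n => [|n IH].
  by rewrite !expr0 subrr expr2 !mul0r subr0 cabs0.
have -> : (k + u) ^+ n.+1 - (k + v) ^+ n.+1 - n.+1%:R * k ^+ n.+1.-1 * (u - v) =
  k * ((k + u) ^+ n - (k + v) ^+ n - n%:R * k ^+ n.-1 * (u - v)) +
  (u * ((k + u) ^+ n - (k + v) ^+ n) + (u - v) * ((k + v) ^+ n - k ^+ n)).
  case: n {IH} => [|n].
    rewrite /= !expr0 !expr1 !mul0r.
    ring.
  have -> : n.+2%:R = n.+1%:R + 1 :> C R by rewrite -natr1.
  by rewrite /= !exprS; ring.
have h1 := cabs_expB n kut kvt.
have h2 := cabs_expB n kvt kt.
have e1 : k + u - (k + v) = u - v by ring.
have e2 : k + v - k = v by ring.
rewrite e1 in h1; rewrite e2 in h2.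
apply: le_trans (cabsD _ _) _; rewrite cabsM.
have T1 : cabs (u * ((k + u) ^+ n - (k + v) ^+ n) + (u - v) * ((k + v) ^+ n - k ^+ n))
   <= 2 * n%:R * s * t ^+ n.-1 * cabs (u - v).
  apply: le_trans (cabsD _ _) _; rewrite !cabsM.
  have g1 : cabs u * cabs ((k + u) ^+ n - (k + v) ^+ n) <= s * (n%:R * t ^+ n.-1 * cabs (u - v)).
    by apply: ler_pM => //; exact: cabs_ge0.
  have g2 : cabs (u - v) * cabs ((k + v) ^+ n - k ^+ n) <= cabs (u - v) * (n%:R * t ^+ n.-1 * s).
    rewrite ler_wpM2l ?cabs_ge0 // (le_trans h2) // ler_wpM2l //.
    by rewrite mulr_ge0 // exprn_ge0.
  apply: le_trans (lerD g1 g2) _.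
  by rewrite le_eqVlt; apply/orP; left; apply/eqP; ring.
case: n IH h1 h2 T1 => [|[|n]] IH h1 h2 T1.
- rewrite (_ : _ - _ - _ = 0) ?cabs0 ?mulr0 ?add0r; last by rewrite !expr0 mul0r; ring.
  apply: le_trans T1 _.
  by rewrite !(mulr0, mul0r) !mulr_ge0 ?cabs_ge0.
- rewrite (_ : _ - _ - _ = 0) ?cabs0 ?mulr0 ?add0r; last by rewrite /= !expr1 expr0; ring.
  apply: le_trans T1 _; rewrite /= !expr0 !mulr1.
  rewrite ler_wpM2r ?cabs_ge0 // ler_wpM2r //.
  by rewrite -natrX ler_nat.
have g0 : cabs k * cabs ((k + u) ^+ n.+2 - (k + v) ^+ n.+2 - n.+2%:R * k ^+ n.+2.-1 * (u - v))
  <= t * (n.+2%:R ^+ 2 * s * t ^+ n * cabs (u - v)).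
  by apply: ler_pM => //; exact: cabs_ge0.
apply: le_trans (lerD g0 T1) _ => /=.
have -> : t * (n.+2%:R ^+ 2 * s * t ^+ n * cabs (u - v)) +
   2 * n.+2%:R * s * t ^+ n.+1 * cabs (u - v) =
  (n.+2%:R ^+ 2 + 2 * n.+2%:R) * (s * t ^+ n.+1 * cabs (u - v)).
  by rewrite (exprS t); ring.
have -> : n.+3%:R ^+ 2 * s * t ^+ n.+1 * cabs (u - v) =
  n.+3%:R ^+ 2 * (s * t ^+ n.+1 * cabs (u - v)) by ring.
apply: ler_wpM2r; first by rewrite !mulr_ge0 ?exprn_ge0 ?cabs_ge0.
have -> : n.+3%:R = n.+2%:R + 1 :> R by rewrite -natr1.
set q := n.+2%:R; rewrite sqrrD1 mulr_natl mulr2n; lra.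
Qed.

(** A root of [1 + x + ... + x ^ (n - 1)] works, since [1] is not one. *)
Lemma unity_root_neq1 n : (1 < n)%N -> exists2 w : C R, w ^+ n = 1 & w != 1.
Proof.
case: n => [|[|n]] // _.
have [w Hw] := @solve_monicpoly (C R) n.+1 (fun=> -1) isT.
have S0 : \sum_(i < n.+2) w ^+ i = 0.
  rewrite big_ord_recr /= Hw -big_split /= big1 // => i _.
  by rewrite mulN1r subrr.
exists w.
  by apply/eqP; rewrite -subr_eq0 subrX1 S0 mulr0.
apply/eqP => w1; move: S0; rewrite w1.
under eq_bigr do rewrite expr1n.
by rewrite sumr_const card_ord => /eqP; rewrite pnatr_eq0.
Qed.

(** If [f - f z0] vanished to order [N >= 2], then [h] and [w * h] with [w ^+ N = 1]
    would have almost the same image under [f]. By [lip_open] a correction of [w * h]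
    much smaller than [h] gives it exactly the image of [h]. *)
Lemma inj_coef_neq0 (f : C R -> C R) a z0 (A : set (C R)) :
  open A -> A z0 -> set_inj A f ->
  (\forall z \near z0, series (fun n => a n * (z - z0) ^+ n) @ \oo --> f z) ->
  a 1%N != 0.
Proof.
move=> oA Az0 injf serf; apply/negP => /eqP a10.
have [r r0 Hr] := taylor_rem_lip serf.
have [rA rA0 HA] := (openC A).1 oA z0 Az0.
have [N [N1 aN0 aN]] : exists N, [/\ (1 < N)%N, a N != 0 & forall i, (0 < i < N)%N -> a i = 0].
  have [[n [n0 an0]]|Hn] := pselect (exists n, (0 < n)%N /\ a n != 0).
    have ex : exists n, (0 < n)%N && (a n != 0) by exists n; rewrite n0.
    case: (ex_minnP ex) => N /andP[N0 aN0] Nmin; exists N; split => //.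
      case: N N0 aN0 {Nmin} => [|[|N]] //; by rewrite a10 eqxx.
    move=> i /andP[i0 iN]; apply/eqP/negPn/negP => ai0.
    by have := Nmin i; rewrite i0 ai0 leqNgt iN => /(_ isT).
  have a0 n : (0 < n)%N -> a n = 0.
    by move=> n0; apply/eqP/negPn/negP => an; apply: Hn; exists n.
  exfalso; move: serf => /nearC[e e0 He].
  have cst z : cabs (z - z0) < e -> f z = a 0%N.
    move=> /He /cvgCC H; apply/eqP; rewrite eq_sym -subr_eq0 -cabs_eq0; apply/eqP/le_anti.
    rewrite cabs_ge0 andbT; apply/ler_addgt0Pr => eps eps0; rewrite add0r.
    have [n0 _ /(_ n0.+1 (leqnSn _))] := H eps eps0.
    rewrite /= /series /= big_mkord big_ord_recl /= expr0 mulr1 big1 ?addr0.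
      by move/ltW.
    by move=> i _; rewrite a0 ?mul0r.
  pose p := Num.min e rA / 2.
  have p0 : 0 < p by rewrite divr_gt0 // lt_min e0.
  have pe : p < e by rewrite (@lt_le_trans _ _ (Num.min e rA)) ?ge_min ?lexx // /p ltr_pdivrMr // ltr_pMr ?ltr1n // lt_min e0.
  have pA : p < rA by rewrite (@lt_le_trans _ _ (Num.min e rA)) ?ge_min ?lexx ?orbT // /p ltr_pdivrMr // ltr_pMr ?ltr1n // lt_min e0.
  have pC : cabs (z0 + p%:C - z0) = p by rewrite (addrC z0) addrK cabs_real gtr0_norm.
  have : f (z0 + p%:C) = f z0.
    by rewrite !cst ?subrr ?cabs0 ?pC.
  move/(injf _ _ (mem_set _) (mem_set Az0)) => /(_ (HA _ _)).
  rewrite pC => /(_ pA) /eqP; rewrite -subr_eq0 -cabs_eq0 pC => /eqP p00.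
  by rewrite p00 ltxx in p0.
have [w wN w1] := unity_root_neq1 N1.
have cw : cabs w = 1.
  have : cabs w ^+ N = 1 by rewrite -cabsX wN cabs1.
  move/eqP; rewrite pexpr_eq1 ?(ltn_trans _ N1) ?cabs_ge0 //; first by move/eqP.
have [B B0 HB] := Hr N.
have NR0 : 0 < (N%:R : R) by rewrite ltr0n (ltn_trans _ N1).
have aN0' : 0 < cabs (a N) by rewrite cabs_gt0.
have w10 : 0 < cabs (w - 1) by rewrite cabs_gt0 subr_eq0.
pose eps := Num.min (1 / (N%:R * 2 ^+ N)) (cabs (w - 1) / 2).
have eps0 : 0 < eps by rewrite lt_min !divr_gt0 // mulr_gt0 // exprn_gt0.
have eps1 : eps <= 1 / (N%:R * 2 ^+ N) by rewrite ge_min lexx.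
have eps2 : eps <= cabs (w - 1) / 2 by rewrite ge_min lexx orbT.
have epsle1 : eps <= 1.
  apply: le_trans eps1 _; rewrite ler_pdivrMr ?mulr_gt0 ?exprn_gt0 // mul1r.
  by rewrite -natrX -natrM ler1n muln_gt0 expn_gt0 (ltn_trans _ N1).
(* For [h] of size [tau] the remainder of order [N] must be negligible against
   [eps] times the leading term, and [h] and [w * h] must stay in [A]. *)
pose K := (B + 1) * 2 ^+ N * 8.
have K0 : 0 < K.
  by rewrite !mulr_gt0 ?exprn_gt0 // ltr_wpDl.
have [tau [tau0 taur taurA tauK]] : exists tau : R, [/\ 0 < tau, 2 * tau <= r, 2 * tau < rA &
    tau * K < N%:R * cabs (a N) * eps].
  exists (Num.min (Num.min (r / 2) (rA / 4)) (N%:R * cabs (a N) * eps / (2 * K))).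
  have g1 : 0 < N%:R * cabs (a N) * eps / (2 * K).
    exact: divr_gt0 (mulr_gt0 (mulr_gt0 NR0 aN0') eps0) (mulr_gt0 (ltr0Sn _ 1) K0).
  have g2 : 0 < r / 2 by rewrite divr_gt0.
  have g3 : 0 < rA / 4 by rewrite divr_gt0.
  split.
  - by rewrite !lt_min g1 g2 g3.
  - by rewrite mulrC -ler_pdivlMr // !ge_min lexx.
  - rewrite mulrC -ltr_pdivlMr //; rewrite (@le_lt_trans _ _ (rA / 4)) //.
      by rewrite !ge_min lexx !orbT.
    lra.
  - rewrite -ltr_pdivlMr //; rewrite (@le_lt_trans _ _ (N%:R * cabs (a N) * eps / (2 * K))) //.
      by rewrite !ge_min lexx !orbT.
    rewrite ltr_pM2l ?mulr_gt0 // ltf_pV2 ?posrE ?mulr_gt0 //; lra.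
pose h : C R := tau%:C.
have ch : cabs h = tau by rewrite cabs_real gtr0_norm.
pose k0 := w * h.
have ck0 : cabs k0 = tau by rewrite cabsM cw mul1r.
pose F k := a N * k ^+ N + taylor_rem f a z0 N k.
have FE k : F k = f (z0 + k) - a 0%N.
  rewrite /F /taylor_rem big_ord_recr /= (bigD1 (Ordinal (ltnW N1))) //=.
  rewrite expr0 mulr1 big1 ?addr0; first by ring.
  by move=> i i0; rewrite aN ?mul0r // ltn_ord lt0n andbT; exact: i0.
pose d := a N * N%:R * k0 ^+ N.-1.
have cd : cabs d = cabs (a N) * N%:R * tau ^+ N.-1.
  by rewrite /d !cabsM cabs_nat cabsX ck0.
have tN : tau ^+ N = tau * tau ^+ N.-1.
  by rewrite -exprS prednK // (ltn_trans _ N1).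
have tN2 : tau ^+ N = tau * (tau * tau ^+ N.-2).
  by rewrite -!exprS prednK ?prednK //; case: (N) N1 => [|[]].
have tN1 : tau ^+ N.-1 = tau * tau ^+ N.-2.
  by rewrite -exprS prednK //; case: (N) N1 => [|[]].
have d0 : d != 0.
  by rewrite -cabs_gt0 cd !mulr_gt0 // exprn_gt0.
have rad0 : 0 < eps * tau by rewrite mulr_gt0.
have etau : eps * tau <= tau by rewrite ler_piMl // ltW.
have lipF u v : cabs u <= eps * tau -> cabs v <= eps * tau ->
  cabs (F (k0 + u) - F (k0 + v) - d * (u - v)) <= cabs d / 2 * cabs (u - v).
  move=> hu hv.
  have -> : F (k0 + u) - F (k0 + v) - d * (u - v) =
    a N * ((k0 + u) ^+ N - (k0 + v) ^+ N - N%:R * k0 ^+ N.-1 * (u - v)) +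
    (taylor_rem f a z0 N (k0 + u) - taylor_rem f a z0 N (k0 + v)).
    rewrite /F /d; move: (taylor_rem _ _ _ _ (k0 + u)) (taylor_rem _ _ _ _ (k0 + v)).
    by move: ((k0 + u) ^+ N) ((k0 + v) ^+ N) (k0 ^+ N.-1) => *; ring.
  apply: le_trans (cabsD _ _) _; rewrite cabsM.
  have kt : cabs k0 + eps * tau <= 2 * tau by rewrite ck0; lra.
  have g1 := cabs_expB2 N (ltW rad0) hu hv kt.
  have g2 : cabs (taylor_rem f a z0 N (k0 + u) - taylor_rem f a z0 N (k0 + v)) <=
     B * (2 * tau) ^+ N * cabs (u - v).
    have -> : u - v = (k0 + u) - (k0 + v) by ring.
    apply: HB => //.
      by rewrite (le_trans (cabsD _ _)) // (le_trans _ kt) // lerD2l.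
    by rewrite (le_trans (cabsD _ _)) // (le_trans _ kt) // lerD2l.
  apply: le_trans (lerD (ler_wpM2l (cabs_ge0 (a N)) g1) g2) _.
  rewrite cd !mulrA -mulrDl; apply: ler_wpM2r; first exact: cabs_ge0.
  rewrite !exprMn tN tN1.
  have p20 : (0:R) < 2 ^+ N by rewrite exprn_gt0.
  have e22 : (2:R) ^+ N = 4 * 2 ^+ N.-2.
    by case: (N) N1 => [|[|n]] // _; rewrite !exprS /=; ring.
  set T := tau ^+ N.-2. have T0 : 0 < T by rewrite exprn_gt0.
  have eN : N%:R * eps * 2 ^+ N.-2 <= 1 / 4.
    move: eps1; rewrite ler_pdivlMr ?mulr_gt0 // e22 => q; lra.
  have e1 : cabs (a N) * N%:R ^+ 2 * eps * tau * (2 ^+ N.-2 * T)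
     <= cabs (a N) * N%:R * (tau * T) / 4.
    have -> : cabs (a N) * N%:R ^+ 2 * eps * tau * (2 ^+ N.-2 * T) =
       (cabs (a N) * N%:R * (tau * T)) * (N%:R * eps * 2 ^+ N.-2) by ring.
    by rewrite ler_pM2l ?mulr_gt0 // -[X in _ <= X]div1r.
  have e2 : B * (2 ^+ N * (tau * (tau * T))) <= cabs (a N) * N%:R * (tau * T) / 4.
    have -> : B * (2 ^+ N * (tau * (tau * T))) = (B * 2 ^+ N * tau) * (tau * T) by ring.
    have -> : cabs (a N) * N%:R * (tau * T) / 4 = (N%:R * cabs (a N) / 4) * (tau * T) by ring.
    have tT : 0 <= tau * T by rewrite ltW // mulr_gt0.
    apply: ler_wpM2r => //.
    have q1 : tau * K <= N%:R * cabs (a N).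
      by rewrite (le_trans (ltW tauK)) // ler_piMr // ltW // mulr_gt0.
    have q2 : B * 2 ^+ N * tau * 8 <= tau * K.
      rewrite /K -subr_ge0 (_ : _ - _ = tau * 2 ^+ N * 8); last by ring.
      by rewrite !mulr_ge0 // ltW.
    have q3 : 0 <= B * 2 ^+ N * tau by rewrite !mulr_ge0 // ltW.
    lra.
  lra.
have close : cabs (F h - F k0) < cabs d * (eps * tau) / 4.
  have -> : F h - F k0 = taylor_rem f a z0 N h - taylor_rem f a z0 N k0.
    rewrite /F [k0 ^+ N]exprMn wN mul1r.
    by move: (taylor_rem _ _ _ _ h) (taylor_rem _ _ _ _ k0) (h ^+ N) => *; ring.
  have ht : tau <= r by lra.
  have := HB h k0 tau ht; rewrite ch ck0 => /(_ (lexx _) (lexx _)) g.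
  apply: le_lt_trans g _.
  have hk2 : cabs (h - k0) <= 2 * tau.
    by have := cabs_tri 0 h k0; rewrite subr0 sub0r cabsN ch ck0; lra.
  have BT : 0 <= B * tau ^+ N by rewrite mulr_ge0 // exprn_ge0 // ltW.
  apply: le_lt_trans (ler_wpM2l BT hk2) _.
  rewrite cd tN.
  set T := tau ^+ N.-1; have T0 : 0 < T by rewrite exprn_gt0.
  have -> : B * (tau * T) * (2 * tau) = (2 * B * tau) * (tau * T) by ring.
  have -> : cabs (a N) * N%:R * T * (eps * tau) / 4 = (N%:R * cabs (a N) * eps / 4) * (tau * T) by ring.
  rewrite ltr_pM2r ?mulr_gt0 //.
  have p21 : (1:R) <= 2 ^+ N by rewrite exprn_ege1 // ler1n.
  have q2 : B * tau * 8 <= tau * K.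
    have -> : tau * K = (B * tau * 8) * 2 ^+ N + tau * 2 ^+ N * 8 by rewrite /K; ring.
    have q3 : 0 <= B * tau * 8 by rewrite !mulr_ge0 // ltW.
    have q4 : 0 <= tau * 2 ^+ N * 8 by rewrite !mulr_ge0 ?exprn_ge0 // ltW.
    have := ler_wpM2l q3 p21; lra.
  lra.
have [u hu Fu] := lip_open rad0 d0 lipF close.
have := Fu; rewrite !FE => /(congr1 (fun x => x + a 0%N)); rewrite !subrK => E.
have ckt : cabs (k0 + u) < rA.
  by rewrite (le_lt_trans (cabsD _ _)) // ck0; lra.
have A1 : A (z0 + (k0 + u)) by apply: HA; rewrite (addrC z0) addrK.
have A2 : A (z0 + h) by apply: HA; rewrite (addrC z0) addrK ch; lra.
have /addrI E' := injf _ _ (mem_set A1) (mem_set A2) E.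
have : (w - 1) * h = - u by rewrite mulrBl mul1r -/k0 -E' opprD addrA subrr add0r.
move/(congr1 (@cabs R)); rewrite cabsM cabsN ch => E2.
have : cabs (w - 1) * tau < cabs (w - 1) / 2 * tau.
  by rewrite E2 (lt_le_trans hu) // ler_pM2r.
rewrite ltr_pM2r //; lra.
Qed.

End critical.

(** * Second-order jets and the Laplacian *)

Section jets.
Variable R : realType.
Implicit Types (z w h k : C R).

Definition little2 (e : C R -> R) := forall eps : R, 0 < eps ->
  exists2 r : R, 0 < r & forall h, cabs h < r -> `|e h| <= eps * cabs h ^+ 2.

Lemma little2D e1 e2 : little2 e1 -> little2 e2 -> little2 (fun h => e1 h + e2 h).
Proof.
move=> H1 H2 eps eps0; have e0 : 0 < eps / 2 by rewrite divr_gt0.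
have [r1 r10 h1] := H1 _ e0; have [r2 r20 h2] := H2 _ e0.
exists (Num.min r1 r2); first by rewrite lt_min r10.
move=> h; rewrite lt_min => /andP[hr1 hr2].
rewrite (le_trans (ler_normD _ _)) // (le_trans (lerD (h1 _ hr1) (h2 _ hr2))) //.
by rewrite -mulrDl -splitr.
Qed.

Lemma little2Z c e : little2 e -> little2 (fun h => c * e h).
Proof.
move=> H eps eps0; have c1 : 0 < `|c| + 1 by rewrite ltr_wpDl.
have [r r0 h1] := H _ (divr_gt0 eps0 c1).
exists r => // h /h1 hh; rewrite normrM.
apply: le_trans (_ : (`|c| + 1) * `|e h| <= _).
  by rewrite ler_wpM2r // lerDl.
apply: le_trans (ler_wpM2l (ltW c1) hh) _.
by rewrite mulrCA mulrA divfK ?gt_eqF.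
Qed.

Lemma little2_le (e1 e2 : C R -> R) (r : R) : 0 < r -> little2 e2 ->
  (forall h, cabs h < r -> `|e1 h| <= `|e2 h|) -> little2 e1.
Proof.
move=> r0 H2 H eps eps0; have [r2 r20 h2] := H2 _ eps0.
exists (Num.min r r2); first by rewrite lt_min r0.
by move=> h; rewrite lt_min => /andP[hr hr2]; rewrite (le_trans (H _ hr)) // h2.
Qed.

Lemma little2_cube (e : C R -> R) (r K : R) : 0 < r ->
  (forall h, cabs h < r -> `|e h| <= K * cabs h ^+ 3) -> little2 e.
Proof.
move=> r0 H eps eps0; have K1 : 0 < `|K| + 1 by rewrite ltr_wpDl.
exists (Num.min r (eps / (`|K| + 1))); first by rewrite lt_min r0 divr_gt0.
move=> h; rewrite lt_min => /andP[hr]; rewrite ltr_pdivlMr // => hK.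
apply: le_trans (H _ hr) _; rewrite exprS mulrA ler_wpM2r ?exprn_ge0 ?cabs_ge0 //.
rewrite (le_trans _ (ltW hK)) // mulrC ler_wpM2l ?cabs_ge0 //.
by rewrite (le_trans (ler_norm _)) // lerDl.
Qed.

Definition hjet (f : C R -> C R) z0 (a b : C R) :=
  little2 (fun h => cabs (f (z0 + h) - f z0 - a * h - b * h ^+ 2)).

(** The number [4 * c] is the Laplacian of [u] at [z0]; [Re (b h^2)] is the harmonic part
    of the quadratic term. The chain rule transports [a] and [c] independently of [b]. *)
Definition rjet (u : C R -> R) z0 (a : C R) (c : R) := exists b : C R,
  little2 (fun h => u (z0 + h) - u z0 - complex.Re (a * h) - complex.Re (b * h ^+ 2)
                    - c * cabs h ^+ 2).

Lemma rjet_bound u z0 a c : rjet u z0 a c -> exists2 K : R, 0 < K &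
  exists2 r : R, 0 < r & forall h, cabs h < r ->
   `|u (z0 + h) - u z0 - complex.Re (a * h)| <= K * cabs h ^+ 2.
Proof.
move=> [b /(_ 1 ltr01)[r r0 H]]; exists (1 + cabs b + `|c|).
  by rewrite ltr_wpDr // ltr_wpDr ?cabs_ge0.
exists r => // h /H hh.
have -> : u (z0 + h) - u z0 - complex.Re (a * h) =
   (u (z0 + h) - u z0 - complex.Re (a * h) - complex.Re (b * h ^+ 2) - c * cabs h ^+ 2)
   + (complex.Re (b * h ^+ 2) + c * cabs h ^+ 2) by ring.
have q1 : `|complex.Re (b * h ^+ 2)| <= cabs b * cabs h ^+ 2.
  by rewrite (le_trans (normRe_le _)) // cabsM cabsX.
have q2 : `|c * cabs h ^+ 2| = `|c| * cabs h ^+ 2.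
  by rewrite normrM [X in _ * X = _]ger0_norm // exprn_ge0 // cabs_ge0.
set X := u _ - _ - _ - _ - _ in hh *.
have := ler_normD X (complex.Re (b * h ^+ 2) + c * cabs h ^+ 2).
have := ler_normD (complex.Re (b * h ^+ 2)) (c * cabs h ^+ 2).
lra.
Qed.

Lemma rjet_cont u z0 a c : rjet u z0 a c -> forall e : R, 0 < e ->
  exists2 d : R, 0 < d & forall z, cabs (z - z0) < d -> `|u z - u z0| < e.
Proof.
move=> /rjet_bound[K K0 [r r0 H]] e e0.
have L0 : 0 < cabs a + K + 1 by rewrite ltr_wpDl // addr_ge0 ?cabs_ge0 // ltW.
exists (Num.min 1 (Num.min r (e / (cabs a + K + 1)))).
  by rewrite !lt_min ltr01 r0 divr_gt0.
move=> z; rewrite !lt_min => /and3P[h1 hr]; rewrite ltr_pdivlMr // => he.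
have E : z0 + (z - z0) = z by rewrite addrC subrK.
have := H _ hr; rewrite E => hh.
have h0 := cabs_ge0 (z - z0).
have hsq : cabs (z - z0) ^+ 2 <= cabs (z - z0).
  by rewrite expr2 ler_piMl // ltW.
have := ler_normD (u z - u z0 - complex.Re (a * (z - z0))) (complex.Re (a * (z - z0))).
rewrite subrK => q.
have q2 : `|complex.Re (a * (z - z0))| <= cabs a * cabs (z - z0).
  by rewrite (le_trans (normRe_le _)) // cabsM.
have q3 := ler_wpM2l (ltW K0) hsq.
lra.
Qed.

Lemma rjetD u v z0 a1 c1 a2 c2 : rjet u z0 a1 c1 -> rjet v z0 a2 c2 ->
  rjet (fun z => u z + v z) z0 (a1 + a2) (c1 + c2).
Proof.
move=> [b1 h1] [b2 h2]; exists (b1 + b2).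
apply: little2_le ltr01 (little2D h1 h2) _ => h _.
by rewrite !mulrDl !ReD le_eqVlt; apply/orP; left; apply/eqP; congr `| _ |; ring.
Qed.

Lemma rjetZ (k : R) u z0 a c : rjet u z0 a c ->
  rjet (fun z => k * u z) z0 (k%:C * a) (k * c).
Proof.
move=> [b h1]; exists (k%:C * b).
apply: little2_le ltr01 (little2Z k h1) _ => h _.
have E (x y : C R) : complex.Re (k%:C * x * y) = k * complex.Re (x * y).
  by case: x y => [x1 x2] [y1 y2] /=; ring.
by rewrite !E le_eqVlt; apply/orP; left; apply/eqP; congr `| _ |; ring.
Qed.

Lemma rjet_cst (k : R) z0 : rjet (fun=> k) z0 0 0.
Proof.
exists 0; apply: (@little2_cube _ 1 0) => // h _.
by rewrite !mul0r /= !subr0 subrr normr0.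
Qed.

Lemma rjet_absq F z0 a b : hjet F z0 a b ->
  rjet (fun z => cabs (F z) ^+ 2) z0 (2 * (F z0)^* * a) (cabs a ^+ 2).
Proof.
move=> HF; exists (2 * (F z0)^* * b).
pose E h := F (z0 + h) - F z0 - a * h - b * h ^+ 2.
have hE : little2 (fun h => cabs (E h)) by exact: HF.
have [r r0 hE1] := hE 1 ltr01.
pose M := cabs a + cabs b + 1.
have M0 : 0 < M by rewrite ltr_wpDl // addr_ge0 ?cabs_ge0.
have L1 : little2 (fun h => 2 * cabs (F z0) * cabs (E h)) by exact: little2Z.
have L2 : little2 (fun h => (2 * M ^+ 2) * cabs h ^+ 3).
  apply: (@little2_cube _ 1 (2 * M ^+ 2)) => // h _.
  by rewrite ger0_norm // mulr_ge0 ?exprn_ge0 ?cabs_ge0 ?mulr_ge0 ?exprn_ge0 // ltW.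
apply: (little2_le (r := Num.min 1 r) _ (little2D L1 L2)); first by rewrite lt_min ltr01.
move=> h; rewrite lt_min => /andP[h1 hr].
have /= := hE1 _ hr; rewrite mul1r ger0_norm ?cabs_ge0 // => hEh.
have h0 := cabs_ge0 h.
set X := a * h + b * h ^+ 2 + E h.
have FX : F (z0 + h) = F z0 + X by rewrite /X /E; ring.
have sqD (z w : C R) : cabs (z + w) ^+ 2 = cabs z ^+ 2 + complex.Re (2 * z^* * w) + cabs w ^+ 2.
  by rewrite !cabs_sqr; case: z w => [x1 x2] [y1 y2] /=; ring.
set W := b * h ^+ 2 + E h.
have XW : X = a * h + W by exact: esym (addrA _ _ _).
have cW : cabs W <= (cabs b + 1) * cabs h ^+ 2.
  by rewrite (le_trans (cabsD _ _)) // mulrDl mul1r cabsM cabsX lerD.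
have cX2 : `|cabs X ^+ 2 - cabs a ^+ 2 * cabs h ^+ 2| <= 2 * M ^+ 2 * cabs h ^+ 3.
  rewrite -exprMn -cabsM subr_sqr normrM.
  have q1 : `|cabs X - cabs (a * h)| <= M * cabs h ^+ 2.
    rewrite (le_trans (cabs_dist _ _)) // XW (addrC (a * h)) addrK (le_trans cW) //.
    by rewrite ler_wpM2r ?exprn_ge0 // lerD2r lerDr cabs_ge0.
  have hsq : cabs h ^+ 2 <= cabs h by rewrite expr2 ler_piMl // ltW.
  have q2 : `|cabs X + cabs (a * h)| <= 2 * M * cabs h.
    rewrite ger0_norm ?addr_ge0 ?cabs_ge0 // XW.
    have := cabsD (a * h) W; rewrite cabsM => q3.
    have b1 : 0 <= cabs b + 1 by rewrite addr_ge0 ?cabs_ge0.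
    have q4 := ler_wpM2l b1 hsq.
    have q5 : 0 <= (cabs b + 1) * cabs h by rewrite mulr_ge0.
    rewrite /M; lra.
  have -> : 2 * M ^+ 2 * cabs h ^+ 3 = (M * cabs h ^+ 2) * (2 * M * cabs h) by ring.
  by apply: ler_pM.
rewrite FX sqD [X in _ <= X]ger0_norm; last first.
  by rewrite addr_ge0 // !mulr_ge0 ?exprn_ge0 ?cabs_ge0 // ltW.
have -> : cabs (F z0) ^+ 2 + complex.Re (2 * (F z0)^* * X) + cabs X ^+ 2 -
  cabs (F z0) ^+ 2 - complex.Re (2 * (F z0)^* * a * h) -
  complex.Re (2 * (F z0)^* * b * h ^+ 2) - cabs a ^+ 2 * cabs h ^+ 2 =
  complex.Re (2 * (F z0)^* * E h) + (cabs X ^+ 2 - cabs a ^+ 2 * cabs h ^+ 2).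
  by rewrite /X !mulrDr !ReD !mulrA; ring.
apply: le_trans (ler_normD _ _) _; apply: lerD => //.
rewrite (le_trans (normRe_le _)) // !cabsM cabs_nat.
have -> // : cabs (F z0)^* = cabs (F z0).
apply/eqP; rewrite -(@eqrXn2 _ 2) ?cabs_ge0 // !cabs_sqr.
by case: (F z0) => x y /=; rewrite sqrrN.
Qed.

Definition jet1 (p : R -> R) (t0 p1 p2 : R) := forall eps : R, 0 < eps ->
  exists2 r : R, 0 < r & forall x, `|x| < r ->
    `|p (t0 + x) - p t0 - p1 * x - p2 * x ^+ 2| <= eps * x ^+ 2.

(** The second coefficient uses
    [Re (a h) ^ 2 = (Re (a^2 h^2) + |a|^2 |h|^2) / 2], whose first term is harmonic. *)
Lemma rjet_comp p u z0 a c p1 p2 : rjet u z0 a c -> jet1 p (u z0) p1 p2 ->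
  rjet (p \o u) z0 (p1%:C * a) (p1 * c + p2 * cabs a ^+ 2 / 2).
Proof.
move=> Hu Hp; have [b Hb] := Hu; exists (p1%:C * b + (p2 / 2)%:C * a ^+ 2).
have [K K0 [r r0 HK]] := rjet_bound Hu.
pose M := cabs a + K; have M0 : 0 < M by rewrite ltr_wpDl ?cabs_ge0.
have L1 := little2Z p1 Hb.
have L2 : little2 (fun h => (`|p2| * (2 * K * M)) * cabs h ^+ 3).
  apply: (@little2_cube _ 1 (`|p2| * (2 * K * M))) => // h _.
  by rewrite ger0_norm // mulr_ge0 ?exprn_ge0 ?cabs_ge0 // !mulr_ge0 // ltW.
have xM h : cabs h < r -> cabs h <= 1 -> `|u (z0 + h) - u z0| <= M * cabs h.
  move=> hr h1; have h0 := cabs_ge0 h.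
  have hsq : cabs h ^+ 2 <= cabs h by rewrite expr2 ler_piMl.
  have q3 := ler_wpM2l (ltW K0) hsq.
  have := ler_normD (u (z0 + h) - u z0 - complex.Re (a * h)) (complex.Re (a * h)).
  rewrite subrK; have := HK _ hr; have := normRe_le (a * h); rewrite cabsM /M; lra.
have L3 : little2 (fun h => let x := u (z0 + h) - u z0 in
    p (u z0 + x) - p (u z0) - p1 * x - p2 * x ^+ 2).
  move=> eps eps0; have M20 : 0 < M ^+ 2 by rewrite exprn_gt0.
  have [s s0 Hs] := Hp _ (divr_gt0 eps0 M20).
  exists (Num.min 1 (Num.min r (s / M))); first by rewrite !lt_min ltr01 r0 divr_gt0.
  move=> h; rewrite !lt_min ltr_pdivlMr // => /and3P[h1 hr hs] /=.
  have hx := xM h hr (ltW h1).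
  rewrite (le_trans (Hs _ _)) //; first by rewrite (le_lt_trans hx) // mulrC.
  rewrite -mulrA ler_wpM2l ?(ltW eps0) // mulrC ler_pdivrMr // mulrC -exprMn.
  by rewrite -real_normK ?num_real // lerXn2r ?nnegrE // mulr_ge0 ?cabs_ge0 // ltW.
apply: (little2_le (r := Num.min 1 r) _ (little2D (little2D L1 L3) _)); first by rewrite lt_min ltr01.
  pose e h := let x := u (z0 + h) - u z0 in p2 * (x ^+ 2 - complex.Re (a * h) ^+ 2).
  have Le : little2 e.
    apply: (little2_le (r := Num.min 1 r) _ L2); first by rewrite lt_min ltr01.
    move=> h; rewrite lt_min => /andP[h1 hr]; rewrite /e.
    rewrite [X in _ <= X]ger0_norm; last first.
      by rewrite mulr_ge0 ?exprn_ge0 ?cabs_ge0 // !mulr_ge0 // ltW.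
    rewrite normrM -mulrA ler_wpM2l // subr_sqr normrM.
    have -> : 2 * K * M * cabs h ^+ 3 = (K * cabs h ^+ 2) * (2 * M * cabs h) by ring.
    apply: ler_pM => //; first exact: HK.
    rewrite (le_trans (ler_normD _ _)) //.
    have := xM h hr (ltW h1); have := normRe_le (a * h); rewrite cabsM.
    have : 0 <= K * cabs h by rewrite mulr_ge0 ?cabs_ge0 // ltW.
    rewrite /M; lra.
  exact: Le.
move=> h _ /=.
set x := u (z0 + h) - u z0.
have -> : u (z0 + h) = u z0 + x by rewrite /x; ring.
have ReZ (t : R) (z w : C R) : complex.Re (t%:C * z * w) = t * complex.Re (z * w).
  by case: z w => [x1 x2] [y1 y2] /=; ring.
have sq : complex.Re (a * h) ^+ 2 = (complex.Re (a ^+ 2 * h ^+ 2) + cabs a ^+ 2 * cabs h ^+ 2) / 2.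
  rewrite !cabs_sqr; case: (a) (h) => [x1 x2] [y1 y2].
  by rewrite !expr2 /=; field.
rewrite [(_ + _) * h ^+ 2]mulrDl ReD !ReZ sq.
by rewrite le_eqVlt; apply/orP; left; apply/eqP; congr `| _ |; field.
Qed.

(** Averaging the expansion over [h = t, -t, i t, -i t] removes the linear and the
    harmonic terms and leaves [c t^2]. *)
Lemma rjet_max u z0 a c : rjet u z0 a c ->
  (\forall z \near z0, u z <= u z0) -> c <= 0.
Proof.
move=> [b Hb] /nearC[e e0 He]; rewrite leNgt; apply/negP => c0.
have c20 : 0 < c / 2 by rewrite divr_gt0.
have [r r0 Hr] := Hb _ c20.
pose t := Num.min e r / 2.
have m0 : 0 < Num.min e r by rewrite lt_min e0.
have t0 : 0 < t by rewrite divr_gt0.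
have tm : t < Num.min e r by rewrite ltr_pdivrMr // ltr_pMr // ltr1n.
have te : t < e by rewrite (lt_le_trans tm) // ge_min lexx.
have tr : t < r by rewrite (lt_le_trans tm) // ge_min lexx orbT.
have ct : cabs (t%:C : C R) = t by rewrite cabs_real gtr0_norm.
have cti : cabs ('i * t%:C : C R) = t by rewrite cabsM cabs_i mul1r.
have Q (h : C R) : cabs h = t -> complex.Re (a * h) + complex.Re (b * h ^+ 2) <= - (c / 2 * t ^+ 2).
  move=> ht; have := Hr h; rewrite ht => /(_ tr).
  have := He (z0 + h); rewrite (addrC z0) addrK ht => /(_ te).
  rewrite ler_norml => q /andP[q1 q2]; lra.
have := Q _ ct; have := Q _ cti; have := Q (- t%:C); have := Q (- ('i * t%:C)).
rewrite !cabsN ct cti => /(_ erefl) q1 /(_ erefl) q2 q3 q4.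
have := exprn_gt0 2 t0; move: q1 q2 q3 q4; rewrite !mulrN !ReN !sqrrN exprMn.
have -> : ('i : C R) ^+ 2 = -1 by exact: sqr_i.
rewrite mulN1r mulrN ReN => q1 q2 q3 q4 t20.
have := mulr_gt0 c20 t20; lra.
Qed.

End jets.

(** * Jets of the functions entering the metric *)

Section jets1.
Variable R : realType.

Lemma is_derive_little (g : R -> R) (t0 d : R) : is_derive t0 1 g d ->
  forall eps, 0 < eps -> exists2 r : R, 0 < r & forall x, `|x| < r ->
  `|g (t0 + x) - g t0 - d * x| <= eps * `|x|.
Proof.
move=> gd eps eps0.
have H : (fun h : R => h^-1 *: ((g \o shift t0) (h *: (1:R)) - g t0)) @ 0^' --> d.
  have := @ex_derive _ _ _ _ _ _ _ gd.
  by rewrite /derivable -[d](@derive_val _ _ _ _ _ _ _ gd).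
have /cvgrPdist_lt /(_ eps eps0) := H.
rewrite near_withinE => /nearR[r r0 Hr]; exists r => // x xr.
have [->|x0] := eqVneq x 0; first by rewrite addr0 subrr mulr0 subrr normr0 mulr0.
have := Hr x; rewrite subr0 => /(_ xr x0) /=.
rewrite /GRing.scale /= mulr1 => /ltW.
rewrite -(ler_pM2r (_ : 0 < `|x|)) ?normr_gt0 // -normrM distrC mulrBl.
by rewrite mulrAC mulVf // mul1r (addrC x).
Qed.

(** By the mean value theorem applied to the remainder along [s |-> t0 + s x]. *)
Lemma jet1_deriv (p dp : R -> R) (t0 d2 e : R) : 0 < e ->
  (forall t, `|t - t0| < e -> is_derive t 1 p (dp t)) ->
  is_derive t0 1 dp d2 -> jet1 p t0 (dp t0) (d2 / 2).
Proof.
move=> e0 Hp Hdp eps eps0.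
have [r r0 Hr] := is_derive_little Hdp eps0.
exists (Num.min e r); first by rewrite lt_min e0.
move=> x; rewrite lt_min => /andP[xe xr].
pose q s := p (t0 + s * x) - dp t0 * (s * x) - d2 / 2 * (s * x) ^+ 2.
pose dq s := (dp (t0 + s * x) - dp t0 - d2 * (s * x)) * x.
have sx (s : R) : s \in `[0, 1]%R -> `|s * x| <= `|x|.
  rewrite in_itv /= => /andP[s0 s1]; rewrite normrM ger0_norm // ler_piMl //.
have Dq (s : R) : s \in `[0, 1]%R -> is_derive s 1 q (dq s).
  move=> s01; rewrite /q.
  have h1 : is_derive (t0 + s * x) 1 p (dp (t0 + s * x)).
    by apply: Hp; rewrite (addrC t0) addrK (le_lt_trans (sx _ s01)).
  have h2 : is_derive s 1 (fun s : R => t0 + s * x) x.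
    apply: is_derive_eq; rewrite /GRing.scale /=.
    by rewrite !(mulr1, mulr0, add0r, addr0, mul1r).
  have h3 := @is_derive1_comp R p (fun s : R => t0 + s * x) s _ _ h1 h2.
  have h4 : is_derive s 1 (fun s : R => dp t0 * (s * x) + d2 / 2 * (s * x) ^+ 2)
     (dp t0 * x + d2 * (s * x) * x).
    apply: is_derive_eq; rewrite /GRing.scale /= !(mulr1, mulr0, add0r, addr0).
    by rewrite mulr2n; field.
  have -> : (fun s => p (t0 + s * x) - dp t0 * (s * x) - d2 / 2 * (s * x) ^+ 2) =
    (p \o (fun s => t0 + s * x)) - (fun s => dp t0 * (s * x) + d2 / 2 * (s * x) ^+ 2).
    by apply/funext => u /=; rewrite [RHS]/GRing.add /= [in RHS]/GRing.opp /=; ring.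
  apply: is_derive_eq; rewrite /dq.
  move: (dp (t0 + s * x)) (dp t0) => u1 u2.
  by rewrite !mulrBl opprD addrA.
have cq : {within `[(0:R), 1], continuous q}.
  apply: derivable_within_continuous => s s01.
  exact: (@ex_derive _ _ _ _ _ _ _ (Dq s s01)).
have Dq' (s : R) : s \in `](0:R), 1[%R -> is_derive s 1 q (dq s).
  move=> s01; apply: Dq; move: s01; rewrite !in_itv /= => /andP[? ?].
  by apply/andP; split; exact: ltW.
have [c c01 E] := MVT_segment (@ler01 R) Dq' cq.
have -> : p (t0 + x) - p t0 - dp t0 * x - d2 / 2 * x ^+ 2 = q 1 - q 0.
  rewrite /q !mul1r !mul0r addr0 expr0n /= !mulr0 !subr0.
  by move: (p (t0 + x)) (p t0) => u1 u2; ring.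
rewrite E subr0 mulr1 /dq normrM.
have cx := sx _ c01.
apply: le_trans (ler_wpM2r (normr_ge0 x) (Hr (c * x) (le_lt_trans cx xr))) _.
rewrite -[x ^+ 2]real_normK ?num_real // expr2 mulrA ler_wpM2r // ler_wpM2l //.
exact: ltW.
Qed.

Lemma jet1_ln (t0 : R) : 0 < t0 -> jet1 (@ln R) t0 (t0^-1) (- t0^-1 ^+ 2 / 2).
Proof.
move=> t00; apply: (jet1_deriv (dp := fun t => t^-1) t00).
  move=> t ht; apply: is_derive1_ln; move: ht; rewrite ltr_norml => /andP[? _]; lra.
have h : is_derive t0 1 (fun t : R => t) 1 by apply: is_derive_eq.
have := is_deriveV (lt0r_neq0 t00) h.
by rewrite /GRing.scale /= mulr1 exprVn.
Qed.

(** Composed with [ln (r ^+ 2)] this is [ln (1 + sqrt r)]: written as a function of a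
    harmonic function, its Laplacian needs only the second derivative of [softplus]. *)
Definition softplus (t : R) := ln (1 + expR (t / 4)).

Lemma jet1_softplus t0 : let E := expR (t0 / 4) in
  jet1 softplus t0 (E / (4 * (1 + E))) (E / (16 * (1 + E) ^+ 2) / 2).
Proof.
move=> E.
have De (t : R) : is_derive t 1 (fun t : R => expR (t / 4)) (expR (t / 4) / 4).
  have h2 : is_derive t 1 (fun s : R => s / 4) (1 / 4).
    by apply: is_derive_eq; rewrite /GRing.scale /= !(mulr1, mulr0, add0r, addr0, mul1r).
  by have := @is_derive1_comp R expR (fun s : R => s / 4) t _ _ (is_derive_expR (t / 4)) h2; rewrite mulrA mulr1.
have D1 (t : R) : is_derive t 1 (fun t : R => 1 + expR (t / 4)) (expR (t / 4) / 4).
  have h := De t; apply: is_derive_eq.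
  by rewrite /GRing.scale /= ?(mulr1, mulr0, add0r, addr0, mul1r).
have pos (t : R) : 0 < 1 + expR (t / 4) :> R by rewrite addr_gt0 ?expR_gt0.
apply: (jet1_deriv (dp := fun t => expR (t / 4) / (4 * (1 + expR (t / 4)))) ltr01).
  move=> t _; have := @is_derive1_comp R (@ln R) (fun t : R => 1 + expR (t / 4)) t _ _ (is_derive1_ln (pos t)) (D1 t).
  move=> h; apply: (is_derive_eq h).
  by field; rewrite lt0r_neq0.
have -> : (fun t => expR (t / 4) / (4 * (1 + expR (t / 4)))) =
   (fun t => 4^-1 - 4^-1 * (1 + expR (t / 4))^-1) :> (R -> R).
  by apply/funext => t; field; rewrite lt0r_neq0.
have D2 := @is_deriveV R (fun t : R => 1 + expR (t / 4)) t0 _ _ (lt0r_neq0 (pos t0)) (D1 t0).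
apply: is_derive_eq; rewrite /GRing.scale /= -/E.
have : 1 + E != 0 by rewrite lt0r_neq0 // pos.
move=> e1; field; exact: e1.
Qed.

Lemma jet1_lnln (m t0 : R) : 0 < t0 < m ->
  jet1 (fun x => ln x + ln (m - x)) t0 (t0^-1 - (m - t0)^-1)
    (- (t0^-1 ^+ 2 + (m - t0)^-1 ^+ 2) / 2).
Proof.
move=> /andP[t00 t0m].
have e0 : 0 < Num.min t0 (m - t0) by rewrite lt_min t00 subr_gt0.
apply: (jet1_deriv (dp := fun t => t^-1 - (m - t)^-1) e0).
  move=> t; rewrite lt_min !ltr_norml => /andP[/andP[a1 a2] /andP[a3 a4]].
  have tp : 0 < t by lra.
  have mtp : 0 < m - t by lra.
  have h1 := is_derive1_ln tp.
  have h2 : is_derive t 1 (fun s : R => m - s) (-1).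
    by apply: is_derive_eq; rewrite /GRing.scale /= ?(mulr1, mulr0, add0r, addr0, mul1r).
  have h3 := @is_derive1_comp R (@ln R) (fun s : R => m - s) t _ _ (is_derive1_ln mtp) h2.
  apply: is_derive_eq; by rewrite mulrN1.
have h : is_derive t0 1 (fun t : R => t) 1 by apply: is_derive_eq.
have h1 := @is_deriveV R (fun s : R => s) t0 _ _ (lt0r_neq0 t00) h.
have mt0 : 0 < m - t0 by rewrite subr_gt0.
have h2 : is_derive t0 1 (fun s : R => m - s) (-1).
  by apply: is_derive_eq; rewrite /GRing.scale /= ?(mulr1, mulr0, add0r, addr0, mul1r).
have h3 := @is_deriveV R (fun s : R => m - s) t0 _ _ (lt0r_neq0 mt0) h2.
apply: is_derive_eq; rewrite /GRing.scale /= !exprVn.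
by move: (_ ^- 2) (_ ^- 2) => u1 u2; ring.
Qed.

End jets1.

Section jetsf.
Variable R : realType.
Implicit Types (z w h k : C R).

Lemma hjet_lin (a b z0 : C R) : hjet (fun z => a * z + b) z0 a 0.
Proof.
apply: (@little2_cube _ _ 1 0) => // h _.
have -> : a * (z0 + h) + b - (a * z0 + b) - a * h - 0 * h ^+ 2 = 0 by ring.
by rewrite cabs0 normr0 mul0r.
Qed.

Lemma hjetBc f z0 a b c : hjet f z0 a b -> hjet (fun z => f z - c) z0 a b.
Proof.
move=> H eps eps0; have [r r0 Hr] := H _ eps0; exists r => // h /Hr.
by rewrite (_ : f (z0 + h) - c - (f z0 - c) = f (z0 + h) - f z0) //; ring.
Qed.

Lemma hjet_series (f : C R -> C R) (a : nat -> C R) z0 :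
  (\forall z \near z0, series (fun n => a n * (z - z0) ^+ n) @ \oo --> f z) ->
  hjet f z0 (a 1%N) (a 2%N).
Proof.
move=> /taylor_rem_lip[r r0 /(_ 2%N)[B B0 HB]].
apply: (@little2_cube _ _ r B) => // h hr.
have := HB h 0 (cabs h) (ltW hr) (lexx _); rewrite cabs0 cabs_ge0 => /(_ isT).
rewrite /taylor_rem !big_ord_recl !big_ord0 /= !subr0 ger0_norm ?cabs_ge0 //.
rewrite /bump /= !expr0n /= !expr0 !expr1 !mulr0 !addr0 !mulr1.
rewrite -mulrA -exprSr.
rewrite (_ : _ - (a 0%N + _) - _ = f (z0 + h) - f z0 - a 1%N * h - a 2%N * h ^+ 2) //.
by ring.
Qed.

Lemma taylor_rem1 (f : C R -> C R) (a : nat -> C R) z0 h :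
  taylor_rem f a z0 1 h = f (z0 + h) - (a 0%N + a 1%N * h).
Proof. by rewrite /taylor_rem big_ord_recr big_ord1 /= expr0 expr1 mulr1. Qed.

Lemma taylor_rem3 (f : C R -> C R) (a : nat -> C R) z0 h :
  taylor_rem f a z0 3 h =
  f (z0 + h) - (a 0%N + a 1%N * h + a 2%N * h ^+ 2 + a 3%N * h ^+ 3).
Proof. by rewrite /taylor_rem !big_ord_recr big_ord0 /= expr0 expr1 mulr1 add0r. Qed.

(** The increment of [f] from [z0 + h] to [z0 + h + k] is expanded once with the
    coefficients at [z0] and once with those at [z0 + h]; dividing the difference of
    the two by a small real [k] compares [f' (z0 + h)] with its Taylor polynomial. *)
Lemma hjet_deriv (A : set (C R)) (f : C R -> C R) (c : C R -> nat -> C R) z0 :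
  open A -> A z0 ->
  (forall z1, A z1 -> \forall z \near z1, series (fun n => c z1 n * (z - z1) ^+ n) @ \oo --> f z) ->
  hjet (fun z => c z 1%N) z0 (2 * c z0 2%N) (3 * c z0 3%N).
Proof.
move=> oA Az0 H; set a := c z0.
have [e e0 He] := (openC A).1 oA z0 Az0.
have [r r0 /(_ 3%N)[B B0 HB]] := taylor_rem_lip (H z0 Az0).
have m0 : 0 < Num.min e (r / 2) by rewrite lt_min e0 divr_gt0.
apply: (@little2_cube _ _ (Num.min e (r / 2)) (8 * B)) => // h.
rewrite lt_min => /andP[he hr]; rewrite ger0_norm ?cabs_ge0 //.
have h0 := cabs_ge0 h.
have Aw : A (z0 + h) by apply: He; rewrite (addrC z0) addrK.
have [s s0 /(_ 1%N)[D D0 HD]] := taylor_rem_lip (H _ Aw).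
have ser0 : a 1%N = c z0 1%N by [].
set X := _ - _ - _ - _.
have [hz|hz] := eqVneq h 0.
  have -> : X = 0 by rewrite /X hz addr0 -/a; ring.
  by rewrite cabs0 !mulr_ge0 ?exprn_ge0.
have ch0 : 0 < cabs h by rewrite cabs_gt0.
have key (k : R) : 0 < k -> k <= s -> k <= cabs h ->
   cabs X <= B * (2 * cabs h) ^+ 3 + (D + cabs (6 * a 3%N * h) + cabs (a 2%N * 2) + cabs (a 3%N) ) * k + cabs (a 3%N) * k ^+ 2.
  move=> k0 ks kh.
  have ck : cabs (k%:C : C R) = k by rewrite cabs_real gtr0_norm.
  have := HD k%:C 0 k ks; rewrite ck cabs0 => /(_ (lexx _) (ltW k0)).
  have := HB (h + k%:C) h (2 * cabs h).
  have -> : h + k%:C - h = k%:C by rewrite (addrC h) addrK.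
  rewrite ck => q.
  have {q}q : cabs (taylor_rem f a z0 3 (h + k%:C) - taylor_rem f a z0 3 h) <=
       B * (2 * cabs h) ^+ 3 * k.
    apply: q; first by lra.
      by rewrite (le_trans (cabsD _ _)) // ck; lra.
    lra.
  rewrite subr0 ck => q2.
  have EX : X * k%:C = (taylor_rem f a z0 3 (h + k%:C) - taylor_rem f a z0 3 h) -
     (taylor_rem f (c (z0 + h)) (z0 + h) 1 k%:C - taylor_rem f (c (z0 + h)) (z0 + h) 1 0) +
     (a 2%N + 3 * a 3%N * h + a 3%N * k%:C) * k%:C ^+ 2.
    rewrite !taylor_rem3 !taylor_rem1 addr0 addrA /X -[c z0 1%N]/(a 1%N) -/a.
    move: (f (z0 + h + k%:C)) (f (z0 + h)) (c (z0 + h)) (a 0%N) (a 1%N) (a 2%N) (a 3%N) => u1 u2 u3 a0 a1 a2 a3.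
    by ring.
  rewrite -(ler_pM2r k0) -{1}ck -cabsM EX.
  apply: le_trans (cabsD _ _) _; rewrite cabsM cabsX ck.
  have := cabsD (taylor_rem f a z0 3 (h + k%:C) - taylor_rem f a z0 3 h) (- (taylor_rem f (c (z0 + h)) (z0 + h) 1 k%:C - taylor_rem f (c (z0 + h)) (z0 + h) 1 0)).
  rewrite cabsN => q3.
  have q4 : cabs (a 2%N + 3 * a 3%N * h + a 3%N * k%:C) <= cabs (6 * a 3%N * h) + cabs (a 2%N * 2) + cabs (a 3%N) * k.
    rewrite (le_trans (cabsD _ _)) // cabsM ck lerD2r.
    rewrite (le_trans (cabsD _ _)) // addrC !cabsM !cabs_nat; apply: lerD.
      rewrite ler_wpM2r // ler_wpM2r ?cabs_ge0 // ler_nat //.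
    by rewrite ler_peMr ?cabs_ge0 // ler1n.
  have q5 := ler_wpM2r (exprn_ge0 2 (ltW k0)) q4.
  move: q q2 q3 q5; rewrite expr1.
  set T1 := cabs (taylor_rem _ _ _ _ _ - _); set T2 := cabs (taylor_rem _ _ _ _ _ - _).
  set T3 := cabs (_ - _); set b3 := cabs (a 3%N).
  set b4 := cabs (6 * _ * _); set b5 := cabs (a 2%N * 2); set b6 := B * _.
  have : 0 <= b3 * k ^+ 2 by rewrite mulr_ge0 ?exprn_ge0 ?cabs_ge0 // ltW.
  rewrite !expr2; move: (cabs _) => T4 ? ? ? ? ?; nra.
apply/ler_addgt0Pr => eps eps0.
set L := D + cabs (6 * a 3%N * h) + cabs (a 2%N * 2) + cabs (a 3%N).
have L0 : 0 <= L by rewrite !addr_ge0 ?cabs_ge0.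
have a30 := cabs_ge0 (a 3%N).
have L1 : 0 < L + cabs (a 3%N) + 1 by rewrite ltr_wpDl // addr_ge0.
pose k := Num.min (Num.min s (cabs h)) (Num.min 1 (eps / (L + cabs (a 3%N) + 1))).
have k0 : 0 < k by rewrite !lt_min s0 ch0 ltr01 divr_gt0.
have ks : k <= s by rewrite !ge_min lexx.
have kh : k <= cabs h by rewrite !ge_min lexx !orbT.
have k1 : k <= 1 by rewrite !ge_min lexx !orbT.
have ke : k * (L + cabs (a 3%N) + 1) <= eps by rewrite -ler_pdivlMr // !ge_min lexx !orbT.
apply: le_trans (key k k0 ks kh) _; rewrite -/L.
have -> : B * (2 * cabs h) ^+ 3 = 8 * B * cabs h ^+ 3 by ring.
rewrite -addrA lerD2l.
have kk : k ^+ 2 <= k by rewrite expr2 ler_piMl // ltW.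
have := ler_wpM2l a30 kk; lra.
Qed.

(** The coefficient of [|h|^2] vanishes because [ln |F|] is harmonic. *)
Lemma rjet_lnabs F z0 a b : F z0 != 0 -> hjet F z0 a b ->
  exists2 n : C R, rjet (fun z => ln (cabs (F z) ^+ 2)) z0 n 0 &
     cabs n ^+ 2 = 4 * cabs a ^+ 2 / cabs (F z0) ^+ 2.
Proof.
move=> F0 HF; have N0 : 0 < cabs (F z0) ^+ 2 by rewrite exprn_gt0 // cabs_gt0.
have cJ : cabs (F z0)^* = cabs (F z0).
  apply/eqP; rewrite -(@eqrXn2 _ 2) ?cabs_ge0 // !cabs_sqr.
  by case: (F z0) => x y /=; rewrite sqrrN.
have := rjet_comp (rjet_absq HF) (jet1_ln N0).
set n := _ * _ => H; exists n.
  have -> : 0 = (cabs (F z0) ^+ 2)^-1 * cabs a ^+ 2 +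
    - (cabs (F z0) ^+ 2)^-1 ^+ 2 / 2 * cabs (2 * (F z0)^* * a) ^+ 2 / 2.
    rewrite !cabsM cJ cabs_nat; field; move: F0; rewrite -cabs_gt0; exact: lt0r_neq0.
  exact: H.
rewrite /n !cabsM cJ cabs_nat cabs_real ger0_norm ?invr_ge0 ?ltW //.
field; move: F0; rewrite -cabs_gt0; exact: lt0r_neq0.
Qed.

End jetsf.

(** * An Ahlfors-Schwarz estimate on a conformal annulus *)

Section ahlfors.
Variable R : realType.
Implicit Types (z w h k : C R).

(** The triangle inequality forces the larger of the two, [B], to be at least [2 / 3], whence
    [1 + B <= 5 / 2 * B]. *)
Lemma curvature_ineq_half (A B : R) : 0 < A -> A <= B -> 1 <= A ^+ 2 + B ^+ 2 ->
  (1 + B) / (A ^+ 3 * B ^+ 3) <= 16 * (A ^+ 3 * (1 + A) ^+ 2)^-1.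
Proof.
move=> A0 AB AB1; have B0 : 0 < B := lt_le_trans A0 AB.
have B23 : 2 / 3 <= B.
  rewrite leNgt; apply/negP => B3.
  have : A ^+ 2 <= B ^+ 2 by rewrite lerXn2r ?nnegrE // ltW.
  have : B ^+ 2 < (2 / 3) ^+ 2 by rewrite ltrXn2r ?nnegrE // ltW.
  lra.
have A1 : 0 < 1 + A by rewrite addr_gt0.
have B1 : 0 < 1 + B by rewrite addr_gt0.
have A30 : 0 < A ^+ 3 by rewrite exprn_gt0.
have B30 : 0 < B ^+ 3 by rewrite exprn_gt0.
have A20 : 0 < (1 + A) ^+ 2 by rewrite exprn_gt0.
have key : (1 + B) * (1 + A) ^+ 2 <= 16 * B ^+ 3.
  have h1 : (1 + A) ^+ 2 <= (1 + B) ^+ 2 by apply: lerXn2r; rewrite ?nnegrE ?lerD2l // ltW.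
  have h2 : 1 + B <= 5 / 2 * B by lra.
  have h3 : (1 + B) ^+ 3 <= (5 / 2 * B) ^+ 3 by apply: lerXn2r; rewrite ?nnegrE ?mulr_ge0 // ltW.
  have h4 := ler_wpM2l (ltW B1) h1.
  have h5 : (1 + B) * (1 + B) ^+ 2 = (1 + B) ^+ 3 by rewrite -exprS.
  rewrite exprMn in h3.
  have h6 : (5 / 2) ^+ 3 <= (16 : R) by lra.
  have h7 := ler_wpM2r (ltW B30) h6.
  lra.
rewrite ler_pdivrMr ?mulr_gt0 //.
have -> : 16 * (A ^+ 3 * (1 + A) ^+ 2)^-1 * (A ^+ 3 * B ^+ 3) = 16 * B ^+ 3 / (1 + A) ^+ 2.
  by field; rewrite !lt0r_neq0.
by rewrite ler_pdivlMr.
Qed.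

(** Negative curvature of the metric
    [rho = ((1 + A) (1 + B)) ^ (1/4) / (A B) ^ (3/2)], where [A ^ 2] and [B ^ 2] are the
    distances to the two punctures in units of the distance between these: the left
    side is [rho ^ 4], and the inner sum on the right is [16] times the Laplacian
    of [ln rho]. The hypothesis [1 <= A ^ 2 + B ^ 2] is the triangle inequality. *)
Lemma curvature_ineq (A B : R) : 0 < A -> 0 < B -> 1 <= A ^+ 2 + B ^+ 2 ->
  (1 + A) * (1 + B) / (A ^+ 6 * B ^+ 6) <=
  (16 * ((A ^+ 3 * (1 + A) ^+ 2)^-1 + (B ^+ 3 * (1 + B) ^+ 2)^-1)) ^+ 2.
Proof.
wlog AB : A B / A <= B.
  move=> H A0 B0 AB1; have [AB|BA] := leP A B; first exact: H.
  rewrite mulrC [_ ^+ 6 * _]mulrC [(1 + A) * _]mulrC -/(_ / _) (addrC (_^-1)) mulrC.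
  by apply: H => //; [exact: ltW|rewrite addrC].
move=> A0 B0 AB1.
have h := curvature_ineq_half A0 AB AB1.
have A1 : 0 < 1 + A by rewrite addr_gt0.
have B1 : 0 < 1 + B by rewrite addr_gt0.
have A30 : 0 < A ^+ 3 by rewrite exprn_gt0.
have B30 : 0 < B ^+ 3 by rewrite exprn_gt0.
apply: le_trans (_ : ((1 + B) / (A ^+ 3 * B ^+ 3)) ^+ 2 <= _).
  have -> : ((1 + B) / (A ^+ 3 * B ^+ 3)) ^+ 2 = (1 + B) * (1 + B) / (A ^+ 6 * B ^+ 6).
    by field; rewrite !lt0r_neq0.
  apply: ler_wpM2r; first by rewrite invr_ge0 mulr_ge0 // exprn_ge0 // ltW.
  by apply: ler_wpM2r; [exact: ltW|rewrite lerD2l].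
have q0 : 0 <= (B ^+ 3 * (1 + B) ^+ 2)^-1.
  by rewrite invr_ge0 mulr_ge0 ?exprn_ge0 // ltW.
have q1 : 0 <= (A ^+ 3 * (1 + A) ^+ 2)^-1.
  by rewrite invr_ge0 mulr_ge0 ?exprn_ge0 // ltW.
rewrite lerXn2r ?nnegrE //.
- by rewrite divr_ge0 // ?mulr_ge0 // ltW.
- by rewrite mulr_ge0 // addr_ge0.
- by rewrite (le_trans h) // ler_wpM2l // lerDl.
Qed.

Lemma rjet_continuous u z0 a c : rjet u z0 a c -> u z @[z --> z0] --> u z0.
Proof.
move=> H; apply: (cvgCR (F := nbhs z0)) => e e0; apply/nearC.
by have [d d0 Hd] := rjet_cont H e0; exists d.
Qed.

Variables (A : set (C R)) (f : C R -> C R) (c : C R -> nat -> C R).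
Hypothesis oA : open A.
Hypothesis serf : forall z1, A z1 ->
  \forall z \near z1, series (fun n => c z1 n * (z - z1) ^+ n) @ \oo --> f z.
Hypothesis df0 : forall z1, A z1 -> c z1 1%N != 0.
Variables (w0 p s : C R) (r1 m : R).
Hypothesis fw0 : forall z, A z -> f z != w0.
Hypotheses (pA : ~ A p) (sA : ~ A s) (ps : p != s).
Hypothesis m0 : 0 < m.

Let D := cabs (p - s).
Definition lnsq (F : C R -> C R) z := ln (cabs (F z) ^+ 2).
(** The coordinate [ln (|f - w0| / r1)], harmonic on [A], in which the round annulus
    becomes a strip. *)
Definition height z := 2^-1 * lnsq (fun z => f z - w0) z - ln r1.
(** Up to an additive constant, the logarithm of the metric [rho] on the plane without
    [p] and [s], divided by [|f' / (f - w0)|]: it measures the metric of [A] induced by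
    [rho] against the Euclidean metric in the coordinate [ln (f - w0)]. The coefficients
    [4^-1] and [3 / 8] make [rho] of order [-3/4] at [p] and [s] and of order [-5/4] at
    infinity. *)
Definition logmetric z :=
  4^-1 * softplus (lnsq (fun w => (w - p) / (s - p)) z) +
  4^-1 * softplus (lnsq (fun w => (w - s) / (s - p)) z) +
  - (3 / 8) * (lnsq (fun w => (w - p) / (s - p)) z + lnsq (fun w => (w - s) / (s - p)) z) +
  (- 2^-1) * lnsq (fun w => c w 1%N) z + 2^-1 * lnsq (fun z => f z - w0) z.

Let q z := cabs (c z 1%N) / cabs (f z - w0).

Let height_jet z : A z -> exists2 a, rjet height z a 0 & cabs a = q z.
Proof.
move=> Az; have h1 := hjetBc w0 (hjet_series (serf Az)).
have fn0 : f z - w0 != 0 by rewrite subr_eq0 fw0.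
have [n Hn cn] := rjet_lnabs (F := fun z => f z - w0) fn0 h1.
exists (2^-1%:C * n + 0).
  have := rjetD (rjetZ 2^-1 Hn) (rjet_cst (- ln r1) z).
  by rewrite mulr0 add0r.
rewrite addr0 cabsM cabs_real ger0_norm // /q.
apply/eqP; rewrite -(@eqrXn2 _ 2) //.
- by rewrite exprMn cn exprMn exprVn; apply/eqP; field; rewrite lt0r_neq0 // cabs_gt0.
- by rewrite mulr_ge0 ?cabs_ge0.
- by rewrite divr_ge0 ?cabs_ge0.
Qed.

Let root4 (F : C R -> C R) z := expR (lnsq F z / 4).

Let softplus_jet (F : C R -> C R) z a b : F z != 0 -> hjet F z a b ->
  exists n n', [/\ rjet (lnsq F) z n 0 &
   rjet (@softplus R \o lnsq F) z n'
    (cabs a ^+ 2 / (4 * (root4 F z) ^+ 3 * (1 + root4 F z) ^+ 2) / 4)].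
Proof.
move=> F0 HF; have [n Hn cn] := rjet_lnabs F0 HF.
have := rjet_comp Hn (jet1_softplus (lnsq F z)).
set n' := _ * _ => H; exists n, n'; split=> //.
rewrite /= mulr0 add0r cn -/(root4 F z) in H.
have E4 : cabs (F z) ^+ 2 = root4 F z ^+ 4.
  rewrite /root4 -expRM_natl /lnsq mulrC divfK // lnK // posrE exprn_gt0 //.
  by rewrite cabs_gt0.
rewrite E4 in H.
move: H; set E := root4 F z.
have E0 : 0 < E by exact: expR_gt0.
have E1 : 0 < 1 + E by rewrite addr_gt0.
have -> // : E / (16 * (1 + E) ^+ 2) / 2 * (4 * cabs a ^+ 2 / E ^+ 4) / 2 =
  cabs a ^+ 2 / (4 * E ^+ 3 * (1 + E) ^+ 2) / 4.
by field; rewrite !lt0r_neq0.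
Qed.

Let F1 w := (w - p) / (s - p).
Let F2 w := (w - s) / (s - p).

Let Fjet (x : C R) z : hjet (fun w => (w - x) / (s - p)) z (s - p)^-1 0.
Proof.
have := hjet_lin (s - p)^-1 (- x / (s - p)) z.
by rewrite (_ : (fun w => _) = (fun w => (w - x) / (s - p))) //; apply/funext => w; ring.
Qed.

Let sp0 : s - p != 0.
Proof. by rewrite subr_eq0 eq_sym. Qed.

Let F10 z : A z -> F1 z != 0.
Proof.
move=> Az; rewrite /F1 mulf_neq0 ?invr_eq0 // subr_eq0; apply/eqP => zp.
by apply: pA; rewrite -zp.
Qed.

Let F20 z : A z -> F2 z != 0.
Proof.
move=> Az; rewrite /F2 mulf_neq0 ?invr_eq0 // subr_eq0; apply/eqP => zp.
by apply: sA; rewrite -zp.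
Qed.

Let D0 : 0 < D.
Proof. by rewrite cabs_gt0 subr_eq0. Qed.

Let Ds : cabs (s - p)^-1 = D^-1.
Proof. by rewrite cabsV cabsB. Qed.

Let Z z := ((root4 F1 z ^+ 3 * (1 + root4 F1 z) ^+ 2)^-1 +
            (root4 F2 z ^+ 3 * (1 + root4 F2 z) ^+ 2)^-1).

Let logmetric_jet z : A z -> exists a, rjet logmetric z a (D ^- 2 * Z z / 64).
Proof.
move=> Az.
have [n1 [n1' [H1 K1]]] := softplus_jet (F := F1) (F10 Az) (Fjet p z).
have [n2 [n2' [H2 K2]]] := softplus_jet (F := F2) (F20 Az) (Fjet s z).
have [n3 H3 _] := rjet_lnabs (F := fun w => c w 1%N) (df0 Az) (hjet_deriv oA Az serf).
have fn0 : f z - w0 != 0 by rewrite subr_eq0 fw0.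
have [n4 H4 _] := rjet_lnabs (F := fun z => f z - w0) fn0 (hjetBc w0 (hjet_series (serf Az))).
have := rjetD (rjetD (rjetD (rjetD (rjetZ 4^-1 K1) (rjetZ 4^-1 K2))
  (rjetZ (- (3 / 8)) (rjetD H1 H2))) (rjetZ (- 2^-1) H3)) (rjetZ 2^-1 H4).
set n := (_ + _) => H; exists n.
rewrite !Ds addr0 !mulr0 !addr0 in H.
set u := (X in rjet _ _ _ X) in H.
suff -> : D ^- 2 * Z z / 64 = u by exact: H.
rewrite /u /Z -/F1 -/F2.
have E10 : 0 < root4 F1 z by exact: expR_gt0.
have E11 : 0 < 1 + root4 F1 z by rewrite addr_gt0.
have E20 : 0 < root4 F2 z by exact: expR_gt0.
have E21 : 0 < 1 + root4 F2 z by rewrite addr_gt0.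
move: (root4 F1 z) (root4 F2 z) E10 E11 E20 E21 => a b *.
by field; rewrite !lt0r_neq0.
Qed.

Let Tfun z := logmetric z + (ln (height z) + ln (m - height z)).

Let T_at_max z : A z -> 0 < height z < m ->
  (\forall w \near z, Tfun w <= Tfun z) -> Tfun z <= ln 16 + ln D + ln m.
Proof.
move=> Az /andP[x0 xm] Tmax.
have [a Ha ca] := height_jet Az.
have [b Hb] := logmetric_jet Az.
have xm' : 0 < height z < m by rewrite x0.
have := rjet_max (rjetD Hb (rjet_comp Ha (jet1_lnln xm'))) Tmax.
rewrite mulr0 add0r ca.
set x := height z in x0 xm xm' *.
have mx0 : 0 < m - x by rewrite subr_gt0.
have q0 : 0 < q z by rewrite divr_gt0 // cabs_gt0 ?df0 // subr_eq0 fw0.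
have [S SE] : exists S, S = D * (m / (x * (m - x))) * q z by eexists.
have lam0 : 0 < m / (x * (m - x)) by rewrite divr_gt0 // mulr_gt0.
have S0 : 0 < S by rewrite SE; exact: mulr_gt0 (mulr_gt0 D0 lam0) q0.
move=> cle.
have ZS : Z z <= 16 * S ^+ 2.
  have lam : x^-1 ^+ 2 + (m - x)^-1 ^+ 2 <= (m / (x * (m - x))) ^+ 2.
    have -> : m / (x * (m - x)) = x^-1 + (m - x)^-1.
      by field; rewrite !lt0r_neq0.
    rewrite sqrrD lerD2r lerDl mulrn_wge0 // mulr_ge0 // invr_ge0 ltW //.
  have D2 : 0 < D ^+ 2 by rewrite exprn_gt0.
  have e1 : D ^- 2 * Z z / 64 <= (x^-1 ^+ 2 + (m - x)^-1 ^+ 2) / 2 * q z ^+ 2 / 2.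
    move: cle; lra.
  have e2 : (x^-1 ^+ 2 + (m - x)^-1 ^+ 2) * q z ^+ 2 <= (m / (x * (m - x))) ^+ 2 * q z ^+ 2.
    by rewrite ler_wpM2r // exprn_ge0 // ltW.
  have e3 : D ^- 2 * Z z <= 16 * ((m / (x * (m - x))) ^+ 2 * q z ^+ 2) by lra.
  have := ler_wpM2l (ltW D2) e3.
  rewrite mulVKf ?gt_eqF // SE !exprMn; lra.
have [a1 a1E] : exists a, a = root4 F1 z by exists (root4 F1 z).
have [a2 a2E] : exists a, a = root4 F2 z by exists (root4 F2 z).
have a10 : 0 < a1 by rewrite a1E expR_gt0.
have a20 : 0 < a2 by rewrite a2E expR_gt0.
have sqE (F : C R -> C R) : F z != 0 -> root4 F z ^+ 2 = cabs (F z).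
  move=> Fz; rewrite /root4 -expRM_natl /lnsq lnXn ?cabs_gt0 //.
  have -> : 2 * (ln (cabs (F z)) *+ 2 / 4) = ln (cabs (F z)).
    by rewrite mulr2n; field.
  by rewrite lnK // posrE cabs_gt0.
have a12 : 1 <= a1 ^+ 2 + a2 ^+ 2.
  rewrite a1E a2E !sqE ?F10 ?F20 // -(cabsN (F2 z)).
  apply: le_trans (cabsD _ _).
  rewrite (_ : F1 z - F2 z = 1) ?cabs1 // /F1 /F2 -mulrBl.
  by rewrite (_ : z - p - (z - s) = s - p) ?divff //; ring.
have := curvature_ineq a10 a20 a12.
rewrite [X in 16 * X](_ : _ = Z z); last by rewrite a1E a2E.
have Z0 : 0 < Z z.
  by rewrite /Z -a1E -a2E; apply: addr_gt0; rewrite invr_gt0 mulr_gt0 // exprn_gt0 // addr_gt0.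
have ZS2 : (16 * Z z) ^+ 2 <= (256 * S ^+ 2) ^+ 2.
  have S2 : 0 <= S ^+ 2 by rewrite exprn_ge0 // ltW.
  have Z0' := ltW Z0.
  move: ZS S2 Z0'; move: (Z z) (S ^+ 2) => u1 u2 h1 h2 h3.
  have h4 : 16 * u1 <= 256 * u2 by lra.
  by apply: lerXn2r h4; rewrite nnegrE; [exact: mulr_ge0 (ler0n _ 16) h3|exact: mulr_ge0 (ler0n _ 256) h2].
move=> /le_trans /(_ ZS2).
have P1 : 0 < (1 + a1) * (1 + a2) / (a1 ^+ 6 * a2 ^+ 6).
  by apply: divr_gt0; apply: mulr_gt0; rewrite ?exprn_gt0 ?addr_gt0.
have -> : (256 * S ^+ 2) ^+ 2 = (16 * S) ^+ 4 by ring.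
have P2 : 0 < 16 * S := mulr_gt0 (ltr0Sn _ 15) S0.
have P3 : 0 < (16 * S) ^+ 4 by rewrite exprn_gt0.
rewrite -ler_ln ?posrE // => lnle.
have lnS : ln (16 * S) = ln 16 + (ln D + (ln m - (ln x + ln (m - x))) + (ln (cabs (c z 1%N)) - ln (cabs (f z - w0)))).
  have fz : 0 < cabs (f z - w0) by rewrite cabs_gt0 subr_eq0 fw0.
  have dz : 0 < cabs (c z 1%N) by rewrite cabs_gt0 df0.
  have xmx : 0 < x * (m - x) by rewrite mulr_gt0.
  rewrite lnM ?posrE // SE (lnM (x := D * _)) ?posrE //; last exact: mulr_gt0 D0 lam0.
  by rewrite lnM ?posrE // !ln_div ?posrE // lnM ?posrE.
rewrite lnXn // lnS in lnle.
have lnP : ln ((1 + a1) * (1 + a2) / (a1 ^+ 6 * a2 ^+ 6)) =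
   softplus (lnsq F1 z) + softplus (lnsq F2 z) - 6 / 4 * (lnsq F1 z + lnsq F2 z).
  have b1 : 0 < 1 + a1 by rewrite addr_gt0.
  have b2 : 0 < 1 + a2 by rewrite addr_gt0.
  have c1 : 0 < a1 ^+ 6 by rewrite exprn_gt0.
  have c2 : 0 < a2 ^+ 6 by rewrite exprn_gt0.
  rewrite ln_div ?posrE; [|exact: mulr_gt0|exact: mulr_gt0].
  rewrite (lnM (x := 1 + a1)) ?posrE // (lnM (x := a1 ^+ 6)) ?posrE // !lnXn //.
  have -> : ln (1 + a1) = softplus (lnsq F1 z) by rewrite a1E.
  have -> : ln (1 + a2) = softplus (lnsq F2 z) by rewrite a2E.
  have -> : ln a1 = lnsq F1 z / 4 by rewrite a1E expRK.
  have -> : ln a2 = lnsq F2 z / 4 by rewrite a2E expRK.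
  by move: (softplus (lnsq F1 z)) (softplus (lnsq F2 z)) (lnsq F1 z) (lnsq F2 z) => *; field.
rewrite lnP in lnle.
rewrite /Tfun -/x /logmetric -/F1 -/F2.
have -> : lnsq (c^~ 1%N) z = 2 * ln (cabs (c z 1%N)).
  by rewrite /lnsq lnXn ?cabs_gt0 ?df0 // mulr_natl.
have -> : lnsq (fun z => f z - w0) z = 2 * ln (cabs (f z - w0)).
  by rewrite /lnsq lnXn ?cabs_gt0 ?subr_eq0 ?fw0 // mulr_natl.
move: lnle.
move: (ln x) (ln (m - x)) (ln (cabs (f z - w0))) (ln (cabs (c z 1%N))).
move: (softplus (lnsq F1 z)) (softplus (lnsq F2 z)) (lnsq F1 z) (lnsq F2 z) (ln 16) (ln D) (ln m).
move=> *; lra.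
Qed.

(** On the strip [0 < x < m] the metric [lambda = m / (x (m - x))] satisfies
    [Laplacian (ln lambda) <= lambda ^ 2] and blows up at the boundary. So
    [rho / (lambda |f' / (f - w0)|)] attains its maximum over the compact set [Q]
    where [0 < x < m]; there the Laplacian of its logarithm is not positive, and the
    curvature of [rho] bounds the value by [16]. *)
Lemma ahlfors_bound (Q : set (C R)) :
  Q = [set z | A z /\ 0 <= height z <= m] -> compact Q ->
  forall z, A z -> 0 < height z < m ->
  logmetric z + (ln (height z) + ln (m - height z)) <= ln 16 + ln D + ln m.
Proof.
move=> QE cQ z Az /andP[x0 xm].
pose G w := expR (logmetric w) * (height w * (m - height w)).
have cG : {within Q, continuous G}.
  apply: continuous_in_subspaceT => w; rewrite inE QE => -[Aw _].
  have [a Ha _] := height_jet Aw; have [b Hb] := logmetric_jet Aw.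
  have h1 := rjet_continuous Ha; have h2 := rjet_continuous Hb.
  have h3 := cvg_comp logmetric (@expR R) h2 (@continuous_expR R (logmetric w)).
  have FF : ProperFilter (nbhs w) by exact: nbhs_pfilter.
  have h4 := cvgB (F := nbhs w) (@cvg_cst _ m (C R) (nbhs w) _) h1.
  exact: (cvgM (F := nbhs w) h3 (cvgM (F := nbhs w) h1 (h4 _ _))).
have Qz : Q z by rewrite QE; split => //; rewrite !ltW.
have [w] := compact_EVT_max (ex_intro _ z Qz) cQ cG.
rewrite inE => Qw wmax.
have Gz : 0 < G z by rewrite mulr_gt0 ?expR_gt0 // mulr_gt0 // subr_gt0.
have Gzw : G z <= G w by apply: wmax; rewrite inE.
have Gw : 0 < G w := lt_le_trans Gz Gzw.
have [Aw /andP[w1 w2]] : A w /\ 0 <= height w <= m by move: Qw; rewrite QE.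
have Hw : 0 < height w * (m - height w) by move: Gw; rewrite /G pmulr_rgt0 ?expR_gt0.
have xw0 : 0 < height w.
  by rewrite lt_def w1 andbT; apply/eqP => e; move: Hw; rewrite e mul0r ltxx.
have xwm : 0 < m - height w by move: Hw; rewrite pmulr_rgt0.
have lnG v : 0 < height v -> 0 < m - height v -> Tfun v = ln (G v).
  move=> v0 v1; rewrite /G lnM ?posrE ?expR_gt0 ?mulr_gt0 // expRK lnM ?posrE //.
have -> : logmetric z + (ln (height z) + ln (m - height z)) = ln (G z).
  by rewrite -lnG // subr_gt0.
apply: le_trans (_ : ln (G w) <= _); first by rewrite ler_ln ?posrE.
rewrite -lnG //; apply: T_at_max => //; first by rewrite xw0 -subr_gt0.
have [a Ha _] := height_jet Aw.
have e0 : 0 < Num.min (height w) (m - height w) by rewrite lt_min xw0.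
have [d d0 Hd] := rjet_cont Ha e0.
have [d' d'0 Hd'] := (openC A).1 oA w Aw.
apply/nearC; exists (Num.min d d'); first by rewrite lt_min d0.
move=> v; rewrite lt_min => /andP[/Hd vd /Hd' Av].
move: vd; rewrite lt_min !ltr_norml => /andP[/andP[v1 v2] /andP[v3 v4]].
have vp : 0 < height v by lra.
have vm : 0 < m - height v by lra.
have Qv : Q v by rewrite QE; split => //; rewrite ltW //= -subr_ge0 ltW.
have Gv : 0 < G v by rewrite mulr_gt0 ?expR_gt0 // mulr_gt0.
rewrite !lnG // ler_ln ?posrE //; apply: wmax; by rewrite inE.
Qed.

End ahlfors.

(** * Compactness, paths and curves in the plane *)

Section planetop.
Variable R : realType.
Implicit Types z : C R.

Lemma cont_param_connected (phi : R -> C R) (a b : R) :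
  (forall t, t \in `[a, b]%R -> forall e : R, 0 < e -> exists2 d : R, 0 < d &
     forall u, u \in `[a, b]%R -> `|u - t| < d -> cabs (phi u - phi t) < e) ->
  connected (phi @` [set t | t \in `[a, b]%R]).
Proof.
move=> H; apply: connected_continuous_connected; first exact: segment_connected.
apply/subspace_continuousP => t tab; apply/cvgCC => e e0.
rewrite /= near_withinE; apply/nearR.
have [d d0 Hd] := H t tab e e0; exists d => // u ud uab; exact: Hd.
Qed.

Lemma connected_open_split (S O1 O2 : set (C R)) : connected S -> open O1 -> open O2 ->
  S `<=` O1 `|` O2 -> O1 `&` O2 = set0 -> (exists2 z, S z & O1 z) -> S `<=` O1.
Proof.
move=> cS o1 o2 SO O12 [z0 Sz0 O1z0].
have E : S `&` O1 = S.
  apply: cS; first by exists z0.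
    by exists O1.
  exists (~` O2); first exact: open_closedC.
  apply/seteqP; split => z [Sz Oz]; split => //.
    by move=> O2z; have : (O1 `&` O2) z by []; rewrite O12.
  by have [] := SO z Sz.
by rewrite -E => z [].
Qed.

Lemma segment_path (x y : C R) (S : set (C R)) :
  (forall t : R, 0 <= t <= 1 -> S (x + t%:C * (y - x))) ->
  exists S', [/\ connected S', S' x, S' y & S' `<=` S].
Proof.
move=> H; exists ((fun t : R => x + t%:C * (y - x)) @` [set t | t \in `[0, 1]%R]); split.
- apply: cont_param_connected => t _ e e0.
  have L0 : 0 < cabs (y - x) + 1 by rewrite ltr_wpDl ?cabs_ge0.
  exists (e / (cabs (y - x) + 1)); first by rewrite divr_gt0.
  move=> u _; rewrite ltr_pdivlMr // => hu.
  rewrite (_ : _ - _ = (u - t)%:C * (y - x)); last by rewrite rmorphB; ring.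
  rewrite cabsM cabs_real (le_lt_trans _ hu) // ler_wpM2l // lerDl //.
- by exists 0 => /=; [rewrite in_itv /= lexx ler01|rewrite mul0r addr0].
- by exists 1 => /=; [rewrite in_itv /= lexx ler01|rewrite mul1r addrC subrK].
- by move=> _ [t /= + <-]; rewrite in_itv => /H.
Qed.

Lemma clopenC_all (S : set (C R)) (x y : C R) : open S -> open (~` S) -> S x -> S y.
Proof.
move=> oS oS' Sx.
have [S' [cS' S'x S'y _]] := @segment_path x y setT (fun _ _ => I).
apply: (connected_open_split cS' oS oS' _ _ _ S'y).
- by move=> z _; exact: lem.
- by rewrite setICr.
- by exists x.
Qed.

(** The near-covering form of compactness, with tolerances filtered at [0+]. It yields the
    margins, bounds and moduli of continuity used below. *)
Lemma compact_uniform (X : set (C R)) (P : R -> C R -> Prop) : compact X ->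
  (forall (t t' : R) x, 0 < t' -> t' <= t -> P t x -> P t' x) ->
  (forall x, X x -> exists2 e : R, 0 < e & forall x', cabs (x' - x) < e -> P e x') ->
  exists2 t : R, 0 < t & forall x, X x -> P t x.
Proof.
move=> cX mono H.
have /compact_near_coveringP/(_ R 0^'+ P _) nc := cX.
have {}nc : \forall t \near (0:R)^'+, X `<=` P t.
  apply: nc => x Xx; have [e e0 He] := H x Xx.
  exists ([set x' | cabs (x' - x) < e], [set t : R | 0 < t < e]).
    split => /=; first by apply/nearC; exists e.
    near=> t; apply/andP; split; first by near: t; exact: nbhs_right_gt.
    by near: t; exact: nbhs_right_lt.
  by move=> [x' t] [/= hx' /andP[t0 te]]; apply: mono (He _ hx') => //; exact: ltW.
have [t [t0 Ht]] : exists t : R, 0 < t /\ (X `<=` P t).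
  apply: (@filter_ex _ (0:R)^'+); near=> t; split; first by near: t; exact: nbhs_right_gt.
  by near: t.
by exists t.
Unshelve. all: by end_near. Qed.

Lemma compact_margin (X U : set (C R)) : compact X -> open U -> X `<=` U ->
  exists2 tau : R, 0 < tau & forall x z, X x -> cabs (z - x) < tau -> U z.
Proof.
move=> cX oU XU.
have [|x Xx|t t0 Ht] := @compact_uniform X (fun t x => forall z, cabs (z - x) < t -> U z) cX.
- by move=> t t' x t'0 tt' H z hz; apply: H; exact: lt_le_trans tt'.
- have [e e0 He] := (openC U).1 oU x (XU x Xx).
  exists (e / 2); first by rewrite divr_gt0.
  move=> x' hx' z hz; apply: He; have := cabs_tri x' z x; lra.
- by exists t => // x z Xx; exact: Ht.
Qed.

Lemma compact_bdd (X : set (C R)) : compact X ->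
  exists2 M : R, 0 < M & forall x, X x -> cabs x <= M.
Proof.
move=> cX.
have [|x Xx|t t0 Ht] := @compact_uniform X (fun t x => t * cabs x <= 1) cX.
- move=> t t' x t'0 tt' H; apply: le_trans H.
  by rewrite ler_wpM2r ?cabs_ge0.
- have L0 : 0 < cabs x + 1 by rewrite ltr_wpDl ?cabs_ge0.
  exists (Num.min 1 (cabs x + 1)^-1); first by rewrite lt_min ltr01 invr_gt0.
  move=> x'; rewrite lt_min => /andP[h1 _].
  rewrite (@le_trans _ _ ((cabs x + 1)^-1 * cabs x')) //.
    by rewrite ler_wpM2r ?cabs_ge0 // ge_min lexx orbT.
  rewrite mulrC ler_pdivrMr // mul1r.
  have := cabs_subl x' x; lra.
- exists t^-1; first by rewrite invr_gt0.
  by move=> x /Ht; rewrite -[t^-1]div1r ler_pdivlMr // mulrC.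
Qed.

Lemma compact_closedC (X : set (C R)) : compact X -> closed X.
Proof.
move=> cX; apply: compact_closed cX.
exact: norm_hausdorff.
Qed.

Definition expi (t : R) : C R := cos t +i* sin t.

Lemma cabs_expi t : cabs (expi t) = 1.
Proof.
apply/eqP; rewrite -(@eqrXn2 _ 2) ?cabs_ge0 // cabs_sqr /= expr1n.
by rewrite cos2Dsin2.
Qed.

Lemma expi0 : expi 0 = 1.
Proof. by rewrite /expi cos0 sin0. Qed.

Let lip1 (f df : R -> R) (a b : R) : (forall x : R, is_derive x 1 f (df x)) ->
  (forall x : R, `|df x| <= 1) -> `|f b - f a| <= `|b - a|.
Proof.
move=> Df Hdf; wlog ab : a b / a <= b.
  move=> H; have [ab|ba] := leP a b; first exact: H.
  by rewrite distrC (distrC b); apply: H; exact: ltW.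
have cf : {within `[a, b], continuous f}.
  apply: derivable_within_continuous => x _.
  exact: (@ex_derive _ _ _ _ _ _ _ (Df x)).
have [c _ ->] := MVT_segment ab (fun x _ => Df x) cf.
by rewrite normrM ler_piMl.
Qed.

Lemma expi_lip a b : cabs (expi b - expi a) <= 2 * `|b - a|.
Proof.
apply: le_trans (cabs_le_ReIm _) _; rewrite /= mulr_natl mulr2n; apply: lerD.
  apply: (@lip1 (@cos R) (fun x : R => - sin x)) => // x; rewrite normrN ler_norml.
  by rewrite sin_geN1 sin_le1.
apply: (@lip1 (@sin R) (@cos R)) => // x; rewrite ler_norml.
by rewrite cos_geN1 cos_le1.
Qed.

Lemma polar z : exists2 t : R, `|t| <= 4 & z = (cabs z)%:C * expi t.
Proof.
have pi4 : (pi : R) <= 4.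
  have := @pihalf_lt2 R; rewrite ltr_pdivrMr // => h; lra.
have [->|z0] := eqVneq z 0.
  by exists 0; rewrite ?normr0 // cabs0 mul0r.
have c0 : 0 < cabs z by rewrite cabs_gt0.
pose x : R := complex.Re z / cabs z.
have x1 : -1 <= x <= 1.
  rewrite -ler_norml normrM normfV (ger0_norm (cabs_ge0 z)) ler_pdivrMr // mul1r.
  exact: normRe_le.
have [/andP[t0 tpi] ct] := acos_def x1.
have st : sin (acos x) = `|complex.Im z| / cabs z.
  have E : 1 - x ^+ 2 = (`|complex.Im z| / cabs z) ^+ 2.
    have := cabs_sqr z; rewrite /x !expr_div_n real_normK ?num_real //.
    have : cabs z ^+ 2 != 0 by rewrite lt0r_neq0 // exprn_gt0.
    move: (cabs z ^+ 2) (complex.Re z ^+ 2) (complex.Im z ^+ 2) => u1 u2 u3 u0 e1.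
    by rewrite e1 in u0 *; field.
  by rewrite sin_acos // E sqrtr_sqr ger0_norm // divr_ge0 // cabs_ge0.
have [i0|i0] := leP 0 (complex.Im z).
  exists (acos x); first by rewrite ger0_norm // (le_trans tpi).
  rewrite /expi ct st ger0_norm // /x; case: (z) c0 => a b c0.
  move: (cabs (a +i* b)) c0 => k k0.
  by apply/eqP; rewrite eq_complex /= !mul0r addr0 subr0 !(mulrC k) !divfK ?(lt0r_neq0 k0) ?eqxx.
exists (- acos x); first by rewrite normrN ger0_norm // (le_trans tpi).
rewrite /expi cosN sinN ct st ltr0_norm // /x; case: (z) c0 => a b c0.
move: (cabs (a +i* b)) c0 => k k0.
apply/eqP; rewrite eq_complex /= !mul0r addr0 subr0 mulNr opprK.
by rewrite !(mulrC k) !divfK ?(lt0r_neq0 k0) ?eqxx.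
Qed.

(** Interpolating modulus and argument linearly keeps the path inside any round
    annulus centred at [w0] that contains both end points. *)
Lemma annulus_path (w0 y1 y2 : C R) : exists phi : R -> C R,
 [/\ phi 0 = y1, phi 1 = y2,
  (forall t, 0 <= t <= 1 -> Num.min (cabs (y1 - w0)) (cabs (y2 - w0)) <= cabs (phi t - w0)
     <= Num.max (cabs (y1 - w0)) (cabs (y2 - w0))) &
  (forall t, forall e : R, 0 < e -> exists2 d : R, 0 < d &
     forall u, `|u - t| < d -> cabs (phi u - phi t) < e)].
Proof.
have [a1 _ E1] := polar (y1 - w0); have [a2 _ E2] := polar (y2 - w0).
set R1 := cabs (y1 - w0); set R2 := cabs (y2 - w0).
pose rr (t : R) := (1 - t) * R1 + t * R2.
pose aa (t : R) := (1 - t) * a1 + t * a2.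
exists (fun t => w0 + (rr t)%:C * expi (aa t)); split.
- by rewrite /rr /aa subr0 !mul1r !mul0r !addr0 -E1 addrC subrK.
- by rewrite /rr /aa subrr !mul1r !mul0r !add0r -E2 addrC subrK.
- move=> t /andP[t0 t1]; rewrite (addrC w0) addrK cabsM cabs_expi mulr1 cabs_real.
  have R10 : 0 <= R1 by exact: cabs_ge0.
  have R20 : 0 <= R2 by exact: cabs_ge0.
  have t1' : 0 <= 1 - t by rewrite subr_ge0.
  rewrite ger0_norm ?addr_ge0 ?mulr_ge0 // /rr.
  have [R12|R12] := leP R1 R2.
    apply/andP; split; nra.
  apply/andP; split; nra.
- move=> t e e0.
  pose L := `|R2 - R1| + 2 * (`|R1| + `|R2 - R1| * (`|t| + 1)) * `|a2 - a1| + 1.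
  have L0 : 0 < L by rewrite ltr_wpDl // addr_ge0 // !mulr_ge0 // addr_ge0 // mulr_ge0 // addr_ge0.
  exists (Num.min 1 (e / L)); first by rewrite lt_min ltr01 divr_gt0.
  move=> u; rewrite lt_min ltr_pdivlMr // => /andP[u1 uL].
  apply: le_lt_trans uL.
  rewrite (_ : _ - _ = (rr u - rr t)%:C * expi (aa t) + (rr u)%:C * (expi (aa u) - expi (aa t))); last first.
    by rewrite rmorphB; ring.
  apply: le_trans (cabsD _ _) _; rewrite !cabsM cabs_expi !cabs_real mulr1.
  have -> : rr u - rr t = (u - t) * (R2 - R1) by rewrite /rr; ring.
  have ha := expi_lip (aa t) (aa u).
  have ea : aa u - aa t = (u - t) * (a2 - a1) by rewrite /aa; ring.
  rewrite ea normrM in ha.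
  have hr : `|rr u| <= `|R1| + `|R2 - R1| * (`|t| + 1).
    rewrite (_ : rr u = R1 + (R2 - R1) * u); last by rewrite /rr; ring.
    rewrite (le_trans (ler_normD _ _)) // lerD2l normrM ler_wpM2l //.
    have := ler_normD (u - t) t; rewrite subrK; lra.
  rewrite normrM.
  have q1 := ler_pM (normr_ge0 _) (cabs_ge0 _) hr ha.
  have q0 : 0 <= `|u - t| by [].
  rewrite /L; move: q1; set H := _ + _ * (_ + 1).
  move=> q1.
  have -> : `|u - t| * (`|R2 - R1| + 2 * H * `|a2 - a1| + 1) =
     `|u - t| * `|R2 - R1| + H * (2 * (`|u - t| * `|a2 - a1|)) + `|u - t| by ring.
  lra.
Qed.

(** The speed bound is only known while the curve stays within [D] of its start.
    The supremum of the times up to which the conclusion holds can be increased as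
    long as it is smaller than [T], because [kap * T <= D]. *)
Lemma lip_propagate (G : R -> C R) (T D kap : R) : 0 <= T -> 0 <= kap -> kap * T <= D ->
  (forall t, 0 <= t <= T -> forall e : R, 0 < e -> exists2 d : R, 0 < d &
     forall u, `|u - t| < d -> cabs (G u - G t) < e) ->
  (forall t, 0 <= t <= T -> cabs (G t - G 0) <= D -> exists2 d : R, 0 < d &
     forall u, `|u - t| < d -> cabs (G u - G t) <= kap * `|u - t|) ->
  forall t, 0 <= t <= T -> cabs (G t - G 0) <= kap * t.
Proof.
move=> T0 kap0 kT Gc Gl.
pose S := [set t | 0 <= t <= T /\ forall u, 0 <= u <= t -> cabs (G u - G 0) <= kap * u].
have S0 : S 0.
  split; first by rewrite lexx.
  by move=> u; rewrite -eq_le => /eqP <-; rewrite subrr cabs0 mulr0.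
have Sub : ubound S T by move=> t [/andP[]].
have hS : has_sup S by split; [exists 0|exists T].
pose sg := sup S.
have sg0 : 0 <= sg by exact: ub_le_sup hS.2 _ S0.
have sgT : sg <= T by apply: ge_sup => //; exists 0.
have lts u : 0 <= u -> u < sg -> cabs (G u - G 0) <= kap * u.
  move=> u0 us; have e0 : 0 < sg - u by rewrite subr_gt0.
  have [t [_ Ht]] := sup_adherent e0 hS.
  rewrite -/sg subKr => ut; apply: Ht; rewrite u0 /=; exact: ltW.
have sgT' : 0 <= sg <= T by rewrite sg0.
have ats : cabs (G sg - G 0) <= kap * sg.
  apply/ler_addgt0Pr => e e0.
  have [d d0 Hd] := Gc sg sgT' e e0.
  pose u := Num.max 0 (sg - d / 2).
  have u0 : 0 <= u by rewrite le_max lexx.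
  have [sgz|sgp] := leP sg 0.
    have -> : sg = 0 by apply/le_anti; rewrite sgz sg0.
    by rewrite subrr cabs0 mulr0 add0r ltW.
  have us : u < sg by rewrite gt_max sgp /=; lra.
  have ud : `|u - sg| < d.
    rewrite distrC gtr0_norm ?subr_gt0 // ltrBlDl -ltrBlDr.
    by rewrite lt_max; apply/orP; right; lra.
  have h1 := Hd u ud; have h2 := lts u u0 us.
  have h3 := ler_wpM2l kap0 (ltW us).
  have := cabs_tri (G u) (G sg) (G 0); rewrite (cabsB (G sg) (G u)); lra.
have sgE : sg = T.
  apply/le_anti; rewrite sgT /= leNgt; apply/negP => sT.
  have [|d d0 Hd] := Gl sg sgT'.
    by rewrite (le_trans ats) // (le_trans _ kT) // ler_wpM2l.
  pose v := Num.min T (sg + d / 2).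
  have vs : sg < v by rewrite lt_min sT /=; lra.
  have : S v.
    split; first by rewrite ge_min lexx andbT (le_trans sg0) // ltW.
    move=> u /andP[u0 uv]; have [us|us] := ltP u sg; first exact: lts.
    have ud : `|u - sg| < d.
      rewrite ger0_norm ?subr_ge0 // ltrBlDl (le_lt_trans uv) // gt_min.
      by apply/orP; right; lra.
    have := Hd u ud; rewrite ger0_norm ?subr_ge0 // => h1.
    have := cabs_tri (G sg) (G u) (G 0); rewrite mulrBr in h1; lra.
  by move/(ub_le_sup hS.2); rewrite -/sg leNgt vs.
move=> t /andP[t0]; rewrite le_eqVlt => /orP[/eqP ->|tT]; first by rewrite -sgE.
by apply: lts => //; rewrite sgE.
Qed.

End planetop.

(** * Level curves of a conformal annulus *)

Section annulus.
Variable R : realType.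
Implicit Types z y : C R.
Variables (A : set (C R)) (f : C R -> C R) (c : C R -> nat -> C R).
Hypothesis oA : open A.
Hypothesis serf : forall z1, A z1 ->
  \forall z \near z1, series (fun n => c z1 n * (z - z1) ^+ n) @ \oo --> f z.
Hypothesis injf : set_inj A f.
Variables (w0 : C R) (r1 r2 : R).
Hypothesis fA : f @` A = round_annulus w0 r1 r2.

(** The level sets of [nu] are the preimages of the circles about [w0]; they foliate
    [A] by closed curves around the bounded complementary component. *)
Definition nu z := cabs (f z - w0).

Lemma annulusE y : round_annulus w0 r1 r2 y = (r1 < cabs (y - w0) < r2) :> Prop.
Proof. by rewrite /round_annulus /= cabsE !ltcR. Qed.

Lemma nuA z : A z -> r1 < nu z < r2.
Proof. by move=> Az; rewrite -annulusE -fA; exists z. Qed.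

Lemma f_surj y : r1 < cabs (y - w0) < r2 -> exists2 z, A z & f z = y.
Proof. by rewrite -annulusE -fA. Qed.

Lemma coef_neq0 z : A z -> c z 1%N != 0.
Proof. by move=> Az; exact: inj_coef_neq0 oA Az injf (serf Az). Qed.

Lemma f_cont z : A z -> forall e : R, 0 < e -> exists2 d : R, 0 < d &
  forall z', cabs (z' - z) < d -> cabs (f z' - f z) < e.
Proof.
move=> Az e e0; have [r rr0 /(_ 0%N)[B B0 HB]] := taylor_rem_lip (serf Az).
have L0 : 0 < B + 1 by rewrite ltr_wpDl.
exists (Num.min r (e / (B + 1))); first by rewrite lt_min rr0 divr_gt0.
move=> z'; rewrite lt_min ltr_pdivlMr // => /andP[h1 h2].
have := HB (z' - z) 0 (cabs (z' - z)) (ltW h1) (lexx _).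
rewrite cabs0 cabs_ge0 => /(_ isT).
rewrite /taylor_rem !big_ord1 !expr0 addr0 subr0 !mulr1.
rewrite (_ : z + (z' - z) = z'); last by rewrite addrC subrK.
rewrite (_ : _ - _ - _ = f z' - f z); last by ring.
have := cabs_ge0 (z' - z); lra.
Qed.

(** The increment of [f] differs from the linear one by at most [ep] times the increment
    of the argument, with [ep] so small that [cabs a - ep >= L^-1]. *)
Lemma inv_lip z (L : R) : A z -> (cabs (c z 1%N))^-1 < L -> exists2 d : R, 0 < d &
  forall y, cabs (y - f z) < d -> exists z', [/\ A z', f z' = y & cabs (z' - z) <= L * cabs (y - f z)].
Proof.
move=> Az HL; set a := c z 1%N in HL *.
have a0 : a != 0 := coef_neq0 Az.
have aa0 : 0 < cabs a by rewrite cabs_gt0.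
have L0 : 0 < L by rewrite (lt_trans _ HL) // invr_gt0.
have aL : 1 < cabs a * L by rewrite mulrC -ltr_pdivrMr // div1r.
have [rA rA0 HA] := (openC A).1 oA z Az.
have [r rr0 /(_ 1%N)[B B0 HB]] := taylor_rem_lip (serf Az).
pose ep := Num.min (cabs a / 2) (cabs a - L^-1).
have ep0 : 0 < ep.
  by rewrite lt_min divr_gt0 //= subr_gt0 -[L^-1]div1r ltr_pdivrMr.
pose s := Num.min (Num.min r (rA / 2)) (ep / (B + 1)).
have L1 : 0 < B + 1 by rewrite ltr_wpDl.
have s0 : 0 < s by rewrite !lt_min rr0 !divr_gt0.
have sr : s <= r by rewrite !ge_min lexx.
have srA : s < rA.
  rewrite (@le_lt_trans _ _ (rA / 2)) //; first by rewrite !ge_min lexx orbT.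
  lra.
have sB : B * s <= ep.
  have : s * (B + 1) <= ep by rewrite -ler_pdivlMr // !ge_min lexx orbT.
  have := ltW s0; lra.
have lip h k : cabs h <= s -> cabs k <= s ->
  cabs (f (z + h) - f (z + k) - a * (h - k)) <= ep * cabs (h - k).
  move=> hs ks; have := HB h k s sr hs ks.
  rewrite /taylor_rem !big_ord_recl !big_ord0 /= !addr0 !expr0 !expr1 -/a.
  rewrite (_ : _ - _ - _ = f (z + h) - f (z + k) - a * (h - k)); last first.
    by rewrite /bump /=; ring.
  by move/le_trans; apply; rewrite ler_wpM2r ?cabs_ge0.
have lip2 h k : cabs h <= s -> cabs k <= s ->
  cabs (f (z + h) - f (z + k) - a * (h - k)) <= cabs a / 2 * cabs (h - k).
  move=> hs ks; apply: le_trans (lip h k hs ks) _.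
  by rewrite ler_wpM2r ?cabs_ge0 // ge_min lexx.
exists (cabs a * s / 4); first by rewrite divr_gt0 // mulr_gt0.
move=> y hy; have [h hs fy] := lip_open s0 a0 lip2 hy.
exists (z + h); split => //.
  by apply: HA; rewrite (addrC z) addrK (lt_trans hs).
rewrite (addrC z) addrK -fy.
have := lip h 0 (ltW hs); rewrite cabs0 addr0 subr0 => /(_ (ltW s0)) q.
have q2 : cabs a * cabs h - ep * cabs h <= cabs (f (z + h) - f z).
  have := cabs_subl (a * h) (a * h - (f (z + h) - f z)).
  rewrite subKr cabsM (cabsB (a * h)); lra.
have q3 : L^-1 * cabs h <= cabs (f (z + h) - f z).
  apply: le_trans q2; rewrite -mulrBl ler_wpM2r ?cabs_ge0 //.
  have : ep <= cabs a - L^-1 by rewrite ge_min lexx orbT.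
  lra.
by rewrite mulrC -ler_pdivrMr // mulrC.
Qed.

Definition ginv y := xget 0 [set z | A z /\ f z = y].

Lemma ginvP y : r1 < cabs (y - w0) < r2 -> A (ginv y) /\ f (ginv y) = y.
Proof.
by move=> /f_surj[z Az fz]; rewrite /ginv; case: xgetP => [//|/(_ z)[]].
Qed.

Lemma ginvK z : A z -> ginv (f z) = z.
Proof.
move=> Az; have [Ag fg] := ginvP (nuA Az).
exact: injf (mem_set Ag) (mem_set Az) fg.
Qed.

Lemma ginv_lip z (L : R) : A z -> (cabs (c z 1%N))^-1 < L -> exists2 d : R, 0 < d &
  forall y, cabs (y - f z) < d -> cabs (ginv y - z) <= L * cabs (y - f z).
Proof.
move=> Az HL; have [d d0 Hd] := inv_lip Az HL; exists d => // y /Hd[z' [Az' fz' h]].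
by rewrite -{1}fz' ginvK.
Qed.

Lemma ginv_cont y : r1 < cabs (y - w0) < r2 -> forall e : R, 0 < e -> exists2 d : R, 0 < d &
  forall y', cabs (y' - y) < d -> cabs (ginv y' - ginv y) < e.
Proof.
move=> hy e e0; have [Ag fg] := ginvP hy.
pose L := (cabs (c (ginv y) 1%N))^-1 + 1.
have La : (cabs (c (ginv y) 1%N))^-1 < L by rewrite ltrDl.
have L0 : 0 < L by rewrite (le_lt_trans _ La) // invr_ge0 cabs_ge0.
have [d d0 Hd] := ginv_lip Ag La; rewrite fg in Hd.
exists (Num.min d (e / L)); first by rewrite lt_min d0 divr_gt0.
move=> y'; rewrite lt_min ltr_pdivlMr // => /andP[/Hd h1 h2].
by rewrite (le_lt_trans h1) // mulrC.
Qed.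

Lemma band_compact (a b : R) : r1 < a -> b < r2 -> compact [set z | A z /\ a <= nu z <= b].
Proof.
move=> ra br.
pose E := [set y | a <= cabs (y - w0) <= b].
have cE : compact E.
  apply: (@closed_bounded_compact _ _ (b + cabs w0)).
    rewrite -[X in closed X]setCK closedC; apply/openC => y /= /negP yE.
    pose ea := a - cabs (y - w0); pose eb := cabs (y - w0) - b.
    have [h|h] : 0 < ea \/ 0 < eb.
      by move: yE; rewrite negb_and -!ltNge !subr_gt0 => /orP[|]; [left|right].
    - exists ea => // y' hy'; apply/negP; rewrite negb_and -!ltNge; apply/orP; left.
      have := cabs_tri y y' w0; rewrite /ea in hy'; lra.
    - exists eb => // y' hy'; apply/negP; rewrite negb_and -!ltNge; apply/orP; right.
      have := cabs_tri y' y w0; rewrite (cabsB y y') /eb in hy' *; lra.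
  move=> y /andP[_ yb]; have := cabs_subl y w0; lra.
have -> : [set z | A z /\ a <= nu z <= b] = ginv @` E.
  apply/seteqP; split => z /=.
    by move=> [Az h]; exists (f z) => //; exact: ginvK.
  move=> [y /andP[ya yb] <-].
  have [] := @ginvP y; first by rewrite (lt_le_trans ra) // (le_lt_trans yb).
  by move=> Ag fg; split => //; rewrite /nu fg ya.
apply: continuous_compact cE; apply/subspace_continuousP => y /andP[ya yb].
apply/cvgCC => e e0; rewrite /= near_withinE; apply/nearC.
have hy : r1 < cabs (y - w0) < r2 by rewrite (lt_le_trans ra) // (le_lt_trans yb).
by have [d d0 Hd] := ginv_cont hy e0; exists d => // y' /Hd.
Qed.

Lemma band_path z1 z2 : A z1 -> A z2 -> exists S, [/\ connected S, S z1, S z2 &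
  forall z, S z -> A z /\ Num.min (nu z1) (nu z2) <= nu z <= Num.max (nu z1) (nu z2)].
Proof.
move=> A1 A2; have [phi [p0 p1 pb pc]] := annulus_path w0 (f z1) (f z2).
have /andP[n1 n1'] := nuA A1; have /andP[n2 n2'] := nuA A2.
have pann t : 0 <= t <= 1 -> r1 < cabs (phi t - w0) < r2.
  move=> /pb /andP[h1 h2]; apply/andP; split.
    by apply: lt_le_trans h1; rewrite lt_min; apply/andP; split.
  by apply: le_lt_trans h2 _; rewrite gt_max; apply/andP; split.
exists ((ginv \o phi) @` [set t | t \in `[0, 1]%R]); split.
- apply: cont_param_connected => t; rewrite in_itv => t01 e e0.
  have [d d0 Hd] := ginv_cont (pann t t01) e0.
  have [d' d'0 Hd'] := pc t d d0.
  by exists d' => // u _ /Hd' /Hd.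
- by exists 0; rewrite /= ?in_itv /= ?lexx ?ler01 // p0 ginvK.
- by exists 1; rewrite /= ?in_itv /= ?lexx ?ler01 // p1 ginvK.
- move=> _ [t + <-]; rewrite /= in_itv => t01.
  have [Ag fg] := ginvP (pann t t01); split => //.
  by rewrite /nu fg; exact: pb.
Qed.

(** Near [K] the complement of [K] consists of points of [P] and of a closed set
    disjoint from [K]. *)
Lemma open_glue (K K' P Q O : set (C R)) : open P -> closed K' -> closed Q -> open O ->
  K `<=` O -> K `&` K' = set0 -> K `&` Q = set0 ->
  (forall z, O z -> ~ K z -> ~ K' z -> Q z \/ P z) -> open (K `|` P).
Proof.
move=> oP cK' cQ oO KO KK' KQ H; apply/openC => z [Kz|Pz]; last first.
  have [e e0 He] := (openC P).1 oP z Pz; exists e => // z' /He; by right.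
have : open (O `&` ~` K' `&` ~` Q).
  by apply: openI; [apply: openI => //|]; exact: closed_openC.
move=> /openC/(_ z) [].
  split; first split; first exact: KO.
    by move=> K'z; have : (K `&` K') z by []; rewrite KK'.
  by move=> Qz; have : (K `&` Q) z by []; rewrite KQ.
move=> e e0 He; exists e => // z' /He[[Oz' K'z'] Qz'].
by have [|Kz'] := lem (K z'); [left|have [] := H z' Oz' Kz' K'z'; [|right]].
Qed.

Variables K1 K2 : set (C R).
Hypotheses (cK1 : compact K1) (cK2 : closed K2) (K12 : K1 `&` K2 = set0).
Hypothesis KA : K1 `|` K2 = ~` A.
Variables p s : C R.
Hypotheses (K1p : K1 p) (K2s : K2 s).

Let open_nu (P : R -> Prop) :
  (forall t, P t -> exists2 e : R, 0 < e & forall u, `|u - t| < e -> P u) ->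
  open [set z | A z /\ P (nu z)].
Proof.
move=> HP; apply/openC => z [Az Pz].
have [e e0 He] := HP _ Pz.
have [d d0 Hd] := (openC A).1 oA z Az.
have [d' d'0 Hd'] := f_cont Az e0.
exists (Num.min d d'); first by rewrite lt_min d0.
move=> z'; rewrite lt_min => /andP[/Hd Az' /Hd' h]; split => //; apply: He.
rewrite (le_lt_trans (cabs_dist _ _)) // (_ : _ - _ = f z' - f z) //; ring.
Qed.

Let KAE z : ~ K1 z -> ~ K2 z -> A z.
Proof.
move=> k1 k2; have [//|nA] := lem (A z).
by have : (~` A) z by []; rewrite -KA => -[].
Qed.

Let AK1 z : A z -> ~ K1 z.
Proof. by move=> Az K1z; have : (K1 `|` K2) z := or_introl K1z; rewrite KA; apply. Qed.

Let AK2 z : A z -> ~ K2 z.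
Proof. by move=> Az K2z; have : (K1 `|` K2) z := or_intror K2z; rewrite KA; apply. Qed.

(* [O1] and [O2] are the points at distance less and more than [eta / 2] from [K1],
   where [eta] is at most the distance from [K1] to [K2]. *)
Let nbhd : exists O1 O2 : set (C R), [/\ open O1, open O2, O1 `&` O2 = set0, K1 `<=` O1 &
  [/\ K2 `<=` O2, (exists M : R, forall z, O1 z -> cabs z <= M),
   compact (~` (O1 `|` O2)) & ~` (O1 `|` O2) `<=` A]].
Proof.
have [eta eta0 Heta] : exists2 eta : R, 0 < eta &
    forall x z, K1 x -> cabs (z - x) < eta -> (~` K2) z.
  apply: compact_margin => //; first exact: closed_openC.
  by move=> x K1x K2x; have : (K1 `&` K2) x by []; rewrite K12.
have [M M0 HM] := compact_bdd cK1.
pose t1 := eta / 2; have t10 : 0 < t1 by rewrite divr_gt0.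
pose O1 := [set z | exists2 x, K1 x & cabs (z - x) < t1].
pose O2 := [set z | exists2 e : R, 0 < e & forall x, K1 x -> t1 + e <= cabs (z - x)].
have o1 : open O1.
  apply/openC => z [x K1x h]; exists (t1 - cabs (z - x)); first by rewrite subr_gt0.
  move=> z' h'; exists x => //; have := cabs_tri z z' x; lra.
have o2 : open O2.
  apply/openC => z [e e0 He]; exists (e / 2); first by rewrite divr_gt0.
  move=> z' h'; exists (e / 2); first by rewrite divr_gt0.
  move=> x /He h; have := cabs_tri z' z x; rewrite (cabsB z z'); lra.
have Wb z : ~ O2 z -> exists2 x, K1 x & cabs (z - x) < eta.
  move=> nO2; apply: contrapT => H; apply: nO2; exists t1 => // x K1x.
  rewrite leNgt; apply/negP => h; apply: H; exists x => //; rewrite /t1 in h; lra.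
exists O1, O2; split => //.
- apply/seteqP; split => z // -[[x K1x h] [e e0 /(_ x K1x)]]; lra.
- by move=> x K1x; exists x => //; rewrite subrr cabs0.
split.
- move=> z K2z; apply: contrapT => /Wb[x K1x h].
  exact: Heta K1x h K2z.
- exists (M + t1) => z [x /HM h1 h2]; have := cabs_subl z x; lra.
- apply: (@closed_bounded_compact _ _ (M + eta)).
    by apply: open_closedC; exact: openU.
  move=> z /= H; have [|x /HM h1 h2] := Wb z; first by move=> O2z; apply: H; right.
  have := cabs_subl z x; lra.
- move=> z H; apply: KAE.
    by move=> K1z; apply: H; left; exists z => //; rewrite subrr cabs0.
  move=> K2z; have [|x K1x h] := Wb z; first by move=> O2z; apply: H; right.
  exact: Heta K1x h K2z.
Qed.

(** [V] consists of [K1] and of the part of [A] between [K1] and the curve. Let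
    [O1] and [O2] be disjoint neighbourhoods of [K1] and [K2] that cover everything
    except a compact part of [A]. Near each of its two ends, [A] is connected and avoids
    this compact part, so each end is in [O1] or in [O2]. If both were in the same one,
    the component in the other one would be open and closed in the plane. *)
Lemma circle_separates (rho : R) : r1 < rho < r2 -> exists V : set (C R),
  [/\ open V, K1 `<=` V, (V `&` K2 = set0), (exists M : R, forall z, V z -> cabs z <= M) &
   open (~` (V `|` [set z | A z /\ nu z = rho])) /\ (forall z, V z -> A z -> nu z <> rho)].
Proof.
move=> /andP[rho1 rho2].
have [ O1 [ O2 [ o1 o2 O12 KO1 [KO2 [M HM] cB BA]]]] := nbhd.
set B := ~` _ in cB BA.
have O12' z : O1 z -> O2 z -> False.
  by move=> h1 h2; have : (O1 `&` O2) z by []; rewrite O12.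
have [a [b [ra arho rhob br HB]]] : exists a b, [/\ r1 < a, a < rho, rho < b, b < r2 &
    forall z, B z -> a < nu z < b].
  have [|z Bz|t t0 Ht] := @compact_uniform _ B (fun t z => A z -> r1 + t < nu z < r2 - t) cB.
  - move=> t t' z t'0 tt' H Az; have /andP[h1 h2] := H Az; apply/andP; split; lra.
  - have Az := BA z Bz; have /andP[h1 h2] := nuA Az.
    pose e := Num.min (nu z - r1) (r2 - nu z) / 2.
    have e0 : 0 < e by rewrite divr_gt0 // lt_min !subr_gt0 h1.
    have [e1 e2] : e * 2 <= nu z - r1 /\ e * 2 <= r2 - nu z.
      by rewrite /e divfK // !ge_min !lexx orbT.
    have [d d0 Hd] := f_cont Az e0.
    exists (Num.min e d); first by rewrite lt_min e0.
    move=> z'; rewrite lt_min => /andP[_ /Hd h] Az'.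
    have := cabs_dist (f z' - w0) (f z - w0).
    rewrite (_ : f z' - w0 - (f z - w0) = f z' - f z); last by ring.
    rewrite -/(nu z) -/(nu z') => /le_lt_trans/(_ h); rewrite ltr_norml => /andP[h3 h4].
    have m1 : Num.min e d <= e by rewrite ge_min lexx.
    apply/andP; split; lra.
  pose a := r1 + Num.min t (rho - r1) / 2; pose b := r2 - Num.min t (r2 - rho) / 2.
  have a0 : 0 < Num.min t (rho - r1) by rewrite lt_min t0 subr_gt0.
  have b0 : 0 < Num.min t (r2 - rho) by rewrite lt_min t0 subr_gt0.
  have a1 : Num.min t (rho - r1) <= t by rewrite ge_min lexx.
  have a2 : Num.min t (rho - r1) <= rho - r1 by rewrite ge_min lexx orbT.
  have b1 : Num.min t (r2 - rho) <= t by rewrite ge_min lexx.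
  have b2 : Num.min t (r2 - rho) <= r2 - rho by rewrite ge_min lexx orbT.
  exists a, b; rewrite /a /b; split; try lra.
  move=> z Bz; have /andP[h1 h2] := Ht z Bz (BA z Bz); apply/andP; split; lra.
pose Q := [set z | A z /\ a <= nu z <= b].
have cQ : compact Q by exact: band_compact.
have clQ := compact_closedC cQ.
have K1Q : K1 `&` Q = set0 by apply/seteqP; split => z // -[K1z [/AK1]].
have K2Q : K2 `&` Q = set0 by apply/seteqP; split => z // -[K2z [/AK2]].
have side (P : R -> Prop) : (forall t, P t -> t <= a \/ b <= t) ->
    (forall t t' u, P t -> P t' -> Num.min t t' <= u <= Num.max t t' -> P u) ->
    (forall z, A z -> P (nu z) -> O1 z) \/ (forall z, A z -> P (nu z) -> O2 z).
  move=> Pab Pc.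
  have Pcov z : A z -> P (nu z) -> O1 z \/ O2 z.
    move=> Az Pz; apply: contrapT => H.
    have /HB /andP[h1 h2] : B z by [].
    have [] := Pab _ Pz; lra.
  have [[z1 [A1 P1 O1z1]]|H] := lem (exists z, [/\ A z, P (nu z) & O1 z]); last first.
    right => z Az Pz; have [ O1z|//] := Pcov z Az Pz.
    by exfalso; apply: H; exists z.
  left => z Az Pz; have [S [cS Sz1 Sz HS]] := band_path A1 Az.
  apply: (connected_open_split cS o1 o2 _ O12 _ Sz); last by exists z1.
  move=> u /HS[Au hu]; apply: Pcov => //; exact: Pc hu.
have sideM : (forall z, A z -> nu z <= a -> O1 z) \/ (forall z, A z -> nu z <= a -> O2 z).
  apply: (side (fun t => t <= a)); first by move=> t; left.
  move=> t t' u ta ta' /andP[_ h]; apply: le_trans h _; rewrite ge_max; exact/andP.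
have sideP : (forall z, A z -> b <= nu z -> O1 z) \/ (forall z, A z -> b <= nu z -> O2 z).
  apply: (side (fun t => b <= t)); first by move=> t; right.
  move=> t t' u ta ta' /andP[h _]; apply: le_trans h; rewrite le_min; exact/andP.
have clK1 := compact_closedC cK1.
have K21 : K2 `&` K1 = set0 by rewrite setIC.
pose Pm := [set z | A z /\ nu z < rho].
pose Pp := [set z | A z /\ rho < nu z].
have oPm : open Pm.
  apply: (open_nu (P := fun t => t < rho)) => t ht; exists (rho - t); first by rewrite subr_gt0.
  move=> u; rewrite ltr_norml => /andP[h1 h2]; lra.
have oPp : open Pp.
  apply: (open_nu (P := fun t => rho < t)) => t ht; exists (t - rho); first by rewrite subr_gt0.
  move=> u; rewrite ltr_norml => /andP[h1 h2]; lra.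
have [MQ MQ0 HMQ] := compact_bdd cQ.
have [MK MK0 HMK] := compact_bdd cK1.
have tri z : A z -> [\/ nu z <= a, Q z | b <= nu z].
  move=> Az; have [h|h] := leP (nu z) a; first by apply: Or31.
  have [h'|h'] := leP b (nu z); first by apply: Or33.
  by apply: Or32; split => //; rewrite !ltW.
(* Either of the two ends of [A] may be the one at [K1]. *)
have good (P P' : set (C R)) : open P -> open P' ->
    (forall z, P z -> A z /\ nu z <> rho) -> (forall z, P' z -> A z /\ nu z <> rho) ->
    (forall z, P z -> P' z -> False) ->
    (forall z, A z -> nu z <> rho -> P z \/ P' z) ->
    (forall z, A z -> O1 z -> Q z \/ P z) -> (forall z, A z -> O2 z -> Q z \/ P' z) ->
    (forall z, P z -> Q z \/ O1 z) ->
    exists V : set (C R),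
    [/\ open V, K1 `<=` V, (V `&` K2 = set0), (exists M : R, forall z, V z -> cabs z <= M) &
     open (~` (V `|` [set z | A z /\ nu z = rho])) /\ (forall z, V z -> A z -> nu z <> rho)].
  move=> oP oP' PA PA' PP' PP'A H1 H2 PQ.
  exists (K1 `|` P); split.
  - apply: (open_glue (K' := K2) (Q := Q) (O := O1)) => // z O1z k1 k2.
    by apply: H1 => //; exact: KAE.
  - by move=> z; left.
  - apply/seteqP; split => z // -[[K1z|/PA[Az _]] K2z].
      by have : (K1 `&` K2) z by []; rewrite K12.
    exact: AK2 Az K2z.
  - exists (MK + MQ + `|M|) => z [/HMK h|/PQ[/HMQ h|/HM h]].
    + by have := normr_ge0 M; lra.
    + by have := normr_ge0 M; lra.
    + by have := ler_norm M; lra.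
  split; last first.
    by move=> z [/AK1 nA|/PA[]] //.
  have -> : ~` (K1 `|` P `|` [set z | A z /\ nu z = rho]) = K2 `|` P'.
    apply/seteqP; split => z /=.
      move=> H; have [|nK2] := lem (K2 z); [by left|right].
      have Az : A z by apply: KAE => // K1z; apply: H; left; left.
      have [nz|nz] := lem (nu z = rho); first by case: H; right.
      by have [Pz|//] := PP'A z Az nz; case: H; left; right.
    move=> [K2z|P'z] [[K1z|Pz]|[Az nz]].
    + by have : (K1 `&` K2) z by []; rewrite K12.
    + by have [Az _] := PA z Pz; exact: AK2 Az K2z.
    + exact: AK2 Az K2z.
    + by have [Az _] := PA' z P'z; exact: AK1 Az K1z.
    + exact: PP' Pz P'z.
    + by have [_] := PA' z P'z.
  apply: (open_glue (K' := K1) (Q := Q) (O := O2)) => // z O2z k2 k1.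
  by apply: H2 => //; exact: KAE.
have PmA z : Pm z -> A z /\ nu z <> rho by move=> [Az h]; split => // e; rewrite e ltxx in h.
have PpA z : Pp z -> A z /\ nu z <> rho by move=> [Az h]; split => // e; rewrite e ltxx in h.
have Pmp z : Pm z -> Pp z -> False by move=> [_ h] [_ h']; lra.
have PmpA z : A z -> nu z <> rho -> Pm z \/ Pp z.
  move=> Az h; have [h'|h'|//] := ltgtP (nu z) rho; [by left|by right].
have clopen_absurd (K K' O : set (C R)) x y : K x -> K' y -> open O -> closed K -> closed K' ->
    K `<=` O -> K `&` K' = set0 -> K `&` Q = set0 ->
    (forall z, O z -> ~ K z -> ~ K' z -> Q z) -> False.
  move=> Kx K'y oO cK cK' KO KK' KQ H.
  have oK : open K.
    rewrite -(setU0 K); apply: (open_glue (K' := K') (Q := Q) (O := O)) => //.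
    by move=> z Oz k k'; left; exact: H.
  have Ky := clopenC_all y oK (closed_openC cK) Kx.
  by have : (K `&` K') y by []; rewrite KK'.
case: sideM => sM; case: sideP => sP.
- exfalso; apply: (@clopen_absurd K2 K1 O2 s p) => // z O2z k2 k1.
  have Az := KAE k1 k2; have [h|//|h] := tri z Az.
    by exfalso; exact: O12' (sM z Az h) O2z.
  by exfalso; exact: O12' (sP z Az h) O2z.
- apply: (good Pm Pp) => //.
  + move=> z Az O1z; have [h|h|h] := tri z Az; [|by left|].
      by right; split => //; exact: le_lt_trans h arho.
    by exfalso; exact: O12' O1z (sP z Az h).
  + move=> z Az O2z; have [h|h|h] := tri z Az; [|by left|].
      by exfalso; exact: O12' (sM z Az h) O2z.
    by right; split => //; exact: lt_le_trans rhob h.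
  + move=> z [Az h]; have [h'|h'|h'] := tri z Az; [|by left|lra].
    by right; exact: sM.
- apply: (good Pp Pm) => //.
  + by move=> z h1 h2; exact: Pmp h2 h1.
  + by move=> z Az /(PmpA z Az) [|]; [right|left].
  + move=> z Az O1z; have [h|h|h] := tri z Az; [|by left|].
      by exfalso; exact: O12' O1z (sM z Az h).
    by right; split => //; exact: lt_le_trans rhob h.
  + move=> z Az O2z; have [h|h|h] := tri z Az; [|by left|].
      by right; split => //; exact: le_lt_trans h arho.
    by exfalso; exact: O12' (sP z Az h) O2z.
  + move=> z [Az h]; have [h'|h'|h'] := tri z Az; [lra|by left|].
    by right; exact: sP.
- exfalso; apply: (@clopen_absurd K1 K2 O1 p s) => // z O1z k1 k2.
  have Az := KAE k1 k2; have [h|//|h] := tri z Az.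
    by exfalso; exact: O12' O1z (sM z Az h).
  by exfalso; exact: O12' O1z (sP z Az h).
Qed.

End annulus.

(** * Annuli of large modulus *)

Section modulus.
Variable R : realType.

Let ln_sqr (x : R) : 0 < x -> ln (x ^+ 2) = 2 * ln x.
Proof. by move=> x0; rewrite lnXn // mulr_natl. Qed.

(** The two components of the complement in the sphere, restricted to the plane. [K1]
    is the one that omits infinity; it is compact since the complement of a component
    is a neighbourhood of infinity. *)
Lemma sides_of_doubly_connected (A : set (C R)) : open A -> doubly_connected A ->
  exists K1 K2 : set (C R), [/\ compact K1, closed K2, K1 `&` K2 = set0, K1 `|` K2 = ~` A &
   forall F, separates A F -> (exists2 z, F z & K1 z) /\ (exists2 z, F z & K2 z)].
Proof.
move=> oA [S1 [S2 [S12 comp]]].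
set W : set (sphere R) := sphere_compl A in comp.
have clW : closed W.
  by apply: open_closedC; exact: one_point_compactification_open_some.
have WN : W None by move=> [].
have WE z : W (Some z) <-> ~ A z.
  split; first by move=> H Az; apply: H; exists z.
  by move=> nA [y Ay [yz]]; apply: nA; rewrite -yz.
have inW (S : set (sphere R)) : S = S1 \/ S = S2 -> exists2 x, W x & connected_component W x = S.
  by move=> H; have : components W S by rewrite comp.
have [Sc [So [Hc Ho Sco SoN]]] : exists Sc So, [/\ Sc = S1 \/ Sc = S2, So = S1 \/ So = S2, Sc <> So & So None].
  have : components W (connected_component W None) by exists None.
  have N := @connected_component_refl (sphere R) W None WN.
  rewrite comp => -[E|E]; rewrite E in N.
    by exists S2, S1; split; auto.
  by exists S1, S2; split; auto.
have [xc Wxc Ec] := inW Sc Hc; have [xo Wxo Eo] := inW So Ho.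
have disj x : Sc x -> So x -> False.
  rewrite -Ec -Eo => h1 h2; apply: Sco; rewrite -Ec -Eo.
  have h3 := connected_component_trans h1 (connected_component_sym h2).
  apply/seteqP; split => y hy.
    exact: connected_component_trans (connected_component_sym h3) hy.
  exact: connected_component_trans h3 hy.
have cover x : W x -> Sc x \/ So x.
  move=> Wx; have : components W (connected_component W x) by exists x.
  have N := @connected_component_refl (sphere R) W x Wx.
  by rewrite comp => -[E|E]; rewrite E in N; case: Hc Ho Sco => -> [] -> //; auto.
have clSc : closed Sc by rewrite -Ec; exact: component_closed.
have clSo : closed So by rewrite -Eo; exact: component_closed.
have cl (S : set (sphere R)) : closed S -> closed [set z : C R | S (Some z)].
  move=> cS; apply: closed_comp cS => z _; exact: one_point_compactification_some_continuous.
exists [set z | Sc (Some z)], [set z | So (Some z)]; split.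
- have : nbhs (None : sphere R) (~` Sc).
    apply: open_nbhs_nbhs; split; first exact: closed_openC.
    by move=> /disj /(_ SoN).
  move=> [K [cK _] HK]; apply: subclosed_compact (cl _ clSc) cK _ => z Scz.
  apply: contrapT => nK; have : (~` Sc) (Some z); last by [].
  by apply: HK; left; exists z.
- exact: cl.
- by apply/seteqP; split => z // -[/disj].
- apply/seteqP; split => z /=.
    move=> [Scz|Soz]; apply/WE.
      by move: Scz; rewrite -Ec => /connected_component_sub.
    by move: Soz; rewrite -Eo => /connected_component_sub.
  by move=> /WE /cover.
- move=> F [FA HF]; split.
    by apply: (HF Sc); rewrite comp.
  by apply: (HF So); rewrite comp.
Qed.

(** The middle level curve [gam] meets the segment from [p] to [s], since it
    separates [K1] from [K2]. Where it is within [2 D] of [p], with [D = |p - s|], the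
    Ahlfors-Schwarz estimate bounds the speed of its parametrisation over the circle
    by a constant times [D / m]. If [m] is large, the curve therefore has diameter less
    than [|p - q|]: one of [p] and [q] can be joined to infinity without meeting it. *)
Lemma modulus_bound (A K1 K2 : set (C R)) (m B : R) (p q s : C R) :
  annulus_modulus A m -> compact K1 -> closed K2 -> K1 `&` K2 = set0 -> K1 `|` K2 = ~` A ->
  K1 p -> K1 q -> K2 s -> p != q -> 1 <= B -> cabs (p - s) <= B * cabs (p - q) ->
  m <= 128 * 128 * B.
Proof.
move=> [[_ oA _] _ [f [w0 [r1 [r2 [r10 r12 [anf injf] fA mE]]]]]] cK1 cK2 K12 KA K1p K1q K2s pq B1 pB.
rewrite leNgt; apply/negP => mB.
have [c serf] := @choice _ _ (fun z1 a => A z1 ->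
    \forall z \near z1, series (fun n => a n * (z - z1) ^+ n) @ \oo --> f z)
  (fun z => match lem (A z) with
    | or_introl Az => let: ex_intro a Ha := anf z Az in ex_intro _ a (fun=> Ha)
    | or_intror nA => ex_intro _ (fun=> 0) (fun Az => False_ind _ (nA Az))
    end).
have m0 : 0 < m.
  by apply: lt_trans mB; rewrite mulr_gt0 ?mulr_gt0 // (lt_le_trans ltr01).
have r20 : 0 < r2 := lt_trans r10 r12.
have r2E : r2 = r1 * expR m.
  by rewrite mE lnK ?posrE ?divr_gt0 // mulrC divfK ?gt_eqF.
pose rho := r1 * expR (m / 2).
have rho0 : 0 < rho by rewrite mulr_gt0 ?expR_gt0.
have er (t u : R) : (r1 * expR t < r1 * expR u) = (t < u) by rewrite ltr_pM2l // ltr_expR.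
have rho12 : r1 < rho < r2.
  rewrite r2E /rho er ltr_pMr // expR_gt1 divr_gt0 //=.
  by rewrite ltr_pdivrMr // ltr_pMr // ltr1n.
have ps : p != s.
  apply/eqP => e; have : (K1 `&` K2) p by split => //; rewrite e.
  by rewrite K12.
have pA : ~ A p by move=> Ap; have : (~` A) p by rewrite -KA; left.
have sA : ~ A s by move=> As; have : (~` A) s by rewrite -KA; right.
set D := cabs (p - s) in pB.
have D0 : 0 < D by rewrite cabs_gt0 subr_eq0.
have d0 : 0 < cabs (p - q) by rewrite cabs_gt0 subr_eq0.
have nuAE := nuA fA.
have fw0 z : A z -> f z != w0.
  by move=> /nuAE /andP[h _]; rewrite -subr_eq0 -cabs_gt0; exact: lt_trans h.
have df0 := coef_neq0 oA serf injf.
(* The estimate is applied to the middle half of the annulus, whose closure is compact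
   in [A]; its height is [m / 2]. *)
pose r1' := r1 * expR (m / 4).
have r1'0 : 0 < r1' by rewrite mulr_gt0 ?expR_gt0.
have m20 : 0 < m / 2 by rewrite divr_gt0.
have lnr (t : R) : ln (r1 * expR t) = ln r1 + t by rewrite lnM ?posrE ?expR_gt0 // expRK.
have hE z : A z -> height f w0 r1' z = ln (nu f w0 z) - (ln r1 + m / 4).
  move=> Az; have n0 : 0 < nu f w0 z by rewrite cabs_gt0 subr_eq0 fw0.
  by rewrite /height /lnsq ln_sqr // mulrA mulVf // mul1r lnr.
pose Q := [set z | A z /\ r1' <= nu f w0 z <= r1 * expR (3 * m / 4)].
have cQ : compact Q.
  apply: (band_compact oA serf injf fA); rewrite ?r2E ?er; last by lra.
  by rewrite /r1' ltr_pMr // expR_gt1 divr_gt0.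
have QE : Q = [set z | A z /\ 0 <= height f w0 r1' z <= m / 2].
  apply/seteqP; split => z [Az h]; split => //; move: h; rewrite (hE z Az).
    have n0 : 0 < nu f w0 z by rewrite cabs_gt0 subr_eq0 fw0.
    have e0 (t : R) : 0 < r1 * expR t by rewrite mulr_gt0 ?expR_gt0.
    rewrite /r1' -(ler_ln (e0 (m / 4)) n0) -(ler_ln n0 (e0 (3 * m / 4))) !lnr.
    by move=> /andP[h1 h2]; apply/andP; split; lra.
  have n0 : 0 < nu f w0 z by rewrite cabs_gt0 subr_eq0 fw0.
  have e0 (t : R) : 0 < r1 * expR t by rewrite mulr_gt0 ?expR_gt0.
  rewrite /r1' -(ler_ln (e0 (m / 4)) n0) -(ler_ln n0 (e0 (3 * m / 4))) !lnr.
  by move=> /andP[h1 h2]; apply/andP; split; lra.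
have ahl := ahlfors_bound oA serf df0 fw0 pA sA ps m20 QE cQ.
have speed z : A z -> nu f w0 z = rho -> cabs (z - p) <= 2 * D ->
    (cabs (c z 1%N))^-1 < (32 * 32) * D / (m * rho).
  move=> Az nz zp.
  have hz : height f w0 r1' z = m / 4 by rewrite hE // nz lnr; lra.
  have := ahl z Az; rewrite hz => /(_ _); have -> : 0 < m / 4 < m / 2 by apply/andP; split; lra.
  move=> /(_ isT).
  have -> : m / 2 - m / 4 = m / 4 by lra.
  have sp0 (x : C R) : (x = p \/ x = s) -> 0 < cabs ((z - x) / (s - p)).
    move=> xps; rewrite cabs_div divr_gt0 ?cabs_gt0 ?subr_eq0 1?eq_sym //.
    by apply/eqP => zx; case: xps => xE; [apply: pA|apply: sA]; rewrite -xE zx.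
  have soft (t : R) : 0 <= softplus t.
    by rewrite /softplus ln_ge0 // lerDl expR_ge0.
  have L1 : lnsq (fun w => (w - p) / (s - p)) z <= ln 4.
    rewrite /lnsq ler_ln ?posrE ?exprn_gt0 ?sp0 //; last by left.
    have h : cabs ((z - p) / (s - p)) <= 2.
      by rewrite cabs_div (cabsB s) -/D ler_pdivrMr.
    have := lerXn2r 2 (_ : _ \in Num.nneg) (_ : 2 \in Num.nneg) h.
    by rewrite !nnegrE cabs_ge0 ler0n => /(_ isT isT); rewrite -natrX.
  have L2 : lnsq (fun w => (w - s) / (s - p)) z <= ln 9.
    rewrite /lnsq ler_ln ?posrE ?exprn_gt0 ?sp0 //; last by right.
    have h : cabs ((z - s) / (s - p)) <= 3.
      rewrite cabs_div (cabsB s) -/D ler_pdivrMr //.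
      have := cabs_tri p z s; rewrite -/D; lra.
    have := lerXn2r 2 (_ : _ \in Num.nneg) (_ : 3 \in Num.nneg) h.
    by rewrite !nnegrE cabs_ge0 ler0n => /(_ isT isT); rewrite -natrX.
  have l6 : ln 4 + ln 9 = 2 * ln 6 :> R.
    rewrite -lnM ?posrE // (_ : 4 * 9 = 6 ^+ 2); last by rewrite -natrM -natrX.
    by rewrite ln_sqr //.
  have l60 : 0 <= ln 6 :> R by rewrite ln_ge0 // ler1n.
  have dz : 0 < cabs (c z 1%N) by rewrite cabs_gt0 df0.
  have nz0 : 0 < cabs (f z - w0) by rewrite -/(nu f w0 z) nz.
  rewrite /logmetric.
  have -> : lnsq (c^~ 1%N) z = 2 * ln (cabs (c z 1%N)) by rewrite /lnsq ln_sqr //.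
  have -> : lnsq (fun z => f z - w0) z = 2 * ln rho.
    by rewrite /lnsq ln_sqr // -/(nu f w0 z) nz.
  have := soft (lnsq (fun w => (w - p) / (s - p)) z).
  have := soft (lnsq (fun w => (w - s) / (s - p)) z).
  move: (softplus (lnsq (fun w => (w - p) / (s - p)) z)) (softplus (lnsq (fun w => (w - s) / (s - p)) z)) L1 L2.
  move: (lnsq (fun w => (w - p) / (s - p)) z) (lnsq (fun w => (w - s) / (s - p)) z).
  move=> l1 l2 s1 s2 L1 L2 s10 s20 ineq.
  have ineq2 : ln rho - ln (cabs (c z 1%N)) + 2 * ln (m / 4) <= ln 16 + ln D + ln (m / 2) + ln 6 by lra.
  have m40 : 0 < m / 4 by rewrite divr_gt0.
  have : ln (rho * (m / 4) ^+ 2 / cabs (c z 1%N)) <= ln (16 * D * (m / 2) * 6).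
    have q1 : 0 < rho * (m / 4) ^+ 2 by rewrite mulr_gt0 // exprn_gt0.
    have q2 : 0 < (m / 4) ^+ 2 by rewrite exprn_gt0.
    have q3 : 0 < 16 * D by rewrite mulr_gt0.
    have q4 : 0 < 16 * D * (m / 2) by rewrite mulr_gt0.
    rewrite ln_div ?posrE // (lnM (x := rho)) ?posrE // ln_sqr // (lnM (x := 16 * D * _)) ?posrE //.
    rewrite (lnM (x := 16 * D)) ?posrE // (lnM (x := 16)) ?posrE //.
    lra.
  rewrite ler_ln ?posrE; last 2 first.
    by rewrite divr_gt0 // mulr_gt0 // exprn_gt0.
    by rewrite !mulr_gt0.
  move=> ineq3.
  set v := (cabs (c z 1%N))^-1 in ineq3 *.
  rewrite ltr_pdivlMr; last exact: mulr_gt0 m0 rho0.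
  have v0 : 0 < v by rewrite invr_gt0.
  have mm : 0 < m ^+ 2 by rewrite exprn_gt0.
  have q5 : (v * (m * rho)) * m <= ((24 * 32) * D) * m.
    have -> : (v * (m * rho)) * m = 16 * (rho * (m / 4) ^+ 2 * v) by field.
    have -> : ((24 * 32) * D) * m = 16 * (16 * D * (m / 2) * 6) by field.
    by rewrite ler_pM2l.
  rewrite ler_pM2r // in q5.
  lra.
(* The speed is at most the one of [speed] times the Lipschitz constant [2 * rho] of the
   parametrisation of the circle. *)
pose kap := (32 * 64) * D / m.
have kap0 : 0 < kap by rewrite divr_gt0 // mulr_gt0.
have kD : kap * 4 <= D.
  rewrite /kap mulrAC ler_pdivrMr //.
  have : D * (64 * 128) <= D * m by rewrite ler_pM2l //; lra.
  lra.
have kpq : kap * 4 < cabs (p - q) / 2.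
  rewrite /kap mulrAC ltr_pdivrMr //.
  have h1 : cabs (p - q) * ((128 * 128) * B) < cabs (p - q) * m by rewrite ltr_pM2l.
  lra.
have [V [oV K1V VK2 [MV HMV] [oVc Vrho]]] :=
  circle_separates oA serf injf fA cK1 cK2 K12 KA K1p K2s rho12.
set gam := [set z | A z /\ nu f w0 z = rho] in oVc.
(* [V] is open and closed relative to the complement of [gam]. *)
have stay (S : set (C R)) : connected S -> (exists2 z, S z & V z) ->
    (forall z, S z -> ~ gam z) -> S `<=` V.
  move=> cS SV Sg.
  have cov : S `<=` V `|` ~` (V `|` gam).
    move=> u Su; have [Vu|nV] := lem (V u); first by left.
    by right => -[//|]; exact: Sg.
  have dis : V `&` ~` (V `|` gam) = set0.
    by apply/seteqP; split => u // -[Vu nV]; apply: nV; left.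
  exact: connected_open_split cS oV oVc cov dis SV.
have [z0 [gz0 z0p]] : exists z0, gam z0 /\ cabs (z0 - p) <= D.
  have seg (t : R) : 0 <= t <= 1 -> [set z | cabs (z - p) <= D] (p + t%:C * (s - p)).
    move=> /andP[t0 t1] /=; rewrite (addrC p) addrK cabsM cabs_real ger0_norm //.
    by rewrite (cabsB s) -/D ler_piMl // ltW.
  have [S [cS Sp Ss HS]] := segment_path seg.
  apply: contrapT => H; have SV : S `<=` V.
    have Sg u : S u -> ~ gam u.
      by move=> Su gu; apply: H; exists u; split => //; exact: HS.
    exact: stay S cS (ex_intro2 _ _ p Sp (K1V p K1p)) Sg.
  have : (V `&` K2) s by split => //; exact: SV.
  by rewrite VK2.
have [Az0 nz0] := gz0.
pose y0 := f z0.
have y0w : y0 - w0 != 0 by rewrite subr_eq0 fw0.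
have cy0 : cabs (y0 - w0) = rho by exact: nz0.
have rho20 : 0 < 2 * rho by exact: mulr_gt0 (ltr0Sn _ 1) rho0.
pose yy (t : R) := w0 + (y0 - w0) * expi t.
have yyw t : cabs (yy t - w0) = rho.
  by rewrite /yy (addrC w0) addrK cabsM cabs_expi mulr1.
have yyl t u : cabs (yy u - yy t) <= 2 * rho * `|u - t|.
  rewrite (_ : yy u - yy t = (y0 - w0) * (expi u - expi t)); last by rewrite /yy; ring.
  rewrite cabsM cy0 (_ : 2 * rho * `|u - t| = rho * (2 * `|u - t|)); last by ring.
  exact: ler_wpM2l (ltW rho0) _ _ (expi_lip t u).
have annyy t : r1 < cabs (yy t - w0) < r2 by rewrite yyw.
have gyy t := ginvP fA (annyy t).
pose G t := ginv A f (yy t).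
have G0 : G 0 = z0 by rewrite /G /yy expi0 mulr1 addrC subrK (ginvK injf fA).
(* The curve is followed in both directions from [z0], up to argument [4 >= pi]. *)
have prop (sg : R) : `|sg| = 1 -> forall t, 0 <= t <= 4 -> cabs (G (sg * t) - z0) <= kap * t.
  move=> sg1.
  have sgl (u t : R) : `|sg * u - sg * t| = `|u - t| by rewrite -mulrBr normrM sg1 mul1r.
  have := @lip_propagate R (fun t => G (sg * t)) 4 D kap (ler0n _ _) (ltW kap0) kD.
  rewrite mulr0 G0; apply.
    move=> t _ e e0.
    have [d dd0 Hd] := ginv_cont oA serf injf fA (annyy (sg * t)) e0.
    exists (d / (2 * rho)); first exact: divr_gt0 dd0 rho20.
    move=> u; rewrite ltr_pdivlMr // => hu; apply: Hd.
    by apply: le_lt_trans (yyl _ _) _; rewrite sgl mulrC.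
  move=> t _ Gt; have [AG fG] := gyy (sg * t).
  have nG : nu f w0 (G (sg * t)) = rho by rewrite /nu fG yyw.
  have Gp : cabs (G (sg * t) - p) <= 2 * D.
    have := cabs_tri z0 (G (sg * t)) p; lra.
  have [d dd0 Hd] := ginv_lip oA serf injf fA AG (speed _ AG nG Gp).
  rewrite fG in Hd.
  exists (d / (2 * rho)); first exact: divr_gt0 dd0 rho20.
  move=> u; rewrite ltr_pdivlMr // => hu.
  have hy := yyl (sg * t) (sg * u); rewrite sgl in hy.
  have := Hd (yy (sg * u)); rewrite -/(G _) => h.
  apply: le_trans (h _) _; first by apply: le_lt_trans hy _; rewrite mulrC.
  have L0 : 0 <= (32 * 32) * D / (m * rho).
    apply: divr_ge0; last exact: ltW (mulr_gt0 m0 rho0).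
    by rewrite !mulr_ge0 // ltW.
  apply: le_trans (ler_wpM2l L0 hy) _.
  rewrite le_eqVlt; apply/orP; left; apply/eqP; rewrite /kap; field.
  by rewrite !lt0r_neq0.
have small z : gam z -> cabs (z - z0) <= kap * 4.
  move=> [Az nz].
  have [t t4 tE] := polar ((f z - w0) / (y0 - w0)).
  have fE : f z = yy t.
    rewrite cabs_div cy0 -/(nu f w0 z) nz divff ?gt_eqF // mul1r in tE.
    by rewrite /yy -tE mulrC divfK // addrC subrK.
  have zE : z = G t by rewrite /G -fE (ginvK injf fA).
  rewrite zE; have [t0|t0] := leP 0 t.
    rewrite ger0_norm // in t4.
    have := prop 1 (normr1 _) t; rewrite t0 t4 mul1r => /(_ isT) h.
    by apply: le_trans h _; rewrite ler_pM2l.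
  rewrite ltr0_norm // in t4.
  have := prop (-1) _ (- t); rewrite normrN1 mulN1r opprK t4 oppr_ge0 ltW // => /(_ erefl isT) h.
  by apply: le_trans h _; rewrite ler_pM2l.
(* The disc of radius [kap * 4] about [z0] contains [gam] but not both [p] and [q].
   From the one outside, move radially away from [z0]. *)
have [x [K1x xz0]] : exists x, K1 x /\ kap * 4 < cabs (x - z0).
  have [h|h] := ltP (kap * 4) (cabs (p - z0)); first by exists p.
  exists q; split => //; rewrite ltNge; apply/negP => h'.
  have := cabs_tri z0 p q; rewrite (cabsB z0 q); lra.
have x0 : 0 < cabs (x - z0).
  by apply: lt_trans xz0; rewrite mulr_gt0.
pose T := (`|MV| + cabs z0 + 1) / cabs (x - z0).
have T0 : 0 <= T by rewrite divr_ge0 ?cabs_ge0 // !addr_ge0 // cabs_ge0.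
pose y := z0 + (1 + T)%:C * (x - z0).
have seg (t : R) : 0 <= t <= 1 -> [set z | kap * 4 < cabs (z - z0)] (x + t%:C * (y - x)).
  move=> /andP[t0 t1] /=.
  have -> : x + t%:C * (y - x) - z0 = (1 + t * T)%:C * (x - z0).
    rewrite /y (rmorphD (real_complex R) 1 (t * T)) (rmorphD (real_complex R) 1 T).
    by rewrite (rmorphM (real_complex R) t T) (rmorph1 (real_complex R)); ring.
  have tT : 0 <= t * T := mulr_ge0 t0 T0.
  rewrite cabsM cabs_real ger0_norm; last exact: addr_ge0 ler01 tT.
  by apply: lt_le_trans xz0 _; rewrite ler_peMl ?cabs_ge0 // lerDl.
have [S [cS Sx Sy HS]] := segment_path seg.
have SV : S `<=` V.
  have Sg u : S u -> ~ gam u by move=> /HS /= h /small; rewrite leNgt h.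
  exact: stay S cS (ex_intro2 _ _ x Sx (K1V x K1x)) Sg.
have := HMV y (SV y Sy); rewrite leNgt => /negP; apply.
have := cabs_subl (y - z0) (- z0); rewrite opprK subrK cabsN.
rewrite (_ : y - z0 = (1 + T)%:C * (x - z0)); last by rewrite /y; ring.
rewrite cabsM cabs_real ger0_norm ?addr_ge0 // mulrDl mul1r /T divfK ?gt_eqF //.
have := ler_norm MV; lra.
Qed.

End modulus.

(** * Moebius maps and limit sets *)

Section mobius.
Variable R : realType.
Implicit Types (U X : set (C R)) (z w : C R).

Lemma mobius_on_id U : mobius_on U id.
Proof.
exists 1, 0, 0, 1; split; first by rewrite mulr1 mulr0 subr0 oner_eq0.
by move=> z _; rewrite mul0r add0r oner_eq0 mul1r addr0 divr1.
Qed.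

Lemma mobius_on_comp U (F G : C R -> C R) : mobius_on U F -> mobius_on U G ->
  (forall z, U z -> U (G z)) -> mobius_on U (F \o G).
Proof.
move=> [a [b [c [d [F0 FE]]]]] [a' [b' [c' [d' [G0 GE]]]]] GU.
exists (a * a' + b * c'), (a * b' + b * d'), (c * a' + d * c'), (c * b' + d * d'); split.
  rewrite (_ : _ - _ = (a * d - b * c) * (a' * d' - b' * c')); last by ring.
  exact: mulf_neq0.
move=> z Uz; have [n1 E1] := GE z Uz; have [n2 E2] := FE _ (GU z Uz).
have E : (c * a' + d * c') * z + (c * b' + d * d') = (c * G z + d) * (c' * z + d').
  by rewrite E1; field.
have E' : (a * a' + b * c') * z + (a * b' + b * d') = (a * G z + b) * (c' * z + d').
  by rewrite E1; field.
split; first by rewrite E mulf_neq0.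
by rewrite /= E2 E E' invfM mulrACA divff // mulr1.
Qed.

Lemma mobius_increment U (F : C R -> C R) : mobius_on U F -> exists c d e : C R,
  [/\ e != 0, (forall z, U z -> c * z + d != 0) &
   forall z w, U z -> U w -> F z - F w = e * (z - w) / ((c * z + d) * (c * w + d))].
Proof.
move=> [a [b [c [d [F0 FE]]]]]; exists c, d, (a * d - b * c); split => //.
  by move=> z /FE[].
move=> z w Uz Uw; have [n1 ->] := FE z Uz; have [n2 ->] := FE w Uw.
by field; rewrite n1 n2.
Qed.

Variables (U X : set (C R)).
Hypotheses (oU : open U) (XU : X `<=` U).
Variables (tau L : R).
Hypotheses (tau0 : 0 < tau) (L0 : 0 < L).
Hypothesis Htau : forall x z, X x -> cabs (z - x) < tau -> U z.
Hypothesis HL : forall x y : C R, X x -> X y -> cabs (x - y) <= L.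

Let K := 1 + L / tau.

(** The pole is outside [U], hence at distance at least [tau] from [X]. *)
Lemma mobius_denominator (c d : C R) : (forall z, U z -> c * z + d != 0) ->
  forall z w, X z -> X w -> cabs (c * z + d) <= K * cabs (c * w + d).
Proof.
move=> H z w Xz Xw.
have K1 : 1 <= K by rewrite lerDl divr_ge0 // ltW.
have [->|c0] := eqVneq c 0; first by rewrite !mul0r add0r ler_peMl ?cabs_ge0.
pose pole := - d / c.
have cE (u : C R) : c * u + d = c * (u - pole) by rewrite /pole; field.
have tw : tau <= cabs (w - pole).
  rewrite leNgt cabsB; apply/negP => /(Htau Xw) /H /eqP; apply.
  by rewrite cE subrr mulr0.
rewrite !cE !cabsM mulrCA ler_wpM2l ?cabs_ge0 //.
have h1 := cabs_tri w z pole; have h2 := HL Xz Xw.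
have h3 : L <= L / tau * cabs (w - pole).
  by rewrite mulrAC ler_pdivlMr // ler_wpM2l // ltW.
rewrite /K mulrDl mul1r; lra.
Qed.

(** By [mobius_increment] the difference quotient of [F] at [z] and [w] is
    [e / (P z * P w)], and the denominators are comparable on [X]. *)
Lemma mobius_distortion (F : C R -> C R) (D : R) z w z' w' : mobius_on U F -> 0 < D ->
  X z -> X w -> X z' -> X w' -> D <= cabs (F z' - F w') ->
  D / (L * K ^+ 2) * cabs (z - w) <= cabs (F z - F w).
Proof.
move=> /mobius_increment[c [d [e [e0 n0 FE]]]] D0 Xz Xw Xz' Xw'.
have K0 : 0 < K by rewrite ltr_pwDl // divr_ge0 // ltW.
rewrite !FE; do ?exact: XU.
have P0 u : X u -> 0 < cabs (c * u + d) by move=> Xu; rewrite cabs_gt0 n0 //; exact: XU.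
have den := mobius_denominator n0.
rewrite !cabs_div !cabsM.
set P := cabs (c * z + d); set Q := cabs (c * w + d).
set P' := cabs (c * z' + d); set Q' := cabs (c * w' + d).
have PK : P <= K * P' by exact: den.
have QK : Q <= K * Q' by exact: den.
have p0 : 0 < P by exact: P0. have q0 : 0 < Q by exact: P0.
have p'0 : 0 < P' by exact: P0. have q'0 : 0 < Q' by exact: P0.
have LL := HL Xz' Xw'.
have zw0 := cabs_ge0 (z - w).
have ce0 := cabs_ge0 e.
rewrite ler_pdivlMr ?mulr_gt0 // => h.
rewrite ler_pdivlMr ?mulr_gt0 //.
have h1 : D * (P' * Q') <= cabs e * L by rewrite (le_trans h) // ler_wpM2l.
have h2 : P * Q <= K ^+ 2 * (P' * Q').
  have := ler_pM (ltW p0) (ltW q0) PK QK.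
  by rewrite (_ : K * P' * (K * Q') = K ^+ 2 * (P' * Q')) //; ring.
have LK : 0 < L * K ^+ 2 by rewrite mulr_gt0 // exprn_gt0.
rewrite (_ : D / (L * K ^+ 2) * cabs (z - w) * (P * Q) =
   (D * (P * Q) / (L * K ^+ 2)) * cabs (z - w)); last by ring.
rewrite ler_wpM2r // ler_pdivrMr //.
apply: le_trans (ler_wpM2l (ltW D0) h2) _.
have h3 := ler_wpM2r (exprn_ge0 2 (ltW K0)) h1.
have -> : D * (K ^+ 2 * (P' * Q')) = D * (P' * Q') * K ^+ 2 by ring.
by rewrite (mulrA (cabs e)).
Qed.

Lemma mobius_derive (F : C R -> C R) (c d e z : C R) :
  (forall u, U u -> c * u + d != 0) ->
  (forall u v, U u -> U v -> F u - F v = e * (u - v) / ((c * u + d) * (c * v + d))) ->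
  U z -> F^`() z = e / (c * z + d) ^+ 2.
Proof.
move=> n0 FE Uz.
have h1 : (fun h : C R => c * (h + z) + d) @ 0^' --> c * (0 + z) + d.
  apply: (@cvg_within_filter _ _ _ (nbhs (0 : C R))).
  apply: cvgD; last exact: cvg_cst.
  apply: cvgM; first exact: cvg_cst.
  by apply: cvgD; [exact: cvg_id|exact: cvg_cst].
rewrite add0r in h1.
have h2 : (fun h : C R => e / ((c * (h + z) + d) * (c * z + d))) @ 0^' --> e / ((c * z + d) * (c * z + d)).
  apply: cvgM; first exact: cvg_cst.
  apply: cvgV; first by rewrite mulf_neq0 // n0.
  by apply: cvgM => //; exact: cvg_cst.
rewrite expr2 derive1E /derive.
apply: cvg_lim; first exact: norm_hausdorff.
apply: cvg_trans h2; apply: near_eq_cvg.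
rewrite near_withinE; apply/nearC.
have [r r0 Hr] := (openC U).1 oU z Uz.
exists r => // h; rewrite subr0 => hr h0.
have Uh : U (h + z) by apply: Hr; rewrite addrK.
rewrite /= [h *: (1 : C R)]mulr1 FE // addrK /GRing.scale /=.
by field; rewrite h0 !n0.
Qed.

(** The difference quotient at [z] and [w] is the geometric mean of the derivatives
    at [z] and at [w], in absolute value. *)
Lemma mobius_expands (F : C R -> C R) (eta : R) : mobius_on U F -> 0 < eta ->
  (forall z, X z -> eta%:C <= `|F^`() z|) ->
  forall z w, X z -> X w -> eta * cabs (z - w) <= cabs (F z - F w).
Proof.
move=> /mobius_increment[c [d [e [e0 n0 FE]]]] eta0 H z w Xz Xw.
have P0 u : X u -> 0 < cabs (c * u + d) by move=> Xu; rewrite cabs_gt0 n0 //; exact: XU.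
have He u : X u -> eta * cabs (c * u + d) ^+ 2 <= cabs e.
  move=> Xu; have := H u Xu; rewrite (mobius_derive n0 FE (XU Xu)) cabsE lecR.
  by rewrite cabs_div cabsX ler_pdivlMr // exprn_gt0 // P0.
have := He z Xz; have := He w Xw.
rewrite FE; do ?exact: XU.
rewrite cabs_div !cabsM ler_pdivlMr ?mulr_gt0 ?P0 //.
move: (P0 z Xz) (P0 w Xw); set P := cabs (c * z + d); set Q := cabs (c * w + d).
move=> p0 q0 h1 h2.
have h3 : eta * (P * Q) <= cabs e.
  have [PQ|QP] := leP P Q.
    apply: le_trans h1; apply: ler_wpM2l (ltW eta0) _ _ _.
    by rewrite expr2; exact: ler_wpM2r (ltW q0) _ _ PQ.
  apply: le_trans h2; apply: ler_wpM2l (ltW eta0) _ _ _.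
  by rewrite expr2; exact: ler_wpM2l (ltW p0) _ _ (ltW QP).
rewrite mulrAC ler_wpM2r ?cabs_ge0 //.
Qed.

End mobius.

Section system.
Variable R : realType.
Variables (U X : set (C R)) (Phi : system R).
Hypotheses (cX : compact X) (XU : X `<=` U).
Hypothesis HN : nifs U X Phi.

Lemma smapX j (i : idx Phi j) z : U z -> X (smap i z).
Proof. by have [_ H _ _] := HN; exact: H. Qed.

Lemma word_mapX j k (w : word Phi j k) z : X z -> X (word_map w z).
Proof.
elim: k j w => [|k IH] j //= [i w] Xz; apply: smapX; apply: XU; exact: IH.
Qed.

Lemma limit_set_sub j : limit_set X Phi j `<=` X.
Proof.
move=> z /(_ 1%N isT)[[i []] _ /= [x Xx <-]].
by apply: smapX; exact: XU.
Qed.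

Lemma closure_limit_set_sub j : closure (limit_set X Phi j) `<=` X.
Proof.
apply: subset_trans (closure_subset (limit_set_sub (j := j))) _.
by rewrite -((closure_id X).1 (compact_closedC cX)).
Qed.

Lemma limit_set_smap j (i : idx Phi j) z : limit_set X Phi j.+1 z -> limit_set X Phi j (smap i z).
Proof.
move=> Jz [//|[|k]] _.
  by exists (i, tt) => //=; exists z => //; exact: limit_set_sub Jz.
have [w _ [x Xx <-]] := Jz k.+1 isT.
by exists (i, w) => //; exists x.
Qed.

(** In the metric [d] the images shrink geometrically. By compactness [d] is bounded
    on [X], and sets that are small for [d] are small in the plane. *)
Lemma words_shrink (D : R) : 0 < D -> exists k : nat, forall j (w : word Phi j k) x y,
  X x -> X y -> cabs (word_map w x - word_map w y) <= D.
Proof.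
move=> D0; have [_ _ _ [s [d [/andP[s0 s1] [dge d0 dsym dtri] top contr]]]] := HN.
have dist x : X x -> d x x = 0 by move=> Xx; apply/d0 => //; exact: XU.
have nearX x (e : R) : X x -> 0 < e -> exists2 r : R, 0 < r &
    forall y, cabs (y - x) < r -> X y -> d x y < e.
  move=> Xx e0; have [_ H] := top x Xx (fun y => d x y < e).
  have /nearC[r r0 Hr] : \forall y \near x, X y -> d x y < e by apply: H; exists e.
  by exists r.
have [B B0 HB] : exists2 B : R, 0 < B & forall x y, X x -> X y -> d x y <= B.
  have [[x0 Xx0]|nX] := lem (exists x, X x); last first.
    by exists 1 => // x y Xx; exfalso; apply: nX; exists x.
  have [|x Xx|t t0 Ht] := @compact_uniform R X (fun t x => X x -> t * d x0 x <= 1) cX.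
  - move=> t t' x t'0 tt' H Xx; apply: le_trans (H Xx).
    by rewrite ler_wpM2r // dge //; exact: XU.
  - have [r r0 Hr] := nearX x 1 Xx ltr01.
    have dx0 : 0 <= d x0 x by apply: dge; exact: XU.
    have L0 : 0 < d x0 x + 1 by lra.
    exists (Num.min r (d x0 x + 1)^-1); first by rewrite lt_min r0 invr_gt0.
    move=> x'; rewrite lt_min => /andP[/Hr h _] Xx'.
    have dx1 : 0 <= d x0 x' by apply: dge; exact: XU.
    rewrite (@le_trans _ _ ((d x0 x + 1)^-1 * d x0 x')) //.
      by rewrite ler_wpM2r // ge_min lexx orbT.
    rewrite mulrC ler_pdivrMr // mul1r.
    have := dtri x0 x x' (XU Xx0) (XU Xx) (XU Xx'); have := h Xx'; lra.
  - exists (2 / t); first by rewrite divr_gt0.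
    move=> x y Xx Xy; have := Ht x Xx Xx; have := Ht y Xy Xy => h1 h2.
    have := dtri x x0 y (XU Xx) (XU Xx0) (XU Xy).
    rewrite (dsym x x0) ?ler_pdivlMr //; do ?exact: XU.
    move=> h3; have := ler_wpM2l (ltW t0) h3; rewrite mulrDr mulrC; lra.
have [e e0 He] : exists2 e : R, 0 < e & forall x y, X x -> X y -> d x y < e -> cabs (x - y) <= D.
  have [|x Xx|t t0 Ht] := @compact_uniform R X
     (fun t x => X x -> forall y, X y -> d x y < t -> cabs (x - y) <= D) cX.
  - by move=> t t' x t'0 tt' H Xx y Xy h; apply: H => //; exact: lt_le_trans tt'.
  - have D20 : 0 < D / 2 by rewrite divr_gt0.
    have [H _] := top x Xx (fun y => cabs (y - x) < D / 2).
    have [|e e0 He] := H; first by apply/nearC; exists (D / 2).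
    have e20 : 0 < e / 2 by rewrite divr_gt0.
    have [r r0 Hr] := nearX x (e / 2) Xx e20.
    exists (Num.min r (e / 2)); first by rewrite lt_min r0.
    move=> x'; rewrite lt_min => /andP[/Hr h _] Xx' y Xy; rewrite lt_min => /andP[_ h2].
    have h3 := h Xx'.
    have h4 : d x y < e.
      have := dtri x x' y (XU Xx) (XU Xx') (XU Xy); lra.
    have := He x' Xx' (_ : d x x' < e); have := He y Xy h4 => h5 h6.
    have := cabs_tri x x' y; rewrite (cabsB x y).
    have := h6 ltac:(lra); lra.
  - by exists t => // x y Xx Xy h; exact: Ht h.
have [k Hk] : exists k : nat, s ^+ k * B < e.
  have : (fun n => s ^+ n) @ \oo --> (0 : R).
    by apply: cvg_expr; rewrite gtr0_norm.
  have eB : 0 < e / B by rewrite divr_gt0.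
  move=> /cvgrPdist_lt /(_ _ eB)[k _ /(_ k (leqnn k))].
  rewrite /= sub0r normrN gtr0_norm ?exprn_gt0 // ltr_pdivlMr // => h.
  by exists k.
exists k => j w x y Xx Xy; apply: He; do ?exact: word_mapX.
apply: le_lt_trans Hk.
have : d (word_map w x) (word_map w y) <= s ^+ k * d x y.
  elim: k j w => [|k IH] j w /=; first by rewrite expr0 mul1r.
  case: w => i w /=; apply: le_trans (contr _ _ _ _ _ _) _; do ?exact: word_mapX.
  by rewrite exprS -mulrA ler_wpM2l ?(ltW s0).
move=> h; apply: le_trans h _; rewrite ler_wpM2l ?exprn_ge0 ?(ltW s0) //; exact: HB.
Qed.

Hypothesis HM : mobius_system U Phi.

(** Extends the prefix [Psi] letter by letter until the image of [X] has diameter at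
    most [D]; [F] is the last prefix for which it had not. *)
Lemma critical_prefix (j : nat) (p : C R) (D : R) k : forall j' (Psi : C R -> C R) (w : word Phi j' k) x,
  X x -> mobius_on U Psi -> (forall z, limit_set X Phi j' z -> limit_set X Phi j (Psi z)) ->
  (exists z w', [/\ X z, X w' & D < cabs (Psi z - Psi w')]) ->
  (forall y z, X y -> X z -> cabs (Psi (word_map w y) - Psi (word_map w z)) <= D) ->
  p = Psi (word_map w x) ->
  exists j'' (F : C R -> C R) (i : idx Phi j'') x', [/\ X x', mobius_on U F,
   (forall z, limit_set X Phi j'' z -> limit_set X Phi j (F z)),
   (exists z w', [/\ X z, X w' & D < cabs (F z - F w')]) &
   (forall y z, X y -> X z -> cabs (F (smap i y) - F (smap i z)) <= D) /\ p = F (smap i x')].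
Proof.
elim: k => [|k IH] j' Psi w x Xx mP lP [z1 [z2 [Xz1 Xz2 big]]] small pE.
  by have := small z1 z2 Xz1 Xz2; rewrite leNgt big.
case: w small pE => i w /= small pE.
have [sm|nsm] := lem (forall y z, X y -> X z -> cabs (Psi (smap i y) - Psi (smap i z)) <= D).
  exists j', Psi, i, (word_map w x); split => //; first exact: word_mapX.
  by exists z1, z2.
apply: (IH j'.+1 (Psi \o smap i) w x) => //.
- by apply: mobius_on_comp mP (HM i) _ => z Uz; exact: XU (smapX i Uz).
- by move=> z Jz; apply: lP; exact: limit_set_smap.
- apply: contrapT => H; apply: nsm => y z Xy Xz; rewrite leNgt; apply/negP => h.
  by apply: H; exists y, z.
Qed.

Hypothesis oU : open U.
Variables (tau L delta eta : R).
Hypotheses (tau0 : 0 < tau) (L0 : 0 < L) (delta0 : 0 < delta) (eta0 : 0 < eta).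
Hypothesis Htau : forall x z, X x -> cabs (z - x) < tau -> U z.
Hypothesis HL : forall x y : C R, X x -> X y -> cabs (x - y) <= L.
Hypothesis HS : limit_spread X Phi delta.
Hypothesis Hder : derivative_bounded_below X Phi eta.

Lemma limit_set_spread j : exists x y, [/\ limit_set X Phi j x, limit_set X Phi j y &
  delta <= cabs (x - y)].
Proof.
have [a [b [za [zb [Ja Jb]]]]] := HS j; rewrite cabsE lecR => h.
by exists (smap a za), (smap b zb); split => //; exact: limit_set_smap.
Qed.

(** The quotient of [eta * delta] by the constant [L * K ^ 2] of [mobius_distortion]; the
    factor [2] is lost when choosing the more distant of two points. *)
Definition perfectness : R := eta * delta / (2 * L * (1 + L / tau) ^+ 2).

Lemma perfectness_gt0 : 0 < perfectness.
Proof.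
have K0 : 0 < 1 + L / tau by rewrite addr_gt0 // divr_gt0.
by apply: divr_gt0; rewrite !mulr_gt0 // exprn_gt0.
Qed.

(** With [F] and [i] from [critical_prefix], the images under [F o smap i] of two
    points at distance [delta] of the next limit set are within [D] of [p], and their
    mutual distance is at least [2 * perfectness * D]. *)
Lemma limit_set_perfect j p (D : R) : limit_set X Phi j p -> 0 < D -> D < delta ->
  exists2 q, limit_set X Phi j q & perfectness * D <= cabs (q - p) <= D.
Proof.
move=> Jp D0 Dd; have [k0 Hk] := words_shrink D0.
have {k0 Hk}[k Hk k0] : exists2 k, (forall j (w : word Phi j k) x y,
    X x -> X y -> cabs (word_map w x - word_map w y) <= D) & (0 < k)%N.
  (* The limit set is defined by words of positive length. *)
  case: k0 Hk => [|k Hk]; last by exists k.+1.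
  move=> Hk; exists 1%N => // j' [i []] x y Xx Xy.
  apply: (Hk j' tt (smap i x) (smap i y)); by apply: smapX; exact: XU.
have [w _ [x Xx xE]] := Jp k k0.
have [y1 [y2 [J1 J2 y12]]] := limit_set_spread j.
have [||j'' [F [i [x' [Xx' mF lF [z1 [z2 [Xz1 Xz2 big]]] [small pE]]]]]] :=
   @critical_prefix j p D k j id w x Xx (mobius_on_id _) (fun _ h => h) _ _ (esym xE).
- exists y1, y2; split; [exact: limit_set_sub J1|exact: limit_set_sub J2|exact: lt_le_trans y12].
- by move=> y z Xy Xz; exact: Hk.
have [u1 [u2 [Ju1 Ju2 u12]]] := limit_set_spread j''.+1.
have Xu1 := limit_set_sub Ju1; have Xu2 := limit_set_sub Ju2.
have sX (z : C R) : X z -> X (smap i z) by move=> Xz; apply: smapX; exact: XU.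
have h1 := mobius_expands oU XU (HM i) eta0 (Hder i) Xu1 Xu2.
have h2 := mobius_distortion XU tau0 L0 Htau HL mF D0 (sX _ Xu1) (sX _ Xu2) Xz1 Xz2 (ltW big).
set q1 := F (smap i u1) in h2; set q2 := F (smap i u2) in h2.
have K0 : 0 < 1 + L / tau by rewrite addr_gt0 // divr_gt0.
have LK : 0 < L * (1 + L / tau) ^+ 2 by rewrite mulr_gt0 // exprn_gt0.
have h3 : 2 * (perfectness * D) <= cabs (q1 - q2).
  apply: le_trans h2.
  have -> : 2 * (perfectness * D) = D / (L * (1 + L / tau) ^+ 2) * (eta * delta).
    by rewrite /perfectness; field; rewrite !gt_eqF //= addr_gt0.
  rewrite ler_wpM2l //; first by rewrite divr_ge0 // ltW.
  by rewrite (le_trans _ h1) // ler_wpM2l // ltW.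
have b1 : cabs (q1 - p) <= D by rewrite pE; exact: small.
have b2 : cabs (q2 - p) <= D by rewrite pE; exact: small.
have [g|g] := leP (perfectness * D) (cabs (q1 - p)).
  exists q1; last by rewrite g.
  by apply: lF; exact: limit_set_smap.
exists q2; first by apply: lF; exact: limit_set_smap.
rewrite b2 andbT.
have := cabs_tri p q1 q2; rewrite (cabsB p q2); lra.
Qed.

Lemma closure_limit_set_perfect j p (D : R) : closure (limit_set X Phi j) p ->
  0 < D -> D < delta ->
  exists2 q, limit_set X Phi j q & perfectness / 4 * D <= cabs (q - p) <= D.
Proof.
move=> clp D0 Dd; have c0 := perfectness_gt0.
pose e := Num.min (perfectness * D / 4) (D / 2).
have e0 : 0 < e by rewrite lt_min !divr_gt0 // mulr_gt0.
have [e1 e2] : e <= perfectness * D / 4 /\ e <= D / 2 by rewrite !ge_min !lexx orbT.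
have : nbhs p [set z | cabs (z - p) < e] by apply/nbhsC; exists e.
move=> /clp[p' [Jp' /= pp']].
have D20 : 0 < D / 2 by rewrite divr_gt0.
have [|q Jq /andP[h1 h2]] := limit_set_perfect Jp' D20; first by lra.
exists q => //.
have := cabs_tri p' q p; have := cabs_tri p q p'; rewrite (cabsB p p') => h3 h4.
apply/andP; split; lra.
Qed.

End system.

(** * Uniform perfectness of the limit sets *)

(** Everything that enters the bound depends on [U], [X], [delta] and [eta] only: the
    distance [tau] of [X] from the complement of [U], the diameter bound [L] of [X], and
    [perfectness]. *)
Lemma uniform_modulus_bound (R : realType) (U X : set (C R)) (delta eta : R) :
  domain U -> compact X -> X `<=` U -> 0 < delta -> 0 < eta ->
  exists M : R, forall Phi : system R,
    conformal_nifs U X Phi -> mobius_system U Phi ->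
    limit_spread X Phi delta -> derivative_bounded_below X Phi eta ->
    forall (j : nat) (A : set (C R)) (m : R), annulus_modulus A m ->
      separates A (closure (limit_set X Phi j)) -> m <= M.
Proof.
move=> [_ oU _] cX XU delta0 eta0.
have [tau tau0 Htau] := compact_margin cX oU XU.
have [M0 M00 HM0] := compact_bdd cX.
pose L := 2 * M0.
have L0 : 0 < L by exact: mulr_gt0 (ltr0Sn _ 1) M00.
have HL (x y : C R) : X x -> X y -> cabs (x - y) <= L.
  move=> /HM0 h1 /HM0 h2; have := cabs_tri 0 x y; rewrite subr0 sub0r cabsN /L; lra.
pose k := perfectness tau L delta eta / 4.
have k0 : 0 < k by rewrite divr_gt0 // perfectness_gt0.
pose b := Num.min 1 (delta / L).
have b0 : 0 < b by rewrite lt_min ltr01 divr_gt0.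
pose B := Num.max 1 (2 / (k * b)).
exists (128 * 128 * B) => Phi [HN _] HM HS Hder j A m HA sep.
set F := closure (limit_set X Phi j) in sep.
have FX : F `<=` X by exact: (@closure_limit_set_sub R U X Phi cX XU HN j).
have [[_ oA _] dA _] := HA.
have [K1 [K2 [cK1 clK2 K12 KA sides]]] := sides_of_doubly_connected oA dA.
have [[p Fp K1p] [s0 Fs0 K2s0]] := sides F sep.
have [FA _] := sep.
(* Choosing [s] nearest to [p] forces the point [q], which is closer, into [K1]. *)
have cFK2 : compact (F `&` K2).
  apply: (subclosed_compact _ cX); last by move=> z [Fz _]; exact: FX.
  exact: closedI (@closed_closure _ (limit_set X Phi j)) clK2.
have [s [Fs K2s] sP] : exists2 s, (F `&` K2) s & forall z, (F `&` K2) z -> cabs (p - s) <= cabs (p - z).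
  have cf : {within F `&` K2, continuous (fun z => cabs (p - z))}.
    apply: within_continuousC => h _ e e0; exists e => // z _ hz.
    apply: le_lt_trans (cabs_dist _ _) _.
    by rewrite (_ : p - z - (p - h) = h - z) ?(cabsB h) //; ring.
  have [s] := compact_EVT_min (ex_intro _ s0 (conj Fs0 K2s0)) cFK2 cf.
  by rewrite inE => Ks H; exists s => // z Kz; apply: H; rewrite inE.
have ps : p != s.
  apply/eqP => e; have : (K1 `&` K2) p by split => //; rewrite e.
  by rewrite K12.
have sg0 : 0 < cabs (p - s) by rewrite cabs_gt0 subr_eq0.
have sgL : cabs (p - s) <= L by apply: HL; exact: FX.
pose D := Num.min (cabs (p - s)) delta / 2.
have mn0 : 0 < Num.min (cabs (p - s)) delta by rewrite lt_min sg0.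
have D0 : 0 < D by rewrite divr_gt0.
have [m1 m2] : Num.min (cabs (p - s)) delta <= cabs (p - s) /\ Num.min (cabs (p - s)) delta <= delta.
  by rewrite !ge_min !lexx orbT.
have Dd : D < delta by rewrite /D; lra.
have Ds : D < cabs (p - s) by rewrite /D; lra.
have [q Jq /andP[q1 q2]] :=
  closure_limit_set_perfect cX XU HN HM oU tau0 L0 delta0 eta0 Htau HL HS Hder Fp D0 Dd.
rewrite -/k in q1.
have Fq : F q by exact: subset_closure.
have K1q : K1 q.
  have [//|nK1] := lem (K1 q).
  have [K2q|nK2] := lem (K2 q).
    have := sP q (conj Fq K2q); rewrite (cabsB p q); lra.
  have Aq : A q.
    have [//|nA] := lem (A q).
    by have : (~` A) q by []; rewrite -KA => -[].
  by have : (F `&` A) q by []; rewrite FA.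
have pq0 : 0 < cabs (p - q) by rewrite (cabsB p) (lt_le_trans _ q1) // mulr_gt0.
apply: (modulus_bound HA cK1 clK2 K12 KA K1p K1q K2s).
- by rewrite -subr_eq0 -cabs_gt0.
- by rewrite /B le_max lexx.
have kb : 0 < k * b by exact: mulr_gt0 k0 b0.
have h1 : cabs (p - s) * b <= Num.min (cabs (p - s)) delta.
  rewrite le_min; apply/andP; split.
    by rewrite ler_piMr ?cabs_ge0 // ge_min lexx.
  have bL : b <= delta / L by rewrite ge_min lexx orbT.
  apply: le_trans (ler_wpM2l (ltW sg0) bL) _.
  by rewrite mulrA ler_pdivrMr // mulrC ler_wpM2l // ltW.
apply: le_trans (_ : 2 / (k * b) * cabs (p - q) <= _); last first.
  by rewrite ler_wpM2r ?cabs_ge0 // /B le_max lexx orbT.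
rewrite mulrAC ler_pdivlMr //.
rewrite (cabsB p q) /D in q1 *.
have h2 := ler_wpM2l (ltW k0) h1; lra.
Qed.

Theorem theorem1p1 (R : realType) (U X : set (C R))
    (domU : domain U) (compactX : compact X) (subXU : X `<=` U) :
  (forall Phi : system R,
    conformal_nifs U X Phi ->
    mobius_system U Phi ->
    (exists2 delta : R, 0 < delta & limit_spread X Phi delta) ->
    (exists2 eta : R, 0 < eta & derivative_bounded_below X Phi eta) ->
    forall j : nat, uniformly_perfect (closure (limit_set X Phi j))) /\
  (forall delta eta : R, 0 < delta -> 0 < eta ->
    exists M : R, forall Phi : system R,
      conformal_nifs U X Phi ->
      mobius_system U Phi ->
      limit_spread X Phi delta ->
      derivative_bounded_below X Phi eta ->
      forall (j : nat) (A : set (C R)) (m : R),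
        annulus_modulus A m ->
        separates A (closure (limit_set X Phi j)) ->
        m <= M).
Proof.
split; last by move=> delta eta delta0 eta0; exact: uniform_modulus_bound.
move=> Phi HP HM [delta delta0 HS] [eta eta0 Hder] j.
have [M HMod] := uniform_modulus_bound domU compactX subXU delta0 eta0.
split; last by exists M => A m; exact: HMod.
  apply: (subclosed_compact (@closed_closure _ _) compactX).
  exact: (@closure_limit_set_sub R U X Phi compactX subXU HP.1 j).
have [x [y [Jx Jy xy]]] := limit_set_spread subXU HP.1 HS j.
exists x, y; split; [exact: subset_closure|exact: subset_closure|].
by move=> e; move: xy; rewrite e subrr cabs0 leNgt delta0.
Qed.
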